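(* Let $p>2$ and let $\mu$ be a positive Borel measure on the unit circle $\mathbb{T}$, singular with respect to Lebesgue measure, such that for some constant $C>0$ $$\omega_\mu(t)\le C\,\frac{t}{\sqrt{\log\frac{e}{t}}}\qquad\text{for all } t\in(0,1).$$ Then the singular inner function $S_\mu$ is a multiplier of $D^p_{p-1}$.
   Context: $\mathbb{D}$ is the open unit disc; $|I|$ denotes the Lebesgue measure of an arc $I\subset\mathbb{T}$. The singular inner function associated with $\mu$ is $$S_\mu(z)=\exp\left\{-\int_0^{2\pi}\frac{e^{i\theta}+z}{e^{i\theta}-z}\,d\mu(\theta)\right\},\qquad z\in\mathbb{D}.$$ The modulus of smoothness of $\mu$ is $$\omega_\mu(t)=\sup\{|\mu(I)-\mu(J)| : I,J \text{ adjacent intervals (arcs) of } \mathbb{T},\ |I|=|J|\le t\}.$$ $D^p_{p-1}$ is the space of analytic functions $f$ on $\mathbb{D}$ with $$\|f\|_{D^p_{p-1}}=|f(0)|+\left(\int_{\mathbb{D}}(1-|z|)^{p-1}|f'(z)|^p\,dA(z)\right)^{1/p}<\infty,$$ where $dA$ is area measure. A function $h:\mathbb{D}\to\mathbb{C}$ is a multiplier of a function space $X$ on $\mathbb{D}$ if $hf\in X$ for all $f\in X$. *)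

(* Defs.v *)
From HB Require Import structures.
From mathcomp Require Import all_boot all_order all_algebra.
From mathcomp Require Import complex.
From mathcomp Require Import all_classical all_reals all_analysis.

Set Implicit Arguments.
Unset Strict Implicit.
Unset Printing Implicit Defensive.

Import Order.TTheory GRing.Theory Num.Theory ComplexField.Normc.
Import numFieldNormedType.Exports.

Local Open Scope classical_set_scope.
Local Open Scope complex_scope.
Local Open Scope ring_scope.

Section complex_plane.
Variable R : realType.
Implicit Types (z : R[i]) (f h : R[i] -> R[i]).

Definition unit_disc : set R[i] := [set z | normc z < 1].

Definition cexp z : R[i] :=
  (expR (complex.Re z) * cos (complex.Im z)) +i*
  (expR (complex.Re z) * sin (complex.Im z)).

(* [R[i]^o] is [R[i]] with its canonical topology, as a normed space over
   itself; differentiability and derivative are therefore the complex ones. *)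
Definition analytic_on (D : set R[i]) f :=
  forall z, D z -> derivable (f : R[i]^o -> R[i]^o) z 1.

Definition cderive f z : R[i] := 'D_1 (f : R[i]^o -> R[i]^o) z.

Definition area_measure := (@lebesgue_measure R \x @lebesgue_measure R)%E.

(* Functions on the disc are represented by total functions on [R[i]]: only
   the values taken on the disc matter here. *)
Definition D_norm (p : R) f : \bar R :=
  ((normc (f 0))%:E +
   (\int[area_measure]_(w in [set w : R * R | unit_disc (w.1 +i* w.2)])
      ((1 - normc (w.1 +i* w.2)) `^ (p - 1) *
       normc (cderive f (w.1 +i* w.2)) `^ p)%:E) `^ p^-1)%E.

Definition D_space (p : R) : set (R[i] -> R[i]) :=
  [set f | analytic_on unit_disc f /\ (D_norm p f < +oo)%E].

Definition multiplier (X : set (R[i] -> R[i])) h :=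
  forall f, X f -> X (h \* f).

End complex_plane.

Section circle.
Variable R : realType.

Definition unit_circle := {z : R[i] | normc z == 1}.

Lemma normc_cis (t : R) : normc (cos t +i* sin t) == 1.
Proof. by rewrite /normc /= cos2Dsin2 sqrtr1. Qed.

Definition cis_circle (t : R) : unit_circle :=
  exist (fun z : R[i] => normc z == 1) _ (normc_cis t).

HB.instance Definition _ := Choice.on unit_circle.
HB.instance Definition _ :=
  isPointed.Build unit_circle (cis_circle 0).

Definition circle_open : set (set unit_circle) :=
  [set A | exists2 U : set R[i]^o, open U & A = sval @^-1` U].

Definition circle := g_sigma_algebraType circle_open.

Definition cis (t : R) : circle := cis_circle t.

Definition circle_val (x : circle) : R[i] := sval x.

Definition arc_length (A : set circle) : \bar R :=
  lebesgue_measure (`[0, 2 * pi[ `&` cis @^-1` A).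

Definition singular_measure (mu : set circle -> \bar R) :=
  exists N : set circle,
    [/\ measurable N, arc_length N = 0%E & mu (~` N) = 0%E].

(* Two consecutive nondegenerate arcs [<a, m>] and [<m, b>], each endpoint
   being open or closed, with [m] in exactly one of them; together they wind
   at most once around the circle. *)
Definition adjacent_arcs (I J : set circle) :=
  exists a m b : R, exists sa sm sb : bool,
    [/\ a < m, m < b, b - a <= 2 * pi,
        I = cis @` [set` Interval (BSide sa a) (BSide sm m)] &
        J = cis @` [set` Interval (BSide sm m) (BSide sb b)]].

(* The value is an extended real: no finiteness of [mu] is presupposed.  As
   [+oo - +oo = -oo] in [\bar R], a finite value forces the arcs involved to
   have finite measure. *)
Definition modulus_of_smoothness (mu : set circle -> \bar R) (t : R) : \bar R :=
  ereal_sup [set x | exists I J : set circle,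
    [/\ adjacent_arcs I J, arc_length I = arc_length J,
        (arc_length J <= t%:E)%E & x = `|mu I - mu J|%E]].

Definition circle_integral (mu : {measure set circle -> \bar R})
    (F : circle -> R[i]) : R[i] :=
  (\int[mu]_x complex.Re (F x))%R +i* (\int[mu]_x complex.Im (F x))%R.

Definition singular_inner (mu : {measure set circle -> \bar R}) (z : R[i]) :
    R[i] :=
  cexp (- circle_integral mu
            (fun x => (circle_val x + z) / (circle_val x - z))).

End circle.

(* Main.v *)
Require Import Defs.
From HB Require Import structures.
From mathcomp Require Import all_boot all_order all_algebra.
From mathcomp Require Import complex.
From mathcomp Require Import all_classical all_reals all_analysis.
From mathcomp Require Import measurable_realfun.
From mathcomp Require Import ring lra.

Set Implicit Arguments.
Unset Strict Implicit.
Unset Printing Implicit Defensive.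

Import Order.TTheory GRing.Theory Num.Theory ComplexField.Normc.
Import numFieldNormedType.Exports.

Local Open Scope classical_set_scope.
Local Open Scope complex_scope.
Local Open Scope ring_scope.

(** Write [s = 1 - |z|^2], [lam s = 1 - ln s] and [q = p / 2], and let [S = S_mu].  As
    [(S f)' = S f' + S' f] and [|S| <= 1], multiplying by [S] keeps [f] in the space as soon as
    [(1 - |z|)^(p-1) |S' f|^p] is integrable, and this follows from two estimates:
    [|S'| <= K / (s sqrt (lam s))], and the finiteness of the integral of
    [s^-1 lam(s)^-q (1 + |f|^2)^q] over the disc.

    The first one ([herglotz_deriv_bound]) is where the modulus of smoothness enters.  One has
    [S = exp (- H)], with [H] the Herglotz integral of [mu], whose real part is nonnegative, so that
    [|S'| <= |H'|], and [H' (z)] is the integral of [2 u / (u - z)^2] against [mu].  Put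
    [delta = 1 - |z|] and read angles from [z / |z|].  This kernel has mean zero on the circle, so an
    affine function may be subtracted from the distribution function of [mu]; it is chosen so that
    the difference vanishes at [0] and at [delta].  The hypothesis bounds second differences, hence
    ([zygmund_bound]) the remainder at [t] by [delta / sqrt (lam delta)] times a power of
    [|t| / delta] lower than two, and an integration by parts ([stieltjes_bound]) against a kernel
    whose derivative has size [(delta + |t|)^-3] gives the claim.

    The second one ([weighted_finite]) is Green's formula for [(1 + |f|^2)^q] and a radial weight
    comparable to [s lam(s)^(1-q)] near the circle.  The Laplacian of the weight is at least a
    multiple of [s^-1 lam(s)^-q] there, because [q > 1], while the Laplacian of [(1 + |f|^2)^q] is
    at most a multiple of [(1 + |f|^2)^(q-1) |f'|^2].  Young's inequality absorbs the factor
    [(1 + |f|^2)^(q-1)] and leaves [s^(p-1) |f'|^p], whose integral is finite.  To avoid boundary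
    terms the weight is replaced by one that vanishes for [s <= tau], with estimates uniform in
    [tau] ([wG_laplacian]), and [tau] tends to zero.

    Green's formula needs second derivatives of [f], while analyticity only provides a first one;
    that the derivative is again differentiable is proved from Goursat's theorem
    ([has_cderive_cderive]). *)

(** * Modulus and complex derivative *)

Section complex_basics.
Variable R : realType.
Implicit Types (z w h : R[i]) (f g : R[i] -> R[i]).

Local Notation Re := complex.Re.
Local Notation Im := complex.Im.

Lemma normc_norm z : `|z| = (normc z)%:C.
Proof. by rewrite normc_def; case: z. Qed.

Lemma normcr_ge0 z : 0 <= normc z.
Proof. by case: z => a b /=; exact: sqrtr_ge0. Qed.

Lemma sqr_normcE z : normc z ^+ 2 = Re z ^+ 2 + Im z ^+ 2.
Proof. by case: z => a b /=; rewrite sqr_sqrtr// addr_ge0// sqr_ge0. Qed.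

Lemma le_normc_sqr z (r : R) : 0 <= r -> (normc z <= r) = (Re z ^+ 2 + Im z ^+ 2 <= r ^+ 2).
Proof. by move=> r0; rewrite -sqr_normcE ler_sqr// nnegrE normcr_ge0. Qed.

Lemma normc_eq0 z : (normc z == 0) = (z == 0).
Proof. by apply/eqP/eqP => [/eq0_normc//|->]; exact: normc0. Qed.

Lemma normc_gt0 z : (0 < normc z) = (z != 0).
Proof. by rewrite lt_def normcr_ge0 andbT normc_eq0. Qed.

Lemma normcBC z w : normc (z - w) = normc (w - z).
Proof. by rewrite -normcN opprB. Qed.

Lemma le_normcB z w : normc (z - w) <= normc z + normc w.
Proof. by rewrite -(normcN w); exact: le_normcD. Qed.

Lemma lerB_normcD z w : normc z - normc w <= normc (z + w).
Proof. by rewrite lerBlDr -{1}(addrK w z) (le_trans (le_normcD _ _))// normcN. Qed.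

Lemma lerB_normcB z w : normc z - normc w <= normc (z - w).
Proof. by rewrite -(normcN w); exact: lerB_normcD. Qed.

Lemma normc_real (r : R) : normc r%:C = `|r|.
Proof. by rewrite /= expr0n /= addr0 sqrtr_sqr. Qed.

Lemma cReM z w : Re (z * w) = Re z * Re w - Im z * Im w.
Proof. by case: z => a b; case: w. Qed.

Lemma cImM z w : Im (z * w) = Re z * Im w + Im z * Re w.
Proof. by case: z => a b; case: w. Qed.

Lemma cReD z w : Re (z + w) = Re z + Re w.
Proof. by case: z => a b; case: w. Qed.

Lemma cImD z w : Im (z + w) = Im z + Im w.
Proof. by case: z => a b; case: w. Qed.

Lemma cReN z : Re (- z) = - Re z.
Proof. by case: z. Qed.

Lemma cImN z : Im (- z) = - Im z.
Proof. by case: z. Qed.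

Lemma normRe_le z : `|Re z| <= normc z.
Proof.
rewrite -ler_sqr ?nnegrE ?normcr_ge0// sqr_normcE real_normK ?num_real//.
by rewrite lerDl sqr_ge0.
Qed.

Lemma normIm_le z : `|Im z| <= normc z.
Proof.
rewrite -ler_sqr ?nnegrE ?normcr_ge0// sqr_normcE real_normK ?num_real//.
by rewrite lerDr sqr_ge0.
Qed.

Lemma normc_leReIm z : normc z <= `|Re z| + `|Im z|.
Proof.
rewrite le_normc_sqr ?addr_ge0// sqrrD !real_normK ?num_real//.
by have := mulr_ge0 (normr_ge0 (Re z)) (normr_ge0 (Im z)); lra.
Qed.

(** Complex differentiability with real tolerances only: the estimates below are about [normc], and
    the filters of [R[i]] only appear in the comparison with [derivable]. *)
Definition has_cderive f z (L : R[i]) :=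
  forall e : R, 0 < e -> exists2 d : R, 0 < d & forall h,
    normc h < d -> normc (f (z + h) - f z - L * h) <= e * normc h.

Lemma cgt0_real (e : R[i]) : 0 < e -> exists2 r : R, 0 < r & e = r%:C.
Proof. by case: e => a b; rewrite ltcE /= => /andP[/eqP -> a0]; exists a. Qed.

Lemma has_cderiveP f z L : has_cderive f z L <->
  (fun h : R[i]^o => h^-1 *: (f (h *: (1 : R[i]^o) + z) - f z : R[i]^o)) @ (0 : R[i]^o)^' --> (L : R[i]^o).
Proof.
split=> [fL|].
  apply/cvgrPdist_le => e /cgt0_real[r r0 ->].
  have [d d0 H] := fL _ r0.
  near=> h.
  have h0 : h != 0 by near: h; exact: nbhs_dnbhs_neq.
  have hd : normc h < d.
    rewrite -ltcR -normc_norm; near: h.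
    by apply: (@dnbhs0_lt _ R[i]^o); rewrite ltcR.
  have nh0 : 0 < normc h by rewrite normc_gt0.
  have := H _ hd.
  rewrite /GRing.scale /= mulr1 (addrC h z) normc_norm lecR => H'.
  rewrite -(ler_pM2r nh0) -normcM mulrBl normcBC mulrAC mulVf// mul1r.
  exact: H'.
move=> /cvgrPdist_le fL e e0.
have /fL : 0 < e%:C by rewrite ltcR.
rewrite -nbhs_nearE /dnbhs /within /= => -[d /= d0 H].
case/cgt0_real: d0 H => r r0 -> H.
exists r => // h hr.
have [->|h0] := eqVneq h 0; first by rewrite addr0 subrr mulr0 subrr normc0 mulr0.
have := H h; rewrite /ball_ /= sub0r normrN normc_norm ltcR => /(_ hr h0).
rewrite /GRing.scale /= mulr1 (addrC h z) normc_norm lecR => H'.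
have nh0 : 0 < normc h by rewrite normc_gt0.
by move: H'; rewrite -(ler_pM2r nh0) -normcM mulrBl normcBC mulrAC mulVf// mul1r.
Unshelve. all: end_near. Qed.

Lemma has_cderive_derivable f z L : has_cderive f z L ->
  derivable (f : R[i]^o -> R[i]^o) z 1 /\ cderive f z = L.
Proof.
move=> /has_cderiveP fL; split; first by apply/cvg_ex; exists L.
by rewrite /cderive /derive; apply: (cvg_lim _ fL).
Qed.

Lemma derivable_has_cderive f z : derivable (f : R[i]^o -> R[i]^o) z 1 ->
  has_cderive f z (cderive f z).
Proof. by move=> df; apply/has_cderiveP; exact: df. Qed.

Lemma has_cderiveE f z L : has_cderive f z L -> is_derive (z : R[i]^o) 1 (f : R[i]^o -> R[i]^o) L.
Proof. by move=> /has_cderive_derivable[df <-]; apply: DeriveDef. Qed.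

Lemma is_derive_cderive f z L :
  is_derive (z : R[i]^o) 1 (f : R[i]^o -> R[i]^o) L -> has_cderive f z L.
Proof. by move=> [df <-]; exact: derivable_has_cderive. Qed.

Lemma has_cderive_cst (c : R[i]) z : has_cderive (fun=> c) z 0.
Proof. by apply: is_derive_cderive; exact: is_derive_cst. Qed.

Lemma has_cderive_id z : has_cderive id z 1.
Proof. by apply: is_derive_cderive; exact: is_derive_id. Qed.

Lemma has_cderiveD f g z L M : has_cderive f z L -> has_cderive g z M ->
  has_cderive (fun w => f w + g w) z (L + M).
Proof.
move=> /has_cderiveE fL /has_cderiveE gM; exact: is_derive_cderive.
Qed.

Lemma has_cderiveN f z L : has_cderive f z L -> has_cderive (fun w => - f w) z (- L).
Proof.
move=> /has_cderiveE fL; exact: is_derive_cderive.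
Qed.

Lemma has_cderiveB f g z L M : has_cderive f z L -> has_cderive g z M ->
  has_cderive (fun w => f w - g w) z (L - M).
Proof. by move=> fL gM; apply: has_cderiveD => //; exact: has_cderiveN. Qed.

Lemma has_cderiveM f g z L M : has_cderive f z L -> has_cderive g z M ->
  has_cderive (fun w => f w * g w) z (f z * M + g z * L).
Proof.
move=> /has_cderiveE fL /has_cderiveE gM; exact: is_derive_cderive.
Qed.

Lemma has_cderive_lipschitz f z L : has_cderive f z L -> exists2 d, 0 < d &
  forall h, normc h < d -> normc (f (z + h) - f z) <= (normc L + 1) * normc h.
Proof.
move=> /(_ 1 ltr01)[d d0 H]; exists d => // h /H.
rewrite mul1r => H'; rewrite mulrDl mul1r [leRHS]addrC -normcM.
rewrite -{1}(subrK (L * h) (f (z + h) - f z)).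
by rewrite (le_trans (le_normcD _ _))// lerD2r.
Qed.

Lemma has_cderive_comp f g z L M : has_cderive f z L -> has_cderive g (f z) M ->
  has_cderive (g \o f) z (M * L).
Proof.
move=> fL gM e e0.
have [d d0 fLip] := has_cderive_lipschitz fL.
pose A := normc L + 1; have A0 : 0 < A by rewrite /A ltr_pwDr ?normcr_ge0.
pose B := normc M + 1; have B0 : 0 < B by rewrite /B ltr_pwDr ?normcr_ge0.
have [d1 d10 H1] := gM (e / 2 / A) ltac:(by rewrite !divr_gt0).
have [d2 d20 H2] := fL (e / 2 / B) ltac:(by rewrite !divr_gt0).
exists (Num.min d (Num.min d2 (d1 / A))); first by rewrite !lt_min d0 d20 divr_gt0.
move=> h; rewrite !lt_min => /and3P[hd hd2 hd1] /=.
set k := f (z + h) - f z.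
have kA : normc k <= A * normc h by exact: fLip.
have kd1 : normc k < d1 by rewrite (le_lt_trans kA)// mulrC -ltr_pdivlMr.
have fk : f z + k = f (z + h) by rewrite /k addrC subrK.
have := H1 _ kd1; rewrite fk => h1; have := H2 _ hd2; rewrite -/k => h2.
have -> : g (f (z + h)) - g (f z) - M * L * h =
  (g (f (z + h)) - g (f z) - M * k) + M * (k - L * h) by ring.
rewrite (le_trans (le_normcD _ _))// normcM.
have -> : e * normc h = e / 2 / A * (A * normc h) + B * (e / 2 / B * normc h).
  by field; rewrite !gt_eqF.
apply: lerD.
  by rewrite (le_trans h1)// ler_wpM2l// !divr_ge0 ?ltW.
apply: ler_pM; rewrite ?normcr_ge0//.
by rewrite /B lerDl.
Qed.

Lemma real_is_derive (phi : R -> R) (t l : R) :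
  (forall e, 0 < e -> exists2 d, 0 < d & forall h : R,
     `|h| < d -> `|phi (t + h) - phi t - h * l| <= e * `|h|) ->
  is_derive t 1 phi l.
Proof.
move=> H.
have fl : (fun h : R => h^-1 *: (phi (h *: 1 + t) - phi t)) @ 0^' --> l.
  apply/cvgrPdist_le => e /H[d d0 {}H].
  near=> h.
  have h0 : h != 0 by near: h; exact: nbhs_dnbhs_neq.
  have hd : `|h| < d by near: h; exact: dnbhs0_lt.
  have nh0 : 0 < `|h| by rewrite normr_gt0.
  have := H _ hd.
  rewrite /GRing.scale /= mulr1 (addrC h t) => H'.
  rewrite -(ler_pM2r nh0) -normrM mulrBl distrC mulrAC mulVf// mul1r.
  by rewrite (mulrC l).
apply: DeriveDef; first by apply/cvg_ex; exists l.
exact: cvg_lim fl.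
Unshelve. all: end_near. Qed.

(** This turns complex derivatives into real ones: horizontal and vertical lines give the partial
    derivatives used by Green's formula, and vertical lines in the exponent give angular ones. *)
Lemma is_derive_line f z w (t : R) L : has_cderive f (z + t%:C * w) L ->
  is_derive t 1 (fun t : R => Re (f (z + t%:C * w))) (Re (L * w)) /\
  is_derive t 1 (fun t : R => Im (f (z + t%:C * w))) (Im (L * w)).
Proof.
move=> fL.
have H (e : R) : 0 < e -> exists2 d, 0 < d & forall h : R, `|h| < d ->
    normc (f (z + (t + h)%:C * w) - f (z + t%:C * w) - h%:C * (L * w)) <= e * `|h|.
  move=> e0; pose A := normc w + 1; have A0 : 0 < A by rewrite /A ltr_pwDr ?normcr_ge0.
  have [d d0 H] := fL (e / A) ltac:(by rewrite divr_gt0).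
  exists (d / A); first by rewrite divr_gt0.
  move=> h hd.
  have hA : normc (h%:C * w) <= `|h| * A.
    by rewrite normcM normc_real ler_wpM2l// lerDl.
  have /H : normc (h%:C * w) < d by rewrite (le_lt_trans hA)// -ltr_pdivlMr.
  have -> : z + (t + h)%:C * w = z + t%:C * w + h%:C * w.
    by rewrite rmorphD mulrDl addrA.
  rewrite [L * (_ * _)]mulrCA => /le_trans; apply.
  by rewrite mulrAC ler_pdivrMr// -mulrA ler_pM2l.
split; apply: real_is_derive => e /H[d d0 {}H]; exists d => // h /H; apply: le_trans.
- apply: le_trans (normRe_le _).
  by rewrite !cReD !cReN [Re (h%:C * _)]cReM /= mul0r subr0.
- apply: le_trans (normIm_le _).
  by rewrite !cImD !cImN [Im (h%:C * _)]cImM /= mul0r addr0.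
Qed.

End complex_basics.

Arguments normc : simpl never.

(** * Integrals over a segment *)

Section segment_integral.
Variable R : realType.
Local Notation mu := (@lebesgue_measure R).
Local Notation Re := (@complex.Re R).
Local Notation Im := (@complex.Im R).
Implicit Types (phi psi : R -> R) (a b m : R) (u v : R -> R[i]).

(** Continuity in the whole line at each point of the segment is asked, which is what the functions
    below have and spares one-sided limits in the fundamental theorem of calculus. *)
Definition cont_on a b phi := forall x, a <= x <= b -> {for x, continuous phi}.

Lemma cont_onS a b a' b' phi : a <= a' -> b' <= b -> cont_on a b phi -> cont_on a' b' phi.
Proof.
move=> aa bb c x /andP[ax xb]; apply: c.
by rewrite (le_trans aa)//= (le_trans xb).
Qed.

Lemma cont_on_within a b phi : cont_on a b phi -> {within `[a, b], continuous phi}.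
Proof.
move=> c; apply: continuous_in_subspaceT => x; rewrite inE /= in_itv /=.
exact: c.
Qed.

Lemma cont_on_integrable a b phi : cont_on a b phi -> mu.-integrable `[a, b] (EFin \o phi).
Proof.
move=> c; apply: continuous_compact_integrable; first exact: segment_compact.
exact: cont_on_within.
Qed.

Definition sint a b phi : R := (\int[mu]_(x in `[a, b]) phi x)%R.

Lemma sint_split a m b phi : a <= m -> m <= b -> cont_on a b phi ->
  sint a b phi = sint a m phi + sint m b phi.
Proof.
move=> am mb c; have := @Rintegral_itvB R phi (BLeft a) (BRight b) m.
have/[swap]/[apply] := cont_on_integrable c.
rewrite !bnd_simp => /(_ am mb) H.
rewrite /sint -(@Rintegral_itv_obnd_cbnd _ m); last first.
  apply: (@integrableS _ _ _ mu `[a, b]) => //; last exact: cont_on_integrable.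
  by apply: subset_itvr; rewrite bnd_simp.
by rewrite -H addrC subrK.
Qed.

Lemma sintD a b phi psi : cont_on a b phi -> cont_on a b psi ->
  sint a b (fun x => phi x + psi x) = sint a b phi + sint a b psi.
Proof. by move=> c d; rewrite /sint RintegralD//; exact: cont_on_integrable. Qed.

Lemma sintZ a b k phi : cont_on a b phi ->
  sint a b (fun x => k * phi x) = k * sint a b phi.
Proof. by move=> c; rewrite /sint RintegralZl//; exact: cont_on_integrable. Qed.

Lemma sintB a b phi psi : cont_on a b phi -> cont_on a b psi ->
  sint a b (fun x => phi x - psi x) = sint a b phi - sint a b psi.
Proof. by move=> c d; rewrite /sint RintegralB//; exact: cont_on_integrable. Qed.

Lemma sint_cst a b k : a <= b -> sint a b (fun=> k) = k * (b - a).
Proof.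
move=> ab; rewrite /sint Rintegral_cst//= lebesgue_measure_itv/= lte_fin.
case: ltP => [//|ba].
by have -> : b = a by [apply/eqP; rewrite eq_le ab ba]; rewrite subrr.
Qed.

Lemma eq_sint a b phi psi : (forall x, a <= x <= b -> phi x = psi x) ->
  sint a b phi = sint a b psi.
Proof.
move=> e; apply: eq_Rintegral => x; rewrite inE /= in_itv /=; exact: e.
Qed.

Lemma le_sint a b phi psi : cont_on a b phi -> cont_on a b psi ->
  (forall x, a <= x <= b -> phi x <= psi x) -> sint a b phi <= sint a b psi.
Proof.
by move=> c d e; apply: le_Rintegral => //; exact: cont_on_integrable.
Qed.

Lemma cont_on_cst a b k : cont_on a b (fun=> k).
Proof. by move=> x _; exact: cst_continuous. Qed.

Lemma sint_bound a b phi K : a <= b -> cont_on a b phi ->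
  (forall x, a <= x <= b -> `|phi x| <= K) -> `|sint a b phi| <= K * (b - a).
Proof.
move=> ab c H; rewrite ler_norml; apply/andP; split.
  rewrite -mulNr -sint_cst//; apply: le_sint => // [|x /H]; first exact: cont_on_cst.
  by rewrite ler_norml => /andP[].
rewrite -sint_cst//; apply: le_sint => // [|x /H]; first exact: cont_on_cst.
by rewrite ler_norml => /andP[].
Qed.

Lemma sint_FTC a b phi Phi : a <= b -> cont_on a b phi ->
  (forall x, a <= x <= b -> is_derive x 1 Phi (phi x)) -> sint a b phi = Phi b - Phi a.
Proof.
rewrite le_eqVlt => /predU1P[<- _ _|ab c H].
  by rewrite /sint set_itv1 Rintegral_set1 subrr.
have dc x : a <= x <= b -> {for x, continuous Phi}.
  by move=> /H[dx _]; apply/differentiable_continuous/derivable1_diffP.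
rewrite /sint /Rintegral (@continuous_FTC2 _ _ Phi)//.
- exact: cont_on_within.
- split.
  + by move=> x; rewrite in_itv /= => /andP[ax xb]; have [] := H x ltac:(by rewrite !ltW).
  + by apply: cvg_at_right_filter; apply: dc; rewrite lexx ltW.
  + by apply: cvg_at_left_filter; apply: dc; rewrite lexx ltW.
- move=> x; rewrite in_itv /= => /andP[ax xb]; rewrite derive1E.
  by have [_ ->] := H x ltac:(by rewrite !ltW).
Qed.

Definition ccont_on a b u := cont_on a b (Re \o u) /\ cont_on a b (Im \o u).

Definition csint a b u : R[i] := sint a b (Re \o u) +i* sint a b (Im \o u).

Lemma csint_split a m b u : a <= m -> m <= b -> ccont_on a b u ->
  csint a b u = csint a m u + csint m b u.
Proof. by move=> am mb [c d]; rewrite /csint (sint_split am mb c) (sint_split am mb d). Qed.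

Lemma eq_csint a b u v : (forall x, a <= x <= b -> u x = v x) -> csint a b u = csint a b v.
Proof. by move=> e; rewrite /csint; congr (_ +i* _); apply: eq_sint => x /e /= ->. Qed.

Lemma csintB a b u v : ccont_on a b u -> ccont_on a b v ->
  csint a b (fun x => u x - v x) = csint a b u - csint a b v.
Proof.
move=> [c d] [c' d'].
have -> : csint a b u - csint a b v = (sint a b (Re \o u) - sint a b (Re \o v)) +i*
  (sint a b (Im \o u) - sint a b (Im \o v)) by [].
by rewrite -!sintB//; congr (_ +i* _); apply: eq_sint => x _ /=; rewrite ?cReD ?cImD ?cReN ?cImN.
Qed.

(** The two coordinates are bounded separately, hence the factor two. *)
Lemma csint_bound a b u K : a <= b -> ccont_on a b u ->
  (forall x, a <= x <= b -> normc (u x) <= K) -> normc (csint a b u) <= 2 * K * (b - a).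
Proof.
move=> ab [c d] H; apply: le_trans (normc_leReIm _) _ => /=.
rewrite -mulrA mulr_natl mulr2n; apply: lerD; apply: sint_bound => // x /H;
  apply: le_trans.
- exact: normRe_le.
- exact: normIm_le.
Qed.

Lemma csint_FTC a b g G z w : a <= b ->
  (forall x, a <= x <= b -> has_cderive G (z + x%:C * w) (g (z + x%:C * w))) ->
  ccont_on a b (fun x => g (z + x%:C * w) * w) ->
  csint a b (fun x => g (z + x%:C * w) * w) = G (z + b%:C * w) - G (z + a%:C * w).
Proof.
move=> ab H [c d]; rewrite /csint.
rewrite (sint_FTC ab c (fun x h => (is_derive_line (H x h)).1)).
rewrite (sint_FTC ab d (fun x h => (is_derive_line (H x h)).2)).
by case: (G _) => ? ?; case: (G _) => ? ?.
Qed.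

Lemma has_cderive_line_cont g z w (t : R) L : has_cderive g (z + t%:C * w) L ->
  {for t, continuous (fun x : R => Re (g (z + x%:C * w)))} /\
  {for t, continuous (fun x : R => Im (g (z + x%:C * w)))}.
Proof.
move=> /is_derive_line[[d _] [d' _]].
by split; apply/differentiable_continuous/derivable1_diffP.
Qed.

Lemma has_cderive_ccont_on a b g z w :
  (forall x : R, a <= x <= b -> exists L, has_cderive g (z + x%:C * w) L) ->
  ccont_on a b (fun x => g (z + x%:C * w)).
Proof. by move=> H; split=> x /H[L] /has_cderive_line_cont[]. Qed.

Lemma ccont_onZ a b u k : ccont_on a b u -> ccont_on a b (fun x => u x * k).
Proof.
move=> [c d]; split => x xab.
- have -> : Re \o (fun x => u x * k) = fun y => Re (u y) * Re k - Im (u y) * Im k.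
    by apply/funext => y; rewrite /= cReM.
  by apply: cvgB; apply: cvgM; [exact: c|exact: cvg_cst|exact: d|exact: cvg_cst].
- have -> : Im \o (fun x => u x * k) = fun y => Re (u y) * Im k + Im (u y) * Re k.
    by apply/funext => y; rewrite /= cImM.
  by apply: cvgD; apply: cvgM; [exact: c|exact: cvg_cst|exact: d|exact: cvg_cst].
Qed.

Lemma csintZ a b u k : ccont_on a b u ->
  csint a b (fun x => u x * k) = csint a b u * k.
Proof.
move=> [c d].
have cR l : cont_on a b (fun x => l * Re (u x)).
  by move=> x /c cx; apply: cvgM; [exact: cvg_cst|exact: cx].
have cI l : cont_on a b (fun x => l * Im (u x)).
  by move=> x /d dx; apply: cvgM; [exact: cvg_cst|exact: dx].
apply/eqP; rewrite eq_complex /=; apply/andP; split; apply/eqP.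
  transitivity (sint a b (fun x => Re k * Re (u x) - Im k * Im (u x))).
    by apply: eq_sint => x _ /=; rewrite cReM; ring.
  by rewrite sintB// !sintZ// cReM /csint /comp /=; ring.
transitivity (sint a b (fun x => Im k * Re (u x) + Re k * Im (u x))).
  by apply: eq_sint => x _ /=; rewrite cImM; ring.
by rewrite sintD// !sintZ// cImM /csint /comp /=; ring.
Qed.

Lemma csint_cst a b k : a <= b -> csint a b (fun=> k) = (b - a)%:C * k.
Proof.
by move=> ab; apply/eqP; rewrite eq_complex cReM cImM /= !sint_cst//; apply/andP; split; apply/eqP; ring.
Qed.

Lemma ccont_onD a b u v : ccont_on a b u -> ccont_on a b v -> ccont_on a b (fun x => u x + v x).
Proof.
move=> [c d] [c' d']; split => x xab.
- have -> : Re \o (fun x => u x + v x) = (Re \o u) \+ (Re \o v).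
    by apply/funext => y; rewrite /= cReD.
  by apply: continuousD; [exact: c|exact: c'].
- have -> : Im \o (fun x => u x + v x) = (Im \o u) \+ (Im \o v).
    by apply/funext => y; rewrite /= cImD.
  by apply: continuousD; [exact: d|exact: d'].
Qed.

End segment_integral.

(** * Goursat's theorem on rectangles *)

Section goursat.
Variable R : realType.
Local Notation Re := (@complex.Re R).
Local Notation Im := (@complex.Im R).
Implicit Types (g : R[i] -> R[i]) (a c w h : R).

(** The parametrisations are kept in the form [z + t * w] so that [is_derive_line] applies to them
    as they stand; [vside] includes the factor [i] of [dz]. *)
Definition hside g c (x : R) : R[i] := g (0 +i* c + x%:C * 1).
Definition vside g a (y : R) : R[i] := g (a%:C + y%:C * 'i%C) * 'i%C.

(** The counterclockwise boundary integral of the rectangle with lower left corner [a + i c]. *)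
Definition rect_int g a c w h : R[i] :=
  csint c (c + h) (vside g (a + w)) - csint c (c + h) (vside g a) -
  (csint a (a + w) (hside g (c + h)) - csint a (a + w) (hside g c)).

Definition in_rect a c w h (z : R[i]) := a <= Re z <= a + w /\ c <= Im z <= c + h.

Lemma hside_pt c (x : R) : 0 +i* c + x%:C * 1 = x +i* c :> R[i].
Proof. by rewrite mulr1; apply/eqP; rewrite eq_complex /= add0r addr0 !eqxx. Qed.

Lemma vside_pt a (y : R) : a%:C + y%:C * 'i%C = a +i* y :> R[i].
Proof. by apply/eqP; rewrite eq_complex /=; apply/andP; split; apply/eqP; ring. Qed.

Definition cdiff_on (D : set R[i]) g := forall z, D z -> exists L, has_cderive g z L.

Lemma cdiff_onS (D D' : set R[i]) g : D' `<=` D -> cdiff_on D g -> cdiff_on D' g.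
Proof. by move=> DD H z /DD /H. Qed.

Lemma hside_cont g a b c : cdiff_on [set z | a <= Re z <= b /\ Im z = c] g ->
  ccont_on a b (hside g c).
Proof. by move=> H; apply: has_cderive_ccont_on => x xab; apply: H; rewrite hside_pt. Qed.

Lemma vside_cont g a c d : cdiff_on [set z | Re z = a /\ c <= Im z <= d] g ->
  ccont_on c d (vside g a).
Proof.
move=> H; apply: ccont_onZ; apply: has_cderive_ccont_on => x xab.
by apply: H; rewrite vside_pt.
Qed.

Lemma rect_cont g a c w h : 0 <= w -> 0 <= h -> cdiff_on (in_rect a c w h) g ->
  [/\ ccont_on c (c + h) (vside g (a + w)), ccont_on c (c + h) (vside g a),
   ccont_on a (a + w) (hside g (c + h)) & ccont_on a (a + w) (hside g c)].
Proof.
move=> w0 h0 H; split.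
- by apply: vside_cont => z /= [zr zi]; apply: H; split=> //; rewrite zr lexx lerDl w0.
- by apply: vside_cont => z /= [zr zi]; apply: H; split=> //; rewrite zr lexx lerDl w0.
- by apply: hside_cont => z /= [zr zi]; apply: H; split=> //; rewrite zi lexx lerDl h0.
- by apply: hside_cont => z /= [zr zi]; apply: H; split=> //; rewrite zi lexx lerDl h0.
Qed.

Lemma rect_int_split g a c w h : 0 <= w -> 0 <= h -> cdiff_on (in_rect a c (w + w) (h + h)) g ->
  rect_int g a c (w + w) (h + h) = (rect_int g a c w h + rect_int g (a + w) c w h) +
    (rect_int g a (c + h) w h + rect_int g (a + w) (c + h) w h).
Proof.
move=> w0 h0 H.
have V x : a <= x <= a + (w + w) -> csint c (c + (h + h)) (vside g x) =
    csint c (c + h) (vside g x) + csint (c + h) (c + h + h) (vside g x).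
  move=> xa; rewrite addrA; apply: csint_split; rewrite ?lerDl//.
  by rewrite -addrA; apply: vside_cont => z /= [zr zi]; apply: H; split; rewrite ?zr.
have Z y : c <= y <= c + (h + h) -> csint a (a + (w + w)) (hside g y) =
    csint a (a + w) (hside g y) + csint (a + w) (a + w + w) (hside g y).
  move=> yc; rewrite addrA; apply: csint_split; rewrite ?lerDl//.
  by rewrite -addrA; apply: hside_cont => z /= [zr zi]; apply: H; split; rewrite ?zi.
rewrite /rect_int !V ?Z; try by apply/andP; split; lra.
by rewrite !addrA; ring.
Qed.

Lemma rect_intB g k a c w h : 0 <= w -> 0 <= h ->
  cdiff_on (in_rect a c w h) g -> cdiff_on (in_rect a c w h) k ->
  rect_int (fun z => g z - k z) a c w h = rect_int g a c w h - rect_int k a c w h.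
Proof.
move=> w0 h0 /(rect_cont w0 h0)[c1 c2 c3 c4] /(rect_cont w0 h0)[d1 d2 d3 d4].
have E x : vside (fun z => g z - k z) x = (fun y => vside g x y - vside k x y).
  by apply/funext => y; rewrite /vside mulrBl.
rewrite /rect_int !E !csintB//; ring.
Qed.

Lemma rect_int_primitive g G a c w h : 0 <= w -> 0 <= h ->
  (forall z, in_rect a c w h z -> has_cderive G z (g z)) -> cdiff_on (in_rect a c w h) g ->
  rect_int g a c w h = 0.
Proof.
move=> w0 h0 H /(rect_cont w0 h0)[c1 c2 c3 c4].
have V x : a <= x <= a + w -> ccont_on c (c + h) (vside g x) ->
    csint c (c + h) (vside g x) = G (x +i* (c + h)) - G (x +i* c).
  move=> xa cx; rewrite /vside (@csint_FTC _ _ _ _ G) ?lerDl ?vside_pt// => y yc.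
  by rewrite vside_pt; exact: H.
have Z y : c <= y <= c + h -> ccont_on a (a + w) (hside g y) ->
    csint a (a + w) (hside g y) = G ((a + w) +i* y) - G (a +i* y).
  move=> yc cy.
  have E : hside g y = (fun x : R => g ((0 +i* y) + x%:C * 1) * 1).
    by apply/funext => x; rewrite mulr1.
  rewrite E (@csint_FTC _ _ _ _ G) ?lerDl ?hside_pt//; last by rewrite -E.
  by move=> x xa; rewrite hside_pt; exact: H.
rewrite /rect_int !V// ?Z//; try by rewrite lexx lerDl.
all: try by rewrite lexx andbT lerDl.
ring.
Qed.

Lemma rect_int_bound g a c w h K : 0 <= w -> 0 <= h -> cdiff_on (in_rect a c w h) g ->
  (forall z, in_rect a c w h z -> normc (g z) <= K) ->
  normc (rect_int g a c w h) <= 4 * K * (w + h).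
Proof.
move=> w0 h0 /(rect_cont w0 h0)[c1 c2 c3 c4] H.
have V x : a <= x <= a + w -> ccont_on c (c + h) (vside g x) ->
    normc (csint c (c + h) (vside g x)) <= 2 * K * h.
  move=> xa cx; rewrite -[leRHS]/(2 * K * h) -{2}(addKr c h) (addrC (- c)).
  apply: csint_bound => //; first by rewrite lerDl.
  move=> y yc; rewrite /vside normcM vside_pt.
  have -> : normc 'i%C = 1 :> R by rewrite /normc expr0n expr1n /= add0r sqrtr1.
  by rewrite mulr1; apply: H.
have Z y : c <= y <= c + h -> ccont_on a (a + w) (hside g y) ->
    normc (csint a (a + w) (hside g y)) <= 2 * K * w.
  move=> yc cy; rewrite -[leRHS]/(2 * K * w) -{2}(addKr a w) (addrC (- a)).
  apply: csint_bound => //; first by rewrite lerDl.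
  by move=> x xa; rewrite /hside hside_pt; apply: H.
have := V (a + w) ltac:(by rewrite lexx lerDl w0) c1.
have := V a ltac:(by rewrite lexx lerDl w0) c2.
have := Z (c + h) ltac:(by rewrite lexx lerDl h0) c3.
have := Z c ltac:(by rewrite lexx lerDl h0) c4.
have := le_normcB (csint c (c + h) (vside g (a + w))) (csint c (c + h) (vside g a)).
have := le_normcB (csint a (a + w) (hside g (c + h))) (csint a (a + w) (hside g c)).
move=> ? ? ? ? ? ?.
rewrite /rect_int (le_trans (le_normcB _ _))//; lra.
Qed.

Lemma in_rectS a c w h a' c' w' h' : a <= a' -> a' + w' <= a + w -> c <= c' -> c' + h' <= c + h ->
  in_rect a' c' w' h' `<=` in_rect a c w h.
Proof.
move=> h1 h2 h3 h4 z [/andP[z1 z2] /andP[z3 z4]]; split; apply/andP; split; lra.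
Qed.

Lemma linear_cderive (A B z0 z : R[i]) :
  has_cderive (fun z => A * z + B * ((z - z0) * (z - z0)) / 2) z (A + B * (z - z0)).
Proof.
have d := has_cderiveB (has_cderive_id z) (has_cderive_cst z0 z).
have := has_cderiveD (has_cderiveM (has_cderive_cst A z) (has_cderive_id z))
   (has_cderiveM (has_cderiveM (has_cderive_cst B z) (has_cderiveM d d)) (has_cderive_cst 2^-1 z)).
rewrite /=; set L := (X in has_cderive _ _ X) => H.
by have -> : A + B * (z - z0) = L by rewrite /L; field.
Qed.

(** Repeated halving produces nested rectangles on which the boundary integral decreases at most by
    the factor [4] of the areas.  At the common point [z0] the function differs from its linear part,
    which has a primitive, by [e |z - z0|], so that for small [e] the integral is smaller than that. *)
Lemma goursat g a c w h : 0 < w -> 0 < h -> cdiff_on (in_rect a c w h) g ->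
  rect_int g a c w h = 0.
Proof.
move=> w0 h0 dg.
apply/eqP; rewrite -normc_eq0; apply/negPn/negP => nz.
pose eta := normc (rect_int g a c w h).
have eta0 : 0 < eta by rewrite lt_def nz normcr_ge0.
pose wn n := w / 2 ^+ n; pose hn n := h / 2 ^+ n.
have wn0 n : 0 < wn n by rewrite divr_gt0 ?exprn_gt0.
have hn0 n : 0 < hn n by rewrite divr_gt0 ?exprn_gt0.
have wnS n : wn n = wn n.+1 + wn n.+1.
  by rewrite /wn exprS; field; rewrite expf_neq0.
have hnS n : hn n = hn n.+1 + hn n.+1.
  by rewrite /hn exprS; field; rewrite expf_neq0.
(* [bad n p]: [p] is the lower left corner of a rectangle of the [n]-th generation, inside the given
   one, whose boundary integral is at least [eta / 4 ^ n]; [choice] selects nested ones. *)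
pose bad n (p : R * R) := [/\ a <= p.1, p.1 + wn n <= a + w, c <= p.2, p.2 + hn n <= c + h &
   eta / 4 ^+ n <= normc (rect_int g p.1 p.2 (wn n) (hn n))].
have step (np : nat * (R * R)) : exists p' : R * R, bad np.1 np.2 -> [/\ bad np.1.+1 p',
    np.2.1 <= p'.1, p'.1 + wn np.1.+1 <= np.2.1 + wn np.1,
    np.2.2 <= p'.2 & p'.2 + hn np.1.+1 <= np.2.2 + hn np.1].
  case: np => n [x y] /=.
  apply: contrapT => /forallNP H.
  have [[b1 b2 b3 b4 b5]|nb] := pselect (bad n (x, y)); last by apply: (H (0, 0)) => /nb.
  rewrite /= in b1 b2 b3 b4.
  have sm (x' y' : R) : x <= x' -> x' + wn n.+1 <= x + wn n -> y <= y' ->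
      y' + hn n.+1 <= y + hn n ->
      normc (rect_int g x' y' (wn n.+1) (hn n.+1)) < eta / 4 ^+ n.+1.
    move=> p1 p2 p3 p4; rewrite ltNge; apply/negP => p5; apply: (H (x', y')) => _.
    by split=> //; split => //=; lra.
  have w1 := ltW (wn0 n.+1); have h1 := ltW (hn0 n.+1).
    have wE := wnS n; have hE := hnS n.
  have dgs : cdiff_on (in_rect x y (wn n.+1 + wn n.+1) (hn n.+1 + hn n.+1)) g.
    by apply: cdiff_onS dg; apply: in_rectS; rewrite -?wE -?hE.
  have := rect_int_split w1 h1 dgs; rewrite -wE -hE => sp.
  move: b5; rewrite [rect_int _ _ _ _ _]sp.
  apply/negP; rewrite -ltNge.
  apply: le_lt_trans (le_normcD _ _) _.
  apply: le_lt_trans (lerD (le_normcD _ _) (le_normcD _ _)) _.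
  have -> : eta / 4 ^+ n = (eta / 4 ^+ n.+1 + eta / 4 ^+ n.+1) + (eta / 4 ^+ n.+1 + eta / 4 ^+ n.+1).
    by rewrite exprS; field; rewrite expf_neq0.
  by apply: ltrD; apply: ltrD; apply: sm; lra.
have [F HF] := choice step.
pose s := fix s n := if n is m.+1 then F (m, s m) else (a, c).
have bads n : bad n (s n).
  elim: n => [|n ih].
    by rewrite /bad /wn /hn !expr0 !divr1 /=; split => //; rewrite lexx.
  by have [] := HF (n, s n) ih.
have nest n := let: And5 _ x1 x2 x3 x4 := HF (n, s n) (bads n) in And4 x1 x2 x3 x4.
have nestk n k : [/\ (s n).1 <= (s (n + k)%N).1, (s (n + k)%N).1 + wn (n + k)%N <= (s n).1 + wn n,
    (s n).2 <= (s (n + k)%N).2 & (s (n + k)%N).2 + hn (n + k)%N <= (s n).2 + hn n].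
  elim: k => [|k [i1 i2 i3 i4]]; first by rewrite addn0 !lexx.
  rewrite addnS; have [/= j1 j2 j3 j4] := nest (n + k)%N.
  by split; [exact: le_trans i1 j1|exact: le_trans j2 i2|exact: le_trans i3 j3|exact: le_trans j4 i4].
pose xs := sup (range (fun n => (s n).1)); pose ys := sup (range (fun n => (s n).2)).
have ubx n : ubound (range (fun n => (s n).1)) ((s n).1 + wn n).
  move=> _ [m _ <-].
  have [nm|mn] := leqP n m.
    have [_ + _ _] := nestk n (m - n)%N; rewrite subnKC// => H.
    by apply: le_trans H; rewrite lerDl ltW.
  have [+ _ _ _] := nestk m (n - m)%N; rewrite subnKC; last exact: ltnW.
  by move=> H; apply: (le_trans H); rewrite lerDl ltW.
have uby n : ubound (range (fun n => (s n).2)) ((s n).2 + hn n).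
  move=> _ [m _ <-].
  have [nm|mn] := leqP n m.
    have [_ _ _ +] := nestk n (m - n)%N; rewrite subnKC// => H.
    by apply: le_trans H; rewrite lerDl ltW.
  have [_ _ + _] := nestk m (n - m)%N; rewrite subnKC; last exact: ltnW.
  by move=> H; apply: (le_trans H); rewrite lerDl ltW.
have xsn n : (s n).1 <= xs <= (s n).1 + wn n.
  apply/andP; split; first by apply: ub_le_sup; [exists ((s 0%N).1 + wn 0%N); exact: ubx|exists n].
  by apply: ge_sup; [exists (s 0%N).1; exists 0%N|exact: ubx].
have ysn n : (s n).2 <= ys <= (s n).2 + hn n.
  apply/andP; split; first by apply: ub_le_sup; [exists ((s 0%N).2 + hn 0%N); exact: uby|exists n].
  by apply: ge_sup; [exists (s 0%N).2; exists 0%N|exact: uby].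
pose z0 : R[i] := xs +i* ys.
have z0in n : in_rect (s n).1 (s n).2 (wn n) (hn n) z0 by split; [exact: xsn|exact: ysn].
have [L dL] : exists L, has_cderive g z0 L.
  by apply: dg; have := z0in 0%N; rewrite /wn /hn expr0 !divr1.
pose e := eta / (8 * (w + h) ^+ 2).
have wh0 : 0 < w + h by rewrite addr_gt0.
have e0 : 0 < e by rewrite divr_gt0// mulr_gt0// exprn_gt0.
have [d d0 Hd] := dL _ e0.
have [n nd] : exists n, (w + h) / 2 ^+ n < d.
  have := @cvg_geometric R (w + h) 2^-1 ltac:(rewrite ger0_norm ?invf_lt1 ?ltr1n//).
  move=> /cvgrPdist_lt/(_ _ d0)[n _ /(_ n (leqnn _))].
  rewrite sub0r normrN /= ger0_norm ?exprVn; first by exists n.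
  by rewrite mulr_ge0 ?ltW// invr_gt0 exprn_gt0.
have [b1 b2 b3 b4] := bads n; rewrite leNgt => /negP; apply.
set rn := (w + h) / 2 ^+ n in nd.
have rnE : rn = wn n + hn n by rewrite /rn /wn /hn mulrDl.
have wn0' := ltW (wn0 n); have hn0' := ltW (hn0 n).
pose l (z : R[i]) : R[i] := g z0 + L * (z - z0).
have dl z : exists M, has_cderive l z M.
  eexists; apply: has_cderiveD; first exact: has_cderive_cst.
  apply: has_cderiveM; first exact: has_cderive_cst.
  by apply: has_cderiveB; [exact: has_cderive_id|exact: has_cderive_cst].
have dgn : cdiff_on (in_rect (s n).1 (s n).2 (wn n) (hn n)) g.
  by apply: cdiff_onS dg; exact: in_rectS.
have -> : rect_int g (s n).1 (s n).2 (wn n) (hn n) =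
    rect_int (fun z => g z - l z) (s n).1 (s n).2 (wn n) (hn n).
  rewrite rect_intB// (@rect_int_primitive l (fun z => g z0 * z + L * ((z - z0) * (z - z0)) / 2))//.
    by rewrite subr0.
  by move=> z _; exact: linear_cderive.
apply: le_lt_trans (@rect_int_bound _ _ _ _ _ (e * rn) wn0' hn0' _ _) _.
- move=> z /dgn[M dM]; have [M' dM'] := dl z.
  by exists (M - M'); exact: has_cderiveB.
- move=> z [/andP[z1 z2] /andP[z3 z4]].
  have zz : normc (z - z0) <= rn.
    rewrite (le_trans (normc_leReIm _))// rnE.
    have [/andP[y1 y2] /andP[y3 y4]] := z0in n.
    apply: lerD; rewrite ler_norml.
      by rewrite cReD cReN; apply/andP; split; lra.
    by rewrite cImD cImN; apply/andP; split; lra.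
  have := Hd (z - z0) (le_lt_trans zz nd); rewrite (_ : z0 + (z - z0) = z); last by rewrite addrC subrK.
  move=> H.
  rewrite /l opprD addrA (le_trans H)// ler_wpM2l// ltW//.
rewrite -rnE /e /rn.
have -> : 4 * (eta / (8 * (w + h) ^+ 2) * ((w + h) / 2 ^+ n)) * ((w + h) / 2 ^+ n) =
  eta / 2 / 4 ^+ n.
  have -> : 4 ^+ n = 2 ^+ n ^+ 2 :> R by rewrite (_ : 4 = 2 ^+ 2 :> R); [rewrite -!exprM mulnC|ring].
  by field; rewrite expf_neq0//= gt_eqF.
rewrite ltr_pM2r ?invr_gt0 ?exprn_gt0//; lra.
Qed.

End goursat.

(** * The exponential, and continuity of complex functions *)

Section cexp_theory.
Variable R : realType.
Local Notation Re := (@complex.Re R).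
Local Notation Im := (@complex.Im R).
Implicit Types (z w h : R[i]) (f g : R[i] -> R[i]).

Lemma cexpD z w : cexp (z + w) = cexp z * cexp w.
Proof.
case: z => a b; case: w => c d; rewrite /cexp /= expRD cosD sinD.
by apply/eqP; rewrite eq_complex /=; apply/andP; split; apply/eqP; ring.
Qed.

Lemma cexp0 : cexp 0 = 1 :> R[i].
Proof. by rewrite /cexp /= expR0 cos0 sin0 mul1r mulr0. Qed.

Lemma normc_cexp z : normc (cexp z) = expR (Re z).
Proof.
rewrite /cexp /normc !exprMn -mulrDr cos2Dsin2 mulr1 sqrtr_sqr ger0_norm// expR_ge0.
Qed.

Lemma cexp_neq0 z : cexp z != 0.
Proof. by rewrite -normc_eq0 normc_cexp gt_eqF// expR_gt0. Qed.

Lemma cexpN z : cexp (- z) = (cexp z)^-1.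
Proof. by apply: (mulfI (cexp_neq0 z)); rewrite -cexpD subrr cexp0 divff// cexp_neq0. Qed.

Lemma cexp_Im (t : R) : cexp (0 +i* t) = cos t +i* sin t.
Proof. by rewrite /cexp /= expR0 !mul1r. Qed.

Lemma cexpD2pi z : cexp (z + 0 +i* (2 * pi)) = cexp z.
Proof.
rewrite cexpD cexp_Im mulr_natl cos2pi sin2pi.
by rewrite (_ : 1 +i* 0 = 1) ?mulr1.
Qed.

Lemma is_derive_eps (phi : R -> R) (t l : R) : is_derive t 1 phi l ->
  forall e, 0 < e -> exists2 d, 0 < d & forall h : R,
     `|h| < d -> `|phi (t + h) - phi t - h * l| <= e * `|h|.
Proof.
move=> [d <-] e e0; move: d => /cvgrPdist_le /(_ _ e0).
rewrite -nbhs_nearE /dnbhs /within /= => -[d /= d0 H].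
exists d => // h hd.
have [->|h0] := eqVneq h 0; first by rewrite addr0 subrr mul0r subrr normr0 mulr0.
have := H h; rewrite /ball_ /= sub0r normrN => /(_ hd h0).
rewrite /GRing.scale /= mulr1 (addrC h t) => H'.
have nh0 : 0 < `|h| by rewrite normr_gt0.
move: H'; rewrite -(ler_pM2r nh0) -normrM mulrBl distrC mulrAC mulVf// mul1r.
by rewrite (mulrC _ h).
Qed.

(** The real and imaginary parts of [exp (a + ib) - 1 - (a + ib)] are compared with the linear parts
    of the real functions [exp], [cos] and [sin] at [0]. *)
Lemma cexp_derive0 : has_cderive (@cexp R) 0 1.
Proof.
move=> e e0.
have e8 : 0 < e / 8 by rewrite divr_gt0.
have [d1 d10 H1] := is_derive_eps (is_derive_expR 0) e8.
have [d2 d20 H2] := is_derive_eps (is_derive_cos 0) e8.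
have [d3 d30 H3] := is_derive_eps (is_derive_sin 0) e8.
have [d4 d40 H4] := is_derive_eps (is_derive_expR 0) ltr01.
pose d := Num.min (Num.min d1 d2) (Num.min (Num.min d3 d4) (Num.min (1/2) (e / 8))).
exists d; first by rewrite !lt_min d10 d20 d30 d40 e8 andbT /=; lra.
case=> a b; rewrite add0r cexp0 mul1r !lt_min => /andP[/andP[h1 h2] /andP[/andP[h3 h4] /andP[h5 h6]]].
have an := normRe_le (a +i* b); have bn := normIm_le (a +i* b).
move: an bn h1 h2 h3 h4 h5 h6; set n := normc (a +i* b) => /= an bn h1 h2 h3 h4 h5 h6.
have := H1 a (le_lt_trans an h1); have := H4 a (le_lt_trans an h4).
have := H2 b (le_lt_trans bn h2); have := H3 b (le_lt_trans bn h3).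
rewrite !add0r expR0 cos0 sin0 oppr0 !mulr0 !mulr1 !subr0 addr0 => S C E4 E1.
have Ea : `|expR a - 1| <= 2 * `|a|.
  have := ler_normD (expR a - 1 - a) a; rewrite subrK; lra.
have eA : `|expR a| <= 2.
  have := ler_normD (expR a - 1) 1; rewrite subrK normr1; lra.
apply: le_trans (normc_leReIm _) _.
rewrite /cexp /=.
have -> : expR a * cos b - 1 - a = expR a * (cos b - 1) + (expR a - 1 - a) by ring.
have -> : expR a * sin b - 0 - b = expR a * (sin b - b) + (expR a - 1) * b by ring.
apply: le_trans (lerD (ler_normD _ _) (ler_normD _ _)) _.
rewrite !normrM.
have n0 : 0 <= n := normcr_ge0 _.
have p1 : `|expR a| * `|cos b - 1| <= 2 * (e / 8 * n).
  by apply: ler_pM => //; apply: le_trans C _; rewrite ler_pM2l.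
have p2 : `|expR a| * `|sin b - b| <= 2 * (e / 8 * n).
  by apply: ler_pM => //; apply: le_trans S _; rewrite ler_pM2l.
have p3 : `|expR a - 1 - a| <= e / 8 * n.
  by apply: le_trans E1 _; rewrite ler_pM2l.
have p4 : `|expR a - 1| * `|b| <= 2 * (e / 8) * n.
  apply: ler_pM => //; apply: le_trans Ea _; rewrite ler_pM2l//.
  by rewrite (le_trans an)// ltW.
have := mulr_ge0 (ltW e0) n0; lra.
Qed.

Lemma cexp_derive z : has_cderive (@cexp R) z (cexp z).
Proof.
move=> e e0; have n0 : 0 < normc (cexp z) by rewrite normc_gt0 cexp_neq0.
have [d d0 H] := cexp_derive0 (divr_gt0 e0 n0).
exists d => // h /H; rewrite add0r cexp0 mul1r => H'.
have -> : cexp (z + h) - cexp z - cexp z * h = cexp z * (cexp h - 1 - h).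
  by rewrite cexpD; ring.
by rewrite normcM mulrC -ler_pdivlMr// mulrAC.
Qed.

Lemma continuousCP f z : {for z, continuous (f : R[i]^o -> R[i]^o)} <->
  (forall e : R, 0 < e -> exists2 d : R, 0 < d & forall h, normc h < d -> normc (f (z + h) - f z) <= e).
Proof.
split.
  move=> /cvgrPdist_le fc e e0.
  have /fc : 0 < e%:C by rewrite ltcR.
  move=> /nbhs_ballP[d /= /cgt0_real[r r0 ->] H].
  exists r => // h hr; have := H (z + h).
  rewrite /ball /= opprD addrA subrr sub0r normrN !normc_norm ltcR lecR normcBC.
  by apply.
move=> H; apply/(@cvgrPdist_le _ R[i]^o R[i]^o (nbhs (z : R[i]^o))) => e /cgt0_real[r r0 ->].
have [d d0 {}H] := H _ r0.
apply/nbhs_ballP; exists d%:C => /=; first by rewrite ltcR.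
move=> w; rewrite /ball /= !normc_norm ltcR lecR normcBC => wz.
by rewrite normcBC -[w in f w](subrK z) [_ + z]addrC; exact: H.
Qed.

Lemma has_cderive_continuous f z L : has_cderive f z L ->
  {for z, continuous (f : R[i]^o -> R[i]^o)}.
Proof.
move=> fL; apply/continuousCP => e e0.
have [d d0 H] := has_cderive_lipschitz fL.
have L0 : 0 < normc L + 1 by rewrite ltr_pwDr ?normcr_ge0.
exists (Num.min d (e / (normc L + 1))); first by rewrite lt_min d0 divr_gt0.
move=> h; rewrite lt_min => /andP[/H hd he]; apply: le_trans hd _.
by rewrite mulrC -ler_pdivlMr// ltW.
Qed.

Lemma continuousC_mul f g z : {for z, continuous (f : R[i]^o -> R[i]^o)} ->
  {for z, continuous (g : R[i]^o -> R[i]^o)} ->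
  {for z, continuous ((fun w => f w * g w) : R[i]^o -> R[i]^o)}.
Proof. by move=> cf cg; apply: (@continuousM R[i] R[i]^o f g (z : R[i]^o) cf cg). Qed.

Lemma continuousC_sub f g z : {for z, continuous (f : R[i]^o -> R[i]^o)} ->
  {for z, continuous (g : R[i]^o -> R[i]^o)} ->
  {for z, continuous ((fun w => f w - g w) : R[i]^o -> R[i]^o)}.
Proof.
by move=> cf cg; apply: (@continuousB R[i] R[i]^o R[i]^o f g (z : R[i]^o) cf cg).
Qed.

Lemma continuousC_comp f g z : {for z, continuous (f : R[i]^o -> R[i]^o)} ->
  {for f z, continuous (g : R[i]^o -> R[i]^o)} ->
  {for z, continuous ((fun w => g (f w)) : R[i]^o -> R[i]^o)}.
Proof.
by move=> cf cg; apply: (@continuous_comp R[i]^o R[i]^o R[i]^o f g (z : R[i]^o) cf cg).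
Qed.

Lemma continuousC_line f z w (t : R) :
  {for z + t%:C * w, continuous (f : R[i]^o -> R[i]^o)} ->
  {for t, continuous (fun x : R => Re (f (z + x%:C * w)))} /\
  {for t, continuous (fun x : R => Im (f (z + x%:C * w)))}.
Proof.
move=> /continuousCP H.
have {}H (e : R) : 0 < e -> exists2 d, 0 < d & forall s : R, `|t - s| < d ->
    normc (f (z + t%:C * w) - f (z + s%:C * w)) <= e.
  move=> /H[d d0 {}H]; have w0 : 0 < normc w + 1 by rewrite ltr_pwDr ?normcr_ge0.
  exists (d / (normc w + 1)); first by rewrite divr_gt0.
  move=> s st; have := H ((s - t)%:C * w); rewrite -addrA -mulrDl.
  rewrite (_ : t%:C + (s - t)%:C = s%:C); last by rewrite -rmorphD /= addrC subrK.
  rewrite normcBC; apply.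
  rewrite normcM normc_real distrC (@le_lt_trans _ _ (`|t - s| * (normc w + 1)))//.
    by rewrite ler_wpM2l// lerDl.
  by rewrite -ltr_pdivlMr.
split; apply/cvgrPdist_le => e /H[d d0 {}H]; apply/nbhs_ballP; exists d => // s /= /H.
- by apply: le_trans; rewrite -cReN -cReD; exact: normRe_le.
- by apply: le_trans; rewrite -cImN -cImD; exact: normIm_le.
Qed.

Lemma continuousC_ccont_on a b f z w :
  (forall x : R, a <= x <= b -> {for z + x%:C * w, continuous (f : R[i]^o -> R[i]^o)}) ->
  ccont_on a b (fun x => f (z + x%:C * w)).
Proof. by move=> H; split=> x /H /continuousC_line[]. Qed.

(** A mean value inequality applied to both coordinates along the segment, hence the factor two. *)
Lemma cderive_le f z h (K : R) (f' : R -> R[i]) :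
  (forall t : R, 0 <= t <= 1 -> has_cderive f (z + t%:C * h) (f' t)) ->
  (forall t : R, 0 <= t <= 1 -> normc (f' t) <= K) ->
  normc (f (z + h) - f z) <= 2 * K * normc h.
Proof.
move=> H HK.
have K' t : 0 <= t <= 1 -> normc (f' t * h) <= K * normc h.
  by move=> t01; rewrite normcM ler_wpM2r ?normcr_ge0// HK.
have it (t : R) : t \in `]0, 1[ -> 0 <= t <= 1.
  by rewrite in_itv /= => /andP[? ?]; rewrite !ltW.
have cc := has_cderive_ccont_on (fun x x01 => ex_intro _ _ (H x x01)).
have [c c01 Ec] := @MVT _ _ (fun t => Re (f' t * h)) _ _ (@ltr01 R)
  (fun x x01 => (is_derive_line (H x (it x x01))).1) (cont_on_within cc.1).
have [d d01 Ed] := @MVT _ _ (fun t => Im (f' t * h)) _ _ (@ltr01 R)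
  (fun x x01 => (is_derive_line (H x (it x x01))).2) (cont_on_within cc.2).
apply: le_trans (normc_leReIm _) _.
move: Ec Ed; rewrite mul1r mul0r addr0 subr0 !mulr1 -!cReN -!cImN -cReD -cImD => -> ->.
rewrite -mulrA mulr_natl mulr2n; apply: lerD.
  by apply: le_trans (normRe_le _) _; exact/K'/it.
by apply: le_trans (normIm_le _) _; exact/K'/it.
Qed.

End cexp_theory.

(** * The derivative of an analytic function is analytic *)

Section regularity.
Variable R : realType.
Local Notation Re := (@complex.Re R).
Local Notation Im := (@complex.Im R).
Implicit Types (z w h : R[i]) (f g : R[i] -> R[i]).

Definition cball z (r : R) : set R[i] := [set w | normc (w - z) < r].

Lemma cballD z h r : normc h < r -> cball z r (z + h).
Proof. by rewrite /cball /= [z + h]addrC addrK. Qed.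

Lemma cball_trans z w (r s t : R) : cball z r w -> r + s <= t -> cball w s `<=` cball z t.
Proof.
rewrite /cball /= => zw rst v /= vw.
rewrite (_ : v - z = (v - w) + (w - z)); last by rewrite addrA subrK.
by rewrite (le_lt_trans (le_normcD _ _))//; lra.
Qed.

(** The integrand of Cauchy's formula for [f' (z)] on the circle of radius [rho], up to the factor
    [1 / (2 pi rho)].  The constant [f z] is subtracted, as it integrates to zero, so that the
    integrand has size [rho] and bounds on the increments of [f] give bounds on [f']. *)
Definition circ_incr f z (rho : R) (theta : R) : R[i] :=
  (f (z + rho%:C * cexp (0 + theta%:C * 'i%C)) - f z) * cexp (- (0 + theta%:C * 'i%C)).

Lemma normc_circ theta : normc (cexp (0 + theta%:C * 'i%C)) = 1 :> R.
Proof. by rewrite add0r normc_cexp cReM /= mul0r mulr0 subr0 expR0. Qed.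

Lemma normc_circN theta : normc (cexp (- (0 + theta%:C * 'i%C))) = 1 :> R.
Proof. by rewrite cexpN normcV normc_circ invr1. Qed.

Lemma circ_incr_cont f z rho a b : 
  (forall w, normc (w - z) = `|rho| -> {for w, continuous (f : R[i]^o -> R[i]^o)}) ->
  ccont_on a b (circ_incr f z rho).
Proof.
move=> H; apply: (@continuousC_ccont_on _ _ _
  (fun x => (f (z + rho%:C * cexp x) - f z) * cexp (- x)) 0 'i%C) => x _.
set y := 0 + _.
have cz : {for y, continuous ((fun x => z + rho%:C * cexp x) : R[i]^o -> R[i]^o)}.
  have := has_cderiveD (has_cderive_cst z y)
    (has_cderiveM (has_cderive_cst rho%:C y) (cexp_derive y)).
  exact: has_cderive_continuous.
have cN : {for y, continuous ((fun x => cexp (- x)) : R[i]^o -> R[i]^o)}.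
  have := has_cderive_comp (has_cderiveN (has_cderive_id y)) (cexp_derive _).
  exact: has_cderive_continuous.
pose F x : R[i] := f (z + rho%:C * cexp x).
have cF : {for y, continuous (F : R[i]^o -> R[i]^o)}; last first.
  have cc : {for y, continuous ((fun=> f z) : R[i]^o -> R[i]^o)} by exact: cst_continuous.
  exact: (continuousC_mul (continuousC_sub cF cc) cN).
apply: (continuousC_comp cz).
apply: H; rewrite addrC addKr normcM normc_real.
by rewrite normc_circ mulr1.
Qed.

(** The function [zeta |-> (f (z + exp zeta) - f z) exp (- zeta)] is analytic and [2 pi i]-periodic on
    a half plane.  By Goursat's theorem its integral over a vertical period does not depend on the
    abscissa, since the two horizontal sides cancel; the limit at [- oo] is [2 pi i f' (z)]. *)
Lemma circle_formula f z (r rho : R) L : 0 < rho -> rho < r ->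
  cdiff_on (cball z r) f -> has_cderive f z L ->
  csint 0 (2 * pi) (circ_incr f z rho) = (2 * pi * rho)%:C * L.
Proof.
move=> rho0 rhor df fL.
pose g zeta := (f (z + cexp zeta) - f z) * cexp (- zeta).
have dg : cdiff_on [set zeta | Re zeta <= ln rho] g.
  move=> zeta /= zetar.
  have [M fM] : exists M, has_cderive f (z + cexp zeta) M.
    apply: df; apply: cballD; rewrite normc_cexp.
    by rewrite (le_lt_trans _ rhor)// -[leRHS]lnK ?posrE// ler_expR.
  eexists; apply: has_cderiveM.
    apply: has_cderiveB; last exact: has_cderive_cst.
    apply: (has_cderive_comp (has_cderiveD (has_cderive_cst z zeta) (cexp_derive zeta))).
    exact: fM.
  by apply: (has_cderive_comp (has_cderiveN (has_cderive_id zeta))); exact: cexp_derive.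
pose J (s : R) := csint 0 (2 * pi) (vside g s).
have pi20 : 0 < 2 * pi :> R by rewrite mulr_gt0 ?pi_gt0.
have JE s : s < ln rho -> J s = J (ln rho).
  move=> sr; have := @goursat R g s 0 (ln rho - s) (2 * pi).
  rewrite subr_gt0 => /(_ sr pi20); rewrite /rect_int.
  rewrite [s + _]addrC subrK add0r => H.
  have : J (ln rho) - J s - (csint s (ln rho) (hside g (2 * pi)) - csint s (ln rho) (hside g 0)) = 0.
    apply: H; apply: cdiff_onS dg => w [/andP[_]].
    by rewrite addrC subrK.
  have -> : hside g (2 * pi) = hside g 0.
    apply/funext => x; rewrite /hside /g.
    have -> : 0 +i* (2 * pi) + x%:C * 1 = 0 +i* 0 + x%:C * 1 + 0 +i* (2 * pi) :> R[i].
      by apply/eqP; rewrite eq_complex /=; apply/andP; split; apply/eqP; ring.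
    by rewrite !cexpN !cexpD2pi.
  by rewrite [X in _ - X = _]subrr subr0 => /subr0_eq/esym.
have vc s : s <= ln rho -> ccont_on 0 (2 * pi) (vside g s).
  by move=> sr; apply: vside_cont; apply: cdiff_onS dg => w /= [-> _].
have small (e : R) : 0 < e -> normc (J (ln rho) - csint 0 (2 * pi) (fun=> L * 'i%C)) <= 4 * pi * e.
  move=> e0; have [d d0 Hd] := fL _ e0.
  pose s := Num.min (ln rho) (ln d) - 1.
  have sr : s < ln rho.
    have : Num.min (ln rho) (ln d) <= ln rho by rewrite ge_min lexx.
    rewrite /s; lra.
  have sd : s < ln d.
    have : Num.min (ln rho) (ln d) <= ln d by rewrite ge_min lexx orbT.
    rewrite /s; lra.
  rewrite -(JE _ sr) /J -csintB; last 2 first.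
  - exact/vc/ltW.
  - by split; exact: cont_on_cst.
  rewrite (_ : 4 * pi * e = 2 * e * (2 * pi - 0)); last by ring.
  apply: csint_bound.
  - exact: ltW.
  - have -> : (fun x => vside g s x - L * 'i%C) = (fun x => vside g s x + (- (L * 'i%C))) by [].
    apply: ccont_onD; first exact/vc/ltW.
    by split; exact: cont_on_cst.
  move=> x _; rewrite /vside -mulrBl normcM.
  have -> : normc 'i%C = 1 :> R by rewrite /normc expr0n expr1n /= add0r sqrtr1.
  rewrite mulr1 /g; set zeta := _ + _ * 'i%C.
  have nh : normc (cexp zeta) < d.
    rewrite normc_cexp /zeta cReD cReM /= mul0r mulr0 subr0 addr0.
    by rewrite -[ltRHS]lnK ?posrE// ltr_expR.
  have n0 : 0 < normc (cexp zeta) by rewrite normc_gt0 cexp_neq0.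
  rewrite -(ler_pM2r n0) -normcM mulrBl -mulrA cexpN mulVf ?cexp_neq0// mulr1.
  exact: Hd.
have {small} JL : J (ln rho) = csint 0 (2 * pi) (fun=> L * 'i%C).
  apply/eqP; rewrite -subr_eq0 -normc_eq0 eq_le normcr_ge0 andbT.
  apply/ler_addgt0Pr => e e0; rewrite add0r.
  have pi4 : 0 < 4 * pi :> R by rewrite mulr_gt0 ?pi_gt0.
  have := small (e / (4 * pi)) (divr_gt0 e0 pi4).
  by rewrite mulrCA divff ?mulr1 ?gt_eqF.
have fc w : normc (w - z) = `|rho| -> {for w, continuous (f : R[i]^o -> R[i]^o)}.
  rewrite gtr0_norm// => wz; have [|M] := df w; first by rewrite /cball /= wz.
  exact: has_cderive_continuous.
have JK : J (ln rho) = csint 0 (2 * pi) (circ_incr f z rho) * (rho^-1%:C * 'i%C).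
  rewrite -csintZ; last exact: circ_incr_cont.
  apply: eq_csint => x _; rewrite /vside /g /circ_incr add0r mulrA; congr (_ * _).
  have -> : cexp ((ln rho)%:C + x%:C * 'i%C) = rho%:C * cexp (x%:C * 'i%C).
    by rewrite cexpD; congr (_ * _); rewrite /cexp /= lnK ?posrE// cos0 sin0 mulr1 mulr0.
  rewrite opprD cexpD -mulrA; congr (_ * _); rewrite mulrC; congr (_ * _).
  by rewrite /cexp /= oppr0 expRN lnK ?posrE// cos0 sin0 mulr1 mulr0.
move: JK; rewrite JL csint_cst ?ltW// subr0 mulrA => /(congr1 (fun x => x * (rho%:C * - 'i%C))) E.
have ii : 'i%C * 'i%C = -1 :> R[i] by rewrite -expr2 sqr_i.
have rr : rho^-1%:C * rho%:C = 1 :> R[i] by rewrite -rmorphM /= mulVf// gt_eqF.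
have -> : (2 * pi * rho)%:C * L = (2 * pi)%:C * L * 'i%C * (rho%:C * - 'i%C).
  rewrite rmorphM /=.
  transitivity (- ((2 * pi)%:C * L * rho%:C) * ('i%C * 'i%C)); last by ring.
  by rewrite ii; ring.
rewrite E.
transitivity (- csint 0 (2 * pi) (circ_incr f z rho) * (rho^-1%:C * rho%:C) * ('i%C * 'i%C)).
  by rewrite rr ii; ring.
by ring.
Qed.

Lemma circle_bound f z (r rho B : R) L : 0 < rho -> rho < r ->
  cdiff_on (cball z r) f -> has_cderive f z L ->
  (forall w, normc (w - z) = rho -> normc (f w - f z) <= B) ->
  normc L <= 2 * B / rho.
Proof.
move=> rho0 rhor df fL H.
have pi20 : 0 < 2 * pi :> R by rewrite mulr_gt0 ?pi_gt0.
have E := circle_formula rho0 rhor df fL.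
have : normc (csint 0 (2 * pi) (circ_incr f z rho)) <= 2 * B * (2 * pi - 0).
  apply: csint_bound; first exact: ltW.
    apply: circ_incr_cont => w; rewrite gtr0_norm// => wz.
    have [|M] := df w; first by rewrite /cball /= wz.
    exact: has_cderive_continuous.
  move=> x _; rewrite /circ_incr normcM normc_circN mulr1.
  apply: H; rewrite addrC addKr normcM normc_circ mulr1 normc_real gtr0_norm//.
rewrite E normcM normc_real gtr0_norm ?mulr_gt0 ?pi_gt0// subr0.
rewrite ler_pdivlMr// => H'.
rewrite -(ler_pM2l pi20); lra.
Qed.

(** The derivative is bounded near [z0] by [circle_bound], so that [f] is Lipschitz there;
    [circle_bound] applied to [f (w + h) - f w] then makes [f'] Lipschitz, which gives a quadratic
    Taylor estimate for [f], and the latter can be integrated in [circle_formula]. *)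
Lemma has_cderive_cderive f z0 (r : R) : 0 < r -> cdiff_on (cball z0 r) f ->
  exists L, has_cderive (cderive f) z0 L.
Proof.
move=> r0 df0.
have df w : cball z0 r w -> has_cderive f w (cderive f w).
  by move=> /df0[L fL]; have [_ ->] := has_cderive_derivable fL.
have z0in : cball z0 r z0 by rewrite /cball /= subrr normc0.
have /continuousCP/(_ _ ltr01)[d d0 Hd] := has_cderive_continuous (df _ z0in).
pose r1 := Num.min r d; have r10 : 0 < r1 by rewrite lt_min r0.
have r1r : r1 <= r by rewrite ge_min lexx.
have osc w : cball z0 r1 w -> normc (f w - f z0) <= 1.
  rewrite /cball /= => wz; rewrite -[w in f w](subrK z0 w) addrC.
  rewrite (_ : w - z0 + z0 = z0 + (w - z0)); last by rewrite addrC.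
  by rewrite addrC; apply: Hd; rewrite (lt_le_trans wz)// ge_min lexx orbT.
have {}df w : cball z0 r1 w -> has_cderive f w (cderive f w).
  by move=> H; apply: df; apply: lt_le_trans H _.
have bd w : cball z0 (r1 / 2) w -> normc (cderive f w) <= 16 / r1.
  move=> wz; have sub : cball w (r1 / 2) `<=` cball z0 r1.
    by apply: cball_trans wz _; lra.
  have ww : cball w (r1 / 2) w by rewrite /cball /= subrr normc0 divr_gt0.
  apply: le_trans (@circle_bound f w (r1 / 2) (r1 / 4) 2 _ _ _ _ (df _ (sub _ ww)) _) _.
  - by rewrite divr_gt0.
  - lra.
  - by move=> v /sub /df fv; exists (cderive f v).
  - move=> v vw; rewrite (_ : f v - f w = (f v - f z0) - (f w - f z0)); last by ring.
    apply: le_trans (le_normcB _ _) _.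
    have := osc _ (sub _ ww); have := osc v; rewrite (_ : 2 = 1 + 1)//.
    move=> H1 H2; apply: lerD => //; apply: H1; apply: sub; rewrite /cball /= vw; lra.
  - by rewrite le_eqVlt; apply/orP; left; apply/eqP; field; rewrite gt_eqF.
have seg z h (s : R) : cball z0 s z -> cball z0 s (z + h) ->
    forall t : R, 0 <= t <= 1 -> cball z0 s (z + t%:C * h).
  rewrite /cball /= => zs zhs t /andP[t0 t1].
  rewrite (_ : z + t%:C * h - z0 = (1 - t)%:C * (z - z0) + t%:C * (z + h - z0)); last first.
    by rewrite rmorphB /=; ring.
  apply: le_lt_trans (le_normcD _ _) _; rewrite !normcM !normc_real ger0_norm ?subr_ge0// ger0_norm//.
  have [->|tn0] := eqVneq t 0; first by rewrite mul0r addr0 subr0 mul1r.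
  have tp : 0 < t by rewrite lt_def tn0.
  rewrite (_ : s = (1 - t) * s + t * s); last by ring.
  by apply: ler_ltD; [apply: ler_wpM2l; rewrite ?subr_ge0// ltW|rewrite ltr_pM2l].
pose A := 16 / r1; have A0 : 0 < A by rewrite divr_gt0.
have lip z h : cball z0 (r1 / 2) z -> cball z0 (r1 / 2) (z + h) ->
    normc (f (z + h) - f z) <= 2 * A * normc h.
  move=> zs zhs; have sg := seg _ _ _ zs zhs.
  apply: (@cderive_le _ _ _ _ _ (fun t => cderive f (z + t%:C * h))) => t t01; last exact/bd/sg.
  by apply: df; apply: lt_le_trans (sg t t01) _; lra.
have [B BE B0] : exists2 B, B = 64 * A / r1 & 0 < B.
  by eexists; [reflexivity|rewrite divr_gt0// mulr_gt0].
have lip' z h : cball z0 (r1 / 4) z -> cball z0 (r1 / 4) (z + h) ->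
    normc (cderive f (z + h) - cderive f z) <= B * normc h.
  move=> zs zhs.
  have s1 : cball z (r1 / 4) `<=` cball z0 (r1 / 2) by apply: cball_trans zs _; lra.
  have s2 w : cball z (r1 / 4) w -> cball z0 (r1 / 2) (w + h).
    move=> zw; apply: (cball_trans zhs (s := r1 / 4)); first lra.
    by move: zw; rewrite /cball /= opprD addrACA subrr addr0.
  have inr w : cball z0 (r1 / 2) w -> cball z0 r1 w by move=> H; apply: lt_le_trans H _; lra.
  pose F w := f (w + h) - f w.
  have dF w : cball z (r1 / 4) w -> has_cderive F w (cderive f (w + h) - cderive f w).
    move=> zw; apply: has_cderiveB; last exact/df/inr/s1.
    have := has_cderive_comp (has_cderiveD (has_cderive_id w) (has_cderive_cst h w))
      (df _ (inr _ (s2 _ zw))).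
    by rewrite addr0 mulr1.
  have zz : cball z (r1 / 4) z by rewrite /cball /= subrr normc0 divr_gt0.
  apply: le_trans (@circle_bound F z (r1 / 4) (r1 / 8) (4 * A * normc h) _ _ _ _ (dF _ zz) _) _.
  - by rewrite divr_gt0.
  - lra.
  - by move=> w /dF ?; eexists; eassumption.
  - move=> w wz; have zw : cball z (r1 / 4) w by rewrite /cball /= wz; lra.
    apply: le_trans (le_normcB _ _) _.
    have := lip _ _ (s1 _ zw) (s2 _ zw); have := lip _ _ (s1 _ zz) (s2 _ zz).
    by rewrite /F; lra.
  - by rewrite le_eqVlt; apply/orP; left; apply/eqP; rewrite BE; field; rewrite gt_eqF.
have taylor z h : cball z0 (r1 / 4) z -> cball z0 (r1 / 4) (z + h) ->
    normc (f (z + h) - f z - h * cderive f z) <= 2 * (B * normc h) * normc h.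
  move=> zs zhs; have sg := seg _ _ _ zs zhs.
  have -> : f (z + h) - f z - h * cderive f z =
    (f (z + h) - (z + h) * cderive f z) - (f z - z * cderive f z) by ring.
  apply: (@cderive_le _ (fun w => f w - w * cderive f z) _ _ _
    (fun t => cderive f (z + t%:C * h) - cderive f z)) => t t01.
    have := has_cderiveB (df (z + t%:C * h) _)
      (has_cderiveM (has_cderive_id (z + t%:C * h)) (has_cderive_cst (cderive f z) _)).
    rewrite mulr0 add0r mulr1; apply.
    by apply: lt_le_trans (sg t t01) _; lra.
  apply: le_trans (lip' _ _ zs (sg t t01)) _.
  rewrite ler_pM2l// normcM normc_real; case/andP: t01 => t0 t1.
  by rewrite ger0_norm// ler_piMl// normcr_ge0.
pose rho := r1 / 8; have rho0 : 0 < rho by rewrite divr_gt0.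
have pi20 : 0 < 2 * pi :> R by rewrite mulr_gt0 ?pi_gt0.
have [I IE] : exists I, I = csint 0 (2 * pi) (circ_incr (cderive f) z0 rho) by eexists.
pose q := 2 * pi * rho; have q0 : 0 < q by rewrite mulr_gt0.
have z04 : cball z0 (r1 / 4) z0 by rewrite /cball /= subrr normc0 divr_gt0.
have cont' w : cball z0 (r1 / 4) w -> {for w, continuous (cderive f : R[i]^o -> R[i]^o)}.
  rewrite /cball /= => wz; apply/continuousCP => e e0.
  exists (Num.min (r1 / 4 - normc (w - z0)) (e / B)).
    by rewrite lt_min subr_gt0 wz divr_gt0.
  move=> h; rewrite lt_min => /andP[h1 h2].
  apply: le_trans (lip' _ _ wz _) _; last by rewrite mulrC -ler_pdivlMr// ltW.
  rewrite /cball /= addrAC; apply: le_lt_trans (le_normcD _ _) _; lra.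
exists (q%:C^-1 * I) => e e0.
pose M := 16 * pi * B / q.
have M0 : 0 < M by rewrite !(divr_gt0, mulr_gt0) ?pi_gt0.
exists (Num.min rho (e / M)); first by rewrite lt_min rho0 divr_gt0.
move=> h; rewrite lt_min => /andP[h1 h2].
have z0h : cball z0 (r1 / 4) (z0 + h).
  by apply: cballD; apply: lt_trans h1 _; rewrite /rho; lra.
have bS : cball z0 (r1 / 4) `<=` cball z0 r1 by move=> w H; apply: lt_le_trans H _; lra.
have ballS z : cball z0 rho z -> cball z (r1 / 4) `<=` cball z0 r1.
  by move=> zr; apply: cball_trans zr _; rewrite /rho; lra.
have F1 z : cball z0 rho z -> csint 0 (2 * pi) (circ_incr f z rho) = q%:C * cderive f z.
  move=> zr; apply: (@circle_formula _ _ (r1 / 4)) => //; first by rewrite /rho; lra.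
    by move=> w /(ballS _ zr) /df ?; eexists; eassumption.
  by apply: df; apply: lt_le_trans zr _; rewrite /rho; lra.
have C1 z : cball z0 rho z -> ccont_on 0 (2 * pi) (circ_incr f z rho).
  move=> zr; apply: circ_incr_cont => w; rewrite gtr0_norm// => wz.
  apply: has_cderive_continuous (df _ _); apply: (ballS _ zr).
  by rewrite /cball /= wz /rho; lra.
have C2 : ccont_on 0 (2 * pi) (circ_incr (cderive f) z0 rho).
  apply: circ_incr_cont => w; rewrite gtr0_norm// => wz.
  by apply: cont'; rewrite /cball /= wz /rho; lra.
have r0h : cball z0 rho (z0 + h) by exact: cballD.
have r00 : cball z0 rho z0 by rewrite /cball /= subrr normc0.
have E : q%:C * (cderive f (z0 + h) - cderive f z0 - q%:C^-1 * I * h) =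
    csint 0 (2 * pi) (fun x => circ_incr f (z0 + h) rho x - circ_incr f z0 rho x -
      circ_incr (cderive f) z0 rho x * h).
  have qc : q%:C * q%:C^-1 = 1 :> R[i] by rewrite divff// -normc_eq0 normc_real normr_eq0 gt_eqF.
  rewrite csintB; last 2 first.
  - rewrite (_ : (fun _ => _) = (fun x => circ_incr f (z0 + h) rho x + circ_incr f z0 rho x * (-1))).
      by apply: ccont_onD; [exact: C1|apply: ccont_onZ; exact: C1].
    by apply/funext => x; rewrite mulrN1.
  - exact: ccont_onZ.
  rewrite csintB; [|exact: C1|exact: C1].
  rewrite csintZ// !F1// -IE.
  by rewrite !mulrBr !mulrA qc mul1r.
have ql : normc (q%:C * (cderive f (z0 + h) - cderive f z0 - q%:C^-1 * I * h)) <=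
    2 * (4 * B * normc h * normc h) * (2 * pi - 0).
  rewrite E; apply: csint_bound; first exact: ltW.
    rewrite (_ : (fun _ => _) = (fun x => (circ_incr f (z0 + h) rho x + circ_incr f z0 rho x * (-1)) +
      circ_incr (cderive f) z0 rho x * (- h))); last first.
      by apply/funext => x; rewrite mulrN1 mulrN.
    apply: ccont_onD; last exact: ccont_onZ.
    by apply: ccont_onD; [exact: C1|apply: ccont_onZ; exact: C1].
  move=> x _; rewrite /circ_incr; set v := rho%:C * _.
  have vn : normc v = rho by rewrite normcM normc_circ normc_real gtr0_norm// mulr1.
  have zv : cball z0 (r1 / 4) (z0 + v) by apply: cballD; rewrite vn /rho; lra.
  have zvh : cball z0 (r1 / 4) (z0 + v + h).
    rewrite -addrA; apply: cballD; apply: le_lt_trans (le_normcD _ _) _.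
    by rewrite vn; move: h1; rewrite /rho; lra.
  rewrite (_ : _ - _ = ((f (z0 + v + h) - f (z0 + v) - h * cderive f (z0 + v)) -
    (f (z0 + h) - f z0 - h * cderive f z0)) * cexp (- (0 + x%:C * 'i%C))); last first.
    rewrite [z0 + h + v]addrAC.
    move: (f (z0 + v + h)) (f (z0 + v)) (f (z0 + h)) (f z0) (cderive f (z0 + v)) (cderive f z0).
    by move: (cexp _) => x1 x2 x3 x4 x5 x6 x7; ring.
  rewrite normcM normc_circN mulr1; apply: le_trans (le_normcB _ _) _.
  apply: le_trans (lerD (taylor _ _ zv zvh) (taylor _ _ z04 z0h)) _.
  by rewrite le_eqVlt; apply/orP; left; apply/eqP; ring.
move: ql; rewrite normcM normc_real gtr0_norm// => ql.
rewrite -(ler_pM2l q0) (le_trans ql)//.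
have n0 := normcr_ge0 h.
have : normc h * M <= e by rewrite -ler_pdivlMr// ltW.
move=> /(ler_wpM2r n0)/(ler_wpM2l (ltW q0)); apply: le_trans.
rewrite le_eqVlt; apply/orP; left; apply/eqP; rewrite /M; field; rewrite gt_eqF//.
Qed.

End regularity.

(** * Integrals over the plane *)

Section plane_integrals.
Variable R : realType.
Local Notation mu := (@lebesgue_measure R).
Local Notation mT := (measurableTypeR R).

(** An open subset of the plane is the union of the countably many boxes with rational vertices that it
    contains. *)
Lemma open_measurable_plane (U : set (R * R)) : open U ->
  measurable (U : set (mT * mT)).
Proof.
move=> oU.
pose box (i : rat * rat * (rat * rat)) : set (mT * mT) :=
  [set` `]ratr i.1.1, ratr i.1.2[%R] `*` [set` `]ratr i.2.1, ratr i.2.2[%R].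
pose F i := if `[< box i `<=` U >] then box i else set0.
have -> : U = \bigcup_i F i.
  apply/seteqP; split => [[x y] Uxy|z [i _]]; last first.
    by rewrite /F; case: ifPn => [/asboolP|//]; apply.
  have : nbhs (x, y) U by apply: open_nbhs_nbhs.
  move=> [[P Q] /= [/nbhs_ballP[e /= e0 He] /nbhs_ballP[d /= d0 Hd]] PQ].
  have [a1] := rat_in_itvoo (ltac:(by rewrite ltrBlDr ltrDl) : x - e < x).
  have [a2] := rat_in_itvoo (ltac:(by rewrite ltrDl) : x < x + e).
  have [b1] := rat_in_itvoo (ltac:(by rewrite ltrBlDr ltrDl) : y - d < y).
  have [b2] := rat_in_itvoo (ltac:(by rewrite ltrDl) : y < y + d).
  rewrite !in_itv /= => /andP[yb2 b2d] /andP[b1d b1y] /andP[xa2 a2e] /andP[a1e a1x].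
  exists ((a1, a2), (b1, b2)) => //; rewrite /F; case: ifPn => [_|/asboolP[]].
    by split; rewrite /= in_itv /= ?a1x ?b1y.
  move=> [u v] [/= ]; rewrite !in_itv /= => /andP[u1 u2] /andP[v1 v2].
  apply: PQ; split => /=; [apply: He|apply: Hd]; rewrite /ball /= ltr_norml; apply/andP; split; lra.
apply: countable_bigcupT_measurable; first exact: countableP.
move=> i; rewrite /F; case: ifPn => _; last exact: measurable0.
by apply: measurableX; exact: measurable_itv.
Qed.

Lemma measurable_fun_open_continuous (D : set (R * R)) (F : R * R -> R) : open D ->
  (forall z, D z -> {for z, continuous F}) ->
  measurable_fun (D : set (mT * mT)) (F : mT * mT -> mT).
Proof.
move=> oD cF mD; apply: (measurability _ (measurable_realfun.RGenOInfty.measurableE R)) => //.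
move=> _ [_ [a ->] <-]; apply: open_measurable_plane.
rewrite openE => z [Dz Fz]; apply: filterI; first by apply: open_nbhs_nbhs.
apply: (cF _ Dz); apply: open_nbhs_nbhs; split; last exact: Fz.
exact: itv_open_ends_open.
Qed.

Definition square : set (R * R) := [set` `[-1, 1]%R] `*` [set` `[-1, 1]%R].

Lemma square_measurable : measurable (square : set (mT * mT)).
Proof. by apply: measurableX; exact: measurable_itv. Qed.

Lemma square_finite : ((mu \x mu)%E (square : set (mT * mT)) < +oo)%E.
Proof.
have f : (mu [set` `[-1, 1]%R] < +oo)%E.
  by rewrite lebesgue_measure_itv /= lte_fin; case: ifP => _; rewrite -?EFinB ltry.
apply: (@le_lt_trans _ _ (mu [set` `[-1, 1]%R] * mu [set` `[-1, 1]%R])%E).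
  by rewrite /square product_measure1E.
by rewrite lte_mul_pinfty// ge0_fin_numE.
Qed.

Lemma continuous_square_bounded (V : R * R -> R) : (forall z, square z -> {for z, continuous V}) ->
  exists2 M, 0 < M & forall z, square z -> `|V z| <= M.
Proof.
move=> cV.
have : compact (V @` square).
  apply: continuous_compact.
    by apply: continuous_in_subspaceT => z; rewrite inE => /cV.
  by apply: compact_setX; exact: segment_compact.
move=> /compact_bounded[M [_ HM]].
exists (`|M| + 1); first by rewrite ltr_wpDl.
move=> z sz; apply: (HM (`|M| + 1)); last by exists z.
by rewrite (le_lt_trans (ler_norm _))// ltrDl.
Qed.

Lemma integrable_continuous_square (V : R * R -> R) : (forall z, {for z, continuous V}) ->
  (forall z, ~ square z -> V z = 0) ->
  (mu \x mu)%E.-integrable [set: mT * mT] (EFin \o V).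
Proof.
move=> cV V0.
have -> : EFin \o V = (EFin \o V) \_ square.
  apply/funext => z; rewrite patchE; case: ifPn => // /negP sz /=.
  by rewrite V0// => ?; apply: sz; rewrite inE.
apply/(integrable_mkcond _ square_measurable).
apply: (@measurable_bounded_integrable _ _ _ (mu \x mu)%E V) => //.
- exact: square_measurable.
- exact: square_finite.
- apply: (@measurable_funS _ _ _ _ setT) => //.
  by apply: measurable_fun_open_continuous => // ; exact: openT.
- have [M M0 HM] := continuous_square_bounded (fun z _ => cV z).
  exists M; split; first exact: num_real.
  by move=> x Mx z sz /=; apply: le_trans (HM _ sz) (ltW Mx).
Qed.

Lemma integral_compact_derivative (V Q : R -> R) :
  (forall x, {for x, continuous V}) -> (forall x : R, is_derive x 1 Q (V x)) ->
  (forall x, 1 <= `|x| -> Q x = 0) -> (forall x, ~ `[-1, 1]%classic x -> V x = 0) ->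
  (\int[mu]_x (V x)%:E = 0)%E.
Proof.
move=> cV dQ Q0 V0.
have -> : ((\int[mu]_x (V x)%:E)%E = (\int[mu]_(x in [set` `[-1, 1]%R]) (V x)%:E)%E).
  rewrite [RHS]integral_mkcond; apply: eq_integral => x _; rewrite patchE; case: ifPn => // /negP xs.
  by rewrite V0// => ?; apply: xs; rewrite inE.
have c : cont_on (-1) 1 V by move=> x _; exact: cV.
have /integrable_fin_num := cont_on_integrable c.
rewrite /= => /(_ (measurable_itv _)) fin.
transitivity ((sint (-1) 1 V)%:E)%E; first by rewrite /sint /Rintegral fineK.
have le11 : -1 <= 1 :> R by lra.
by rewrite (sint_FTC le11 c (fun x _ => dQ x)) !Q0 ?subrr// ?normrN normr1.
Qed.

(** By Fubini's theorem, as the integral of [V] along a line is the increment of [Q] between two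
    points where it vanishes. *)
Lemma iint_derivative1 (V Q : R * R -> R) : (forall z, {for z, continuous V}) ->
  (forall z, ~ square z -> V z = 0) ->
  (forall x y : R, is_derive x 1 (fun x : R => Q (x, y)) (V (x, y))) ->
  (forall x y, 1 <= `|x| -> Q (x, y) = 0) ->
  (\int[(mu \x mu)%E]_z (V z)%:E = 0)%E.
Proof.
move=> cV V0 dQ Q0.
have iV := integrable_continuous_square cV V0.
rewrite -(integral21_prod_meas1 iV).
apply: integral0_eq => y _.
apply: (@integral_compact_derivative (fun x => V (x, y)) (fun x => Q (x, y))) => //.
- move=> x; apply: (@continuous_comp _ _ _ (fun x => (x, y)) V) => //.
  move=> A [[P B] /= [Px By] PB]; apply: filterS Px => u Pu; apply: PB; split => //=.
  exact: nbhs_singleton By.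
- by move=> x; apply: Q0.
- by move=> x xs; apply: V0 => -[].
Qed.

Lemma iint_derivative2 (V Q : R * R -> R) : (forall z, {for z, continuous V}) ->
  (forall z, ~ square z -> V z = 0) ->
  (forall x y : R, is_derive y 1 (fun y : R => Q (x, y)) (V (x, y))) ->
  (forall x y, 1 <= `|y| -> Q (x, y) = 0) ->
  (\int[(mu \x mu)%E]_z (V z)%:E = 0)%E.
Proof.
move=> cV V0 dQ Q0.
have iV := integrable_continuous_square cV V0.
rewrite -(integral12_prod_meas1 iV).
apply: integral0_eq => x _.
apply: (@integral_compact_derivative (fun y => V (x, y)) (fun y => Q (x, y))) => //.
- move=> y; apply: (@continuous_comp _ _ _ (fun y => (x, y)) V) => //.
  move=> A [[P B] /= [Px By] PB]; apply: filterS By => u Bu; apply: PB; split => //=.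
  exact: nbhs_singleton Px.
- by move=> y; apply: Q0.
- by move=> y ys; apply: V0 => -[].
Qed.

End plane_integrals.

(** * Green's formula *)

Section real_derivatives.
Variable R : realType.
Implicit Types (f g : R -> R) (x a b : R).

Lemma is_dD f g x a b : is_derive x 1 f a -> is_derive x 1 g b ->
  is_derive x 1 (fun t => f t + g t) (a + b).
Proof. by move=> fa gb; exact: (@is_deriveD _ _ _ _ _ _ _ _ _ fa gb). Qed.

Lemma is_dB f g x a b : is_derive x 1 f a -> is_derive x 1 g b ->
  is_derive x 1 (fun t => f t - g t) (a - b).
Proof. by move=> fa gb; exact: (@is_deriveB _ _ _ _ _ _ _ _ _ fa gb). Qed.

Lemma is_dM f g x a b : is_derive x 1 f a -> is_derive x 1 g b ->
  is_derive x 1 (fun t => f t * g t) (f x * b + g x * a).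
Proof. by move=> fa gb; exact: (@is_deriveM _ _ _ _ _ _ _ _ fa gb). Qed.

Lemma is_dC (k : R) x : is_derive x 1 (fun=> k) 0.
Proof. exact: is_derive_cst. Qed.

Lemma is_dI x : is_derive x 1 (fun t : R => t) 1.
Proof. exact: is_derive_id. Qed.

Lemma is_dcomp f g x a b : is_derive x 1 g b -> is_derive (g x) 1 f a ->
  is_derive x 1 (fun t => f (g t)) (a * b).
Proof. by move=> gb fa; exact: (is_derive1_comp fa gb). Qed.

Lemma is_d_continuous f x a : is_derive x 1 f a -> {for x, continuous f}.
Proof. by move=> [d _]; apply/differentiable_continuous/derivable1_diffP. Qed.

Lemma is_d_near f g x a (d : R) : 0 < d -> (forall t, `|t - x| < d -> f t = g t) ->
  is_derive x 1 f a -> is_derive x 1 g a.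
Proof.
move=> d0 fg fa; apply: real_is_derive => e e0.
have [d' d'0 H] := is_derive_eps fa e0.
exists (Num.min d d'); first by rewrite lt_min d0.
move=> h; rewrite lt_min => /andP[hd hd'].
rewrite -!fg ?subrr ?normr0//; first exact: H.
by rewrite addrC addKr.
Qed.

End real_derivatives.

Section green.
Variable R : realType.
Local Notation Re := (@complex.Re R).
Local Notation Im := (@complex.Im R).
Local Notation mu := (@lebesgue_measure R).
Local Notation mT := (measurableTypeR R).

Definition pt (z : R * R) : R[i] := z.1 +i* z.2.

(** This is [1 - |z|^2], preferred to [1 - |z|] because it is a polynomial in the coordinates, hence
    smooth at the origin. *)
Definition defect (z : R * R) : R := 1 - (z.1 ^+ 2 + z.2 ^+ 2).

Lemma defect_normc z : defect z = 1 - normc (pt z) ^+ 2.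
Proof. by rewrite sqr_normcE. Qed.

Lemma defect_gt0 z : (0 < defect z) = (normc (pt z) < 1).
Proof. by rewrite defect_normc subr_gt0 expr_lt1// normcr_ge0. Qed.

Lemma defect_le1 z : defect z <= 1.
Proof. by rewrite /defect gerBl addr_ge0// sqr_ge0. Qed.

Lemma continuous_fst1 (z : R * R) : {for z, continuous (fun z : R * R => z.1)}.
Proof. exact: cvg_fst. Qed.

Lemma continuous_snd1 (z : R * R) : {for z, continuous (fun z : R * R => z.2)}.
Proof. exact: cvg_snd. Qed.

Section pointwise_continuity.
Variables (T : topologicalType) (z : T).
Implicit Types F H : T -> R.

Lemma pcD F H : {for z, continuous F} -> {for z, continuous H} ->
  {for z, continuous (fun z => F z + H z)}.
Proof. by move=> cF cH; exact: (@continuousD _ _ _ F H z cF cH). Qed.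

Lemma pcB F H : {for z, continuous F} -> {for z, continuous H} ->
  {for z, continuous (fun z => F z - H z)}.
Proof. by move=> cF cH; exact: (@continuousB _ _ _ F H z cF cH). Qed.

Lemma pcM F H : {for z, continuous F} -> {for z, continuous H} ->
  {for z, continuous (fun z => F z * H z)}.
Proof. by move=> cF cH; exact: (@continuousM _ _ F H z cF cH). Qed.

Lemma pcK (k : R) : {for z, continuous (fun=> k : R)}.
Proof. exact: cst_continuous. Qed.

Lemma pcX F n : {for z, continuous F} -> {for z, continuous (fun z => F z ^+ n)}.
Proof.
move=> cF; elim: n => [|n ih]; first exact: cst_continuous.
rewrite (_ : (fun z => _) = (fun z => F z * F z ^+ n)); first exact: pcM.
by apply/funext => w; rewrite exprS.
Qed.

Lemma pcc F (phi : R -> R) : {for z, continuous F} -> {for F z, continuous phi} ->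
  {for z, continuous (fun z => phi (F z))}.
Proof. by move=> cF cH; exact: (@continuous_comp _ _ _ F phi z cF cH). Qed.

Lemma pc_near F H : (\forall w \near z, F w = H w) -> {for z, continuous F} ->
  {for z, continuous H}.
Proof.
move=> FH cF A; rewrite /= -(nbhs_singleton FH) => /cF FA.
have FA' : \forall w \near z, A (F w) by exact: FA.
suff : \forall w \near z, A (H w) by [].
by apply: filterS2 FH FA' => w <-.
Qed.

End pointwise_continuity.

Lemma pc_complex (z : R * R) (f : R[i] -> R[i]) : {for pt z, continuous (f : R[i]^o -> R[i]^o)} ->
  {for z, continuous (fun z => Re (f (pt z)))} /\ {for z, continuous (fun z => Im (f (pt z)))}.
Proof.
move=> /continuousCP cf.
have H (e : R) : 0 < e -> \forall w \near z, normc (f (pt z) - f (pt w)) <= e.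
  move=> /cf[d d0 Hd]; have d2 : 0 < d / 2 by rewrite divr_gt0.
  apply/nbhs_ballP; exists (d / 2) => //= w [].
  rewrite /ball /= => w1 w2; rewrite normcBC.
  have := Hd (pt w - pt z); rewrite (_ : pt z + (pt w - pt z) = pt w); last by rewrite addrC subrK.
  apply; apply: le_lt_trans (normc_leReIm _) _; rewrite /pt !cReD !cImD !cReN !cImN /=.
  by rewrite distrC [`|_ - z.2|]distrC (lt_le_trans (ltrD w1 w2))//; lra.
split; apply/cvgrPdist_le => e /H; apply: filterS => w; apply: le_trans; rewrite -?cReN -?cImN -?cReD -?cImD.
- exact: normRe_le.
- exact: normIm_le.
Qed.



Lemma normc_pt_continuous (g : R[i] -> R[i]) z : {for pt z, continuous (g : R[i]^o -> R[i]^o)} ->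
  {for z, continuous (fun z => normc (g (pt z)))}.
Proof.
move=> /pc_complex[ca cb].
have cs : {for z, continuous (fun z => Num.sqrt (Re (g (pt z)) ^+ 2 + Im (g (pt z)) ^+ 2))}.
  by apply: (pcc (phi := Num.sqrt)); [exact: (pcD (pcX (n:=2) ca) (pcX (n:=2) cb))|exact: sqrt_continuous].
rewrite (_ : (fun z => normc _) = (fun z => Num.sqrt (Re (g (pt z)) ^+ 2 + Im (g (pt z)) ^+ 2)))//.
by apply/funext => w; rewrite -sqr_normcE sqrtr_sqr ger0_norm ?normcr_ge0.
Qed.

Lemma defect_continuous z : {for z, continuous defect}.
Proof.
apply: pcB; first exact: pcK.
by apply: pcD; apply: pcX; [exact: continuous_fst1|exact: continuous_snd1].
Qed.

Lemma defect_lt_near z (tau : R) : defect z < tau -> \forall w \near z, defect w < tau.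
Proof.
move=> zt; apply: (@defect_continuous z [set t | t < tau]).
by apply: open_nbhs_nbhs; split; [exact: open_lt|].
Qed.

Lemma powR_continuous (r t : R) : 0 < t -> {for t, continuous (fun t => t `^ r)}.
Proof. by move=> t0; apply: is_d_continuous (is_derive1_powR r t0). Qed.

Variables (f F1 F2 : R[i] -> R[i]) (q tau : R) (G G1 G2 : R -> R).
Hypothesis df : forall w, normc w < 1 -> has_cderive f w (F1 w).
Hypothesis df1 : forall w, normc w < 1 -> has_cderive F1 w (F2 w).
Hypothesis cf2 : forall w, normc w < 1 -> {for w, continuous (F2 : R[i]^o -> R[i]^o)}.
Hypothesis tau0 : 0 < tau.
Hypothesis dG : forall s : R, s <= 1 -> is_derive s 1 G (G1 s).
Hypothesis dG1 : forall s : R, s <= 1 -> is_derive s 1 G1 (G2 s).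
Hypothesis cG2 : forall s : R, s <= 1 -> {for s, continuous G2}.
Hypothesis G_0 : forall s, s <= tau -> [/\ G s = 0, G1 s = 0 & G2 s = 0].

Let a z := Re (f (pt z)). Let b z := Im (f (pt z)).
Let a1 z := Re (F1 (pt z)). Let b1 z := Im (F1 (pt z)).
Let a2 z := Re (F2 (pt z)). Let b2 z := Im (F2 (pt z)).
Let v z := 1 + (a z ^+ 2 + b z ^+ 2).

Lemma dx_complex (h H : R[i] -> R[i]) (x y : R) : has_cderive h (pt (x, y)) (H (pt (x, y))) ->
  is_derive x 1 (fun x : R => Re (h (pt (x, y)))) (Re (H (pt (x, y)))) /\
  is_derive x 1 (fun x : R => Im (h (pt (x, y)))) (Im (H (pt (x, y)))).
Proof.
move=> dh; have := @is_derive_line _ h (0 +i* y) 1 x (H (pt (x, y))).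
rewrite hside_pt mulr1 => /(_ dh).
have E (t : R) : 0 +i* y + t%:C * 1 = pt (t, y) by rewrite hside_pt.
by under eq_fun do rewrite E; under [X in _ /\ is_derive _ _ X _]eq_fun do rewrite E.
Qed.

Lemma dy_complex (h H : R[i] -> R[i]) (x y : R) : has_cderive h (pt (x, y)) (H (pt (x, y))) ->
  is_derive y 1 (fun y : R => Re (h (pt (x, y)))) (- Im (H (pt (x, y)))) /\
  is_derive y 1 (fun y : R => Im (h (pt (x, y)))) (Re (H (pt (x, y)))).
Proof.
move=> dh; have := @is_derive_line _ h x%:C 'i%C y (H (pt (x, y))).
rewrite vside_pt => /(_ dh); rewrite cReM cImM /= mulr0 mulr1 add0r mulr1 mulr0 addr0.
have E (t : R) : x%:C + t%:C * 'i%C = pt (x, t) by rewrite vside_pt.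
by under eq_fun do rewrite E; under [X in _ /\ is_derive _ _ X _]eq_fun do rewrite E.
Qed.

(** With [u = v^q] and the radial function [Phi = G (defect z)], [green_Qx] and [green_Qy] are the
    components of [Phi grad u - u grad Phi].  Its divergence [Phi Lap u - u Lap Phi] is
    [green_Wx + green_Wy]; the Cauchy-Riemann equations express the derivatives of the coordinates
    [a], [b] of [f] through those of [F1 = f'] and [F2 = f'']. *)
Definition green_Qx z := G (defect z) * (q * v z `^ (q - 1) * (2 * (a z * a1 z + b z * b1 z))) +
  v z `^ q * (2 * z.1 * G1 (defect z)).

Definition green_Wx z := G (defect z) *
  (q * (q - 1) * v z `^ (q - 2) * (2 * (a z * a1 z + b z * b1 z)) ^+ 2 +
   q * v z `^ (q - 1) * (2 * (a1 z ^+ 2 + b1 z ^+ 2 + a z * a2 z + b z * b2 z))) -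
  v z `^ q * (4 * z.1 ^+ 2 * G2 (defect z) - 2 * G1 (defect z)).

Definition green_Qy z := G (defect z) * (q * v z `^ (q - 1) * (2 * (b z * a1 z - a z * b1 z))) +
  v z `^ q * (2 * z.2 * G1 (defect z)).

Definition green_Wy z := G (defect z) *
  (q * (q - 1) * v z `^ (q - 2) * (2 * (b z * a1 z - a z * b1 z)) ^+ 2 +
   q * v z `^ (q - 1) * (2 * (a1 z ^+ 2 + b1 z ^+ 2 - a z * a2 z - b z * b2 z))) -
  v z `^ q * (4 * z.2 ^+ 2 * G2 (defect z) - 2 * G1 (defect z)).

Lemma v_gt0 z : 0 < v z.
Proof. by rewrite /v ltr_pwDl// addr_ge0// sqr_ge0. Qed.

Lemma green_W0 z : defect z <= tau -> green_Wx z = 0 /\ green_Wy z = 0.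
Proof.
by move=> /G_0[h0 h1 h2]; rewrite /green_Wx /green_Wy h0 h1 h2; split; rewrite !(mul0r, mulr0, subrr).
Qed.

Lemma green_Q0 z : defect z <= tau -> green_Qx z = 0 /\ green_Qy z = 0.
Proof.
by move=> /G_0[h0 h1 h2]; rewrite /green_Qx /green_Qy h0 h1; split; rewrite !(mul0r, mulr0, addr0).
Qed.

Lemma defect_square z : ~ square z -> defect z <= tau.
Proof.
move=> sz; apply: (@le_trans _ _ 0); last exact: ltW.
rewrite leNgt; apply/negP; rewrite /defect => H; apply: sz.
have x2 := sqr_ge0 z.1; have y2 := sqr_ge0 z.2.
by split; rewrite /= in_itv /=; apply/andP; split; nra.
Qed.

Lemma green_cont z : {for z, continuous green_Wx} /\ {for z, continuous green_Wy}.
Proof.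
have [zs|zs] := ltP (defect z) tau.
  have H := defect_lt_near zs.
  by split; apply: (@pc_near _ _ (fun=> 0)) => //; try exact: pcK; apply: filterS H => w /ltW /green_W0[].
have n1 : normc (pt z) < 1 by rewrite -defect_gt0 (lt_le_trans tau0).
have [ca cb] := pc_complex (has_cderive_continuous (df n1)).
have [ca1 cb1] := pc_complex (has_cderive_continuous (df1 n1)).
have [ca2 cb2] := pc_complex (cf2 n1).
have cv : {for z, continuous v} by apply: pcD; [exact: pcK|apply: pcD; exact: pcX].
have cvr r := pcc cv (@powR_continuous r _ (v_gt0 z)).
have cs := @defect_continuous z.
have cG := pcc cs (is_d_continuous (dG (defect_le1 _))).
have cG1 := pcc cs (is_d_continuous (dG1 (defect_le1 _))).
have cGG2 := pcc cs (cG2 (defect_le1 _)).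
have c1 := @continuous_fst1 z; have c2 := @continuous_snd1 z.
have ck k := @pcK _ z k.
split.
- exact: (pcB (pcM cG (pcD (pcM (pcM (ck (q * (q - 1))) (cvr (q - 2)))
    (pcX (n:=2) (pcM (ck 2) (pcD (pcM ca ca1) (pcM cb cb1)))))
   (pcM (pcM (ck q) (cvr (q - 1)))
    (pcM (ck 2) (pcD (pcD (pcD (pcX (n:=2) ca1) (pcX (n:=2) cb1)) (pcM ca ca2)) (pcM cb cb2))))))
   (pcM (cvr q) (pcB (pcM (pcM (ck 4) (pcX (n:=2) c1)) cGG2) (pcM (ck 2) cG1)))).
- exact: (pcB (pcM cG (pcD (pcM (pcM (ck (q * (q - 1))) (cvr (q - 2)))
    (pcX (n:=2) (pcM (ck 2) (pcB (pcM cb ca1) (pcM ca cb1)))))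
   (pcM (pcM (ck q) (cvr (q - 1)))
    (pcM (ck 2) (pcB (pcB (pcD (pcX (n:=2) ca1) (pcX (n:=2) cb1)) (pcM ca ca2)) (pcM cb cb2))))))
   (pcM (cvr q) (pcB (pcM (pcM (ck 4) (pcX (n:=2) c2)) cGG2) (pcM (ck 2) cG1)))).
Qed.

Lemma is_dX2 (h : R -> R) (x l : R) : is_derive x 1 h l ->
  is_derive x 1 (fun t => h t ^+ 2) (2 * h x * l).
Proof.
move=> dh; have := is_dM dh dh; rewrite (_ : h x * l + h x * l = 2 * h x * l); last by ring.
by rewrite (_ : (fun t => h t * h t) = (fun t => h t ^+ 2))//; apply/funext => t; rewrite expr2.
Qed.

Lemma green_dx (x y : R) : is_derive x 1 (fun x => green_Qx (x, y)) (green_Wx (x, y)).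
Proof.
have [zs|zs] := ltP (defect (x, y)) tau.
  have /nbhs_ballP[d /= d0 H] := defect_lt_near zs.
  rewrite (green_W0 (ltW zs)).1; apply: (is_d_near d0 _ (is_dC 0 x)) => t tx.
  by rewrite (green_Q0 _).1// ltW//; apply: H; split; [rewrite /ball /= distrC|exact: ballxx].
have n1 : normc (pt (x, y)) < 1 by rewrite -defect_gt0 (lt_le_trans tau0).
have [da db] := dx_complex (df n1).
have [da1 db1] := dx_complex (df1 n1).
have ds : is_derive x 1 (fun x => defect (x, y)) (0 - (2 * x * 1 + 0)) :=
  is_dB (is_dC 1 x) (is_dD (is_dX2 (is_dI x)) (is_dC (y ^+ 2) x)).
have dv := is_dD (is_dC 1 x) (is_dD (is_dX2 da) (is_dX2 db)).
have dvr r := is_dcomp dv (is_derive1_powR r (v_gt0 (x, y))).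
have d1 := is_dcomp ds (dG (defect_le1 _)).
have d2 := is_dcomp ds (dG1 (defect_le1 _)).
have := is_dD (is_dM d1 (is_dM (is_dM (is_dC q x) (dvr (q - 1)))
    (is_dM (is_dC 2 x) (is_dD (is_dM da da1) (is_dM db db1)))))
  (is_dM (dvr q) (is_dM (is_dM (is_dC 2 x) (is_dI x)) d2)).
move=> dQ; apply: (is_derive_eq dQ); rewrite /green_Wx (_ : q - 1 - 1 = q - 2); last by ring.
rewrite -/(v (x, y)) /= -/(a (x, y)) -/(b (x, y)) -/(a1 (x, y)) -/(b1 (x, y)) -/(a2 (x, y)) -/(b2 (x, y)).
move: (a (x, y)) (b (x, y)) (a1 (x, y)) (b1 (x, y)) (a2 (x, y)) (b2 (x, y)) (v (x, y)) (defect _).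
by move=> A B A1 B1 A2 B2 V s; ring.
Qed.

Lemma green_dy (x y : R) : is_derive y 1 (fun y => green_Qy (x, y)) (green_Wy (x, y)).
Proof.
have [zs|zs] := ltP (defect (x, y)) tau.
  have /nbhs_ballP[d /= d0 H] := defect_lt_near zs.
  rewrite (green_W0 (ltW zs)).2; apply: (is_d_near d0 _ (is_dC 0 y)) => t ty.
  by rewrite (green_Q0 _).2// ltW//; apply: H; split; [exact: ballxx|rewrite /ball /= distrC].
have n1 : normc (pt (x, y)) < 1 by rewrite -defect_gt0 (lt_le_trans tau0).
have [da db] := dy_complex (df n1).
have [da1 db1] := dy_complex (df1 n1).
have ds : is_derive y 1 (fun y => defect (x, y)) (0 - (0 + 2 * y * 1)) :=
  is_dB (is_dC 1 y) (is_dD (is_dC (x ^+ 2) y) (is_dX2 (is_dI y))).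
have dv := is_dD (is_dC 1 y) (is_dD (is_dX2 da) (is_dX2 db)).
have dvr r := is_dcomp dv (is_derive1_powR r (v_gt0 (x, y))).
have d1 := is_dcomp ds (dG (defect_le1 _)).
have d2 := is_dcomp ds (dG1 (defect_le1 _)).
have := is_dD (is_dM d1 (is_dM (is_dM (is_dC q y) (dvr (q - 1)))
    (is_dM (is_dC 2 y) (is_dB (is_dM db da1) (is_dM da db1)))))
  (is_dM (dvr q) (is_dM (is_dM (is_dC 2 y) (is_dI y)) d2)).
move=> dQ; apply: (is_derive_eq dQ); rewrite /green_Wy (_ : q - 1 - 1 = q - 2); last by ring.
rewrite -/(v (x, y)) /= -/(a (x, y)) -/(b (x, y)) -/(a1 (x, y)) -/(b1 (x, y)) -/(a2 (x, y)) -/(b2 (x, y)).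
move: (a (x, y)) (b (x, y)) (a1 (x, y)) (b1 (x, y)) (a2 (x, y)) (b2 (x, y)) (v (x, y)) (defect _).
by move=> A B A1 B1 A2 B2 V s; ring.
Qed.

(** The second derivatives [a2], [b2] cancel in the divergence, because [f] is harmonic.  The field
    is supported in [tau <= defect z], so its divergence has integral zero. *)
Lemma green_identity (W : R * R -> R) :
  (forall z, W z = G (defect z) * (4 * q * (q - 1) * v z `^ (q - 2) *
      ((a z ^+ 2 + b z ^+ 2) * (a1 z ^+ 2 + b1 z ^+ 2)) +
      4 * q * v z `^ (q - 1) * (a1 z ^+ 2 + b1 z ^+ 2)) -
    v z `^ q * (4 * ((1 - defect z) * G2 (defect z) - G1 (defect z)))) ->
  [/\ forall z, {for z, continuous W}, forall z, ~ square z -> W z = 0 &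
    (\int[(mu \x mu)%E]_z (W z)%:E = 0)%E].
Proof.
move=> WE.
have E : W = (fun z => green_Wx z + green_Wy z).
  apply/funext => z; rewrite WE /green_Wx /green_Wy.
  rewrite (_ : 1 - defect z = z.1 ^+ 2 + z.2 ^+ 2); last by rewrite /defect; ring.
  move: (a z) (b z) (a1 z) (b1 z) (a2 z) (b2 z) (v z) (defect _) z.1 z.2.
  by move=> A B A1 B1 A2 B2 V s x y; ring.
have Wsq z : ~ square z -> green_Wx z = 0 /\ green_Wy z = 0.
  by move=> /defect_square /green_W0.
have cx z : {for z, continuous green_Wx} by have [] := green_cont z.
have cy z : {for z, continuous green_Wy} by have [] := green_cont z.
have Qsq (x y : R) : 1 <= `|x| \/ 1 <= `|y| -> defect (x, y) <= tau.
  move=> xy; apply: (@le_trans _ _ 0); last exact: ltW.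
  have x2 := sqr_ge0 x; have y2 := sqr_ge0 y.
  rewrite /defect /=; case: xy => h.
    have : 1 <= x ^+ 2 by rewrite -real_normK ?num_real// exprn_ege1.
    lra.
  have : 1 <= y ^+ 2 by rewrite -real_normK ?num_real// exprn_ege1.
  lra.
have ix := iint_derivative1 cx (fun z h => (Wsq z h).1) green_dx
  (fun x y h => (green_Q0 (Qsq x y (or_introl h))).1).
have iy := iint_derivative2 cy (fun z h => (Wsq z h).2) green_dy
  (fun x y h => (green_Q0 (Qsq x y (or_intror h))).2).
split.
- by move=> z; rewrite E; apply: pcD.
- by move=> z /Wsq[h1 h2]; rewrite E h1 h2 addr0.
- rewrite E; under eq_integral do rewrite EFinD.
  rewrite integralD//; first by rewrite ix iy adde0.
  + by apply: integrable_continuous_square => // z /Wsq[].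
  + by apply: integrable_continuous_square => // z /Wsq[].
Qed.

End green.

(** * The radial weight *)

Section weight.
Variable R : realType.
Implicit Types s t x : R.

Definition pos t : R := Num.max 0 t.

Lemma pos_ge0 t : 0 <= pos t. Proof. by rewrite /pos le_max lexx. Qed.

Lemma pos_id t : 0 <= t -> pos t = t. Proof. by move=> ?; rewrite /pos max_r. Qed.

Lemma pos_eq0 t : t <= 0 -> pos t = 0. Proof. by move=> ?; rewrite /pos max_l. Qed.

Lemma pos_le_norm t : pos t <= `|t|.
Proof. by rewrite /pos ge_max normr_ge0 ler_norm. Qed.

Lemma is_dXn n x : is_derive x 1 (fun t => t ^+ n) (n%:R * x ^+ n.-1).
Proof.
elim: n => [|n ih]; first by rewrite mul0r; exact: is_dC.
have d := is_dM (is_dI x) ih.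
rewrite (_ : (fun t => t ^+ n.+1) = (fun t => t * t ^+ n)); last by apply/funext => t; rewrite exprS.
apply: (is_derive_eq d); rewrite -natr1 /=; case: n {ih d} => [|n]; first by rewrite expr0; ring.
by rewrite /= !exprS; ring.
Qed.

(** The powers from the second on are continuously differentiable, which is why the cube of [pos] is
    used in the weight: two derivatives have to be continuous. *)
Lemma is_d_pos n t : is_derive t 1 (fun t => pos t ^+ n.+2) (n.+2%:R * pos t ^+ n.+1).
Proof.
have [t0|t0|->] := ltgtP t 0.
- rewrite (pos_eq0 (ltW t0)) expr0n mulr0.
  apply: (@is_d_near _ (fun=> 0) _ t 0 (- t) _ _ (is_dC 0 t)); rewrite ?oppr_gt0//.
  move=> u; rewrite ltr_norml => /andP[_ ut]; rewrite pos_eq0 ?expr0n//; lra.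
- rewrite (pos_id (ltW t0)).
  apply: (@is_d_near _ (fun t => t ^+ n.+2) _ t _ t t0 _ (is_dXn n.+2 t)).
  by move=> u; rewrite ltr_norml => /andP[ut _]; rewrite pos_id//; lra.
- rewrite (pos_eq0 (lexx 0)) expr0n mulr0; apply: real_is_derive => e e0.
  exists (Num.min 1 e); first by rewrite lt_min ltr01.
  move=> h; rewrite lt_min => /andP[h1 he].
  rewrite add0r (pos_eq0 (lexx 0)) expr0n subr0 mulr0 subr0 ger0_norm ?exprn_ge0 ?pos_ge0//.
  apply: (@le_trans _ _ (`|h| ^+ n.+2)); first by rewrite lerXn2r ?nnegrE ?pos_ge0// pos_le_norm.
  rewrite exprSr ler_wpM2r// exprS (le_trans _ (ltW he))//.
  by rewrite ler_piMr// exprn_ile1// ltW.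
Qed.

Lemma pos_continuous t : {for t, continuous pos}.
Proof.
apply/cvgrPdist_le => e e0; near=> u.
apply: (@le_trans _ _ `|t - u|); last first.
  by near: u; apply: (@cvgr_dist_le _ R^o _ _ _ id t).
rewrite /pos; have [a|a] := leP 0 t; have [b|b] := leP 0 u => //.
- by rewrite subr0 ger0_norm// (le_trans _ (ler_norm _))//; lra.
- by rewrite sub0r normrN ger0_norm// distrC (le_trans _ (ler_norm _))//; lra.
- by rewrite subrr normr0.
Unshelve. all: end_near. Qed.

(** The hypothesis on the measure is about [ln (e / t) = 1 - ln t]. *)
Definition lam s : R := 1 - ln s.

Lemma lam_ge1 s : s <= 1 -> 1 <= lam s.
Proof. by move=> s1; rewrite /lam lerDl oppr_ge0 ln_le0. Qed.

Lemma lam_gt0 s : s <= 1 -> 0 < lam s.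
Proof. by move=> /lam_ge1; exact: lt_le_trans. Qed.

Lemma is_d_lam s : 0 < s -> is_derive s 1 lam (- s^-1).
Proof. by move=> s0; rewrite -[- _]sub0r; exact: (is_dB (is_dC 1 s) (is_derive1_ln s0)). Qed.

Lemma is_d_lam_pow r s : 0 < s -> s <= 1 ->
  is_derive s 1 (fun s => lam s `^ r) (r * lam s `^ (r - 1) * - s^-1).
Proof.
by move=> s0 s1; exact: (is_dcomp (is_d_lam s0) (is_derive1_powR r (lam_gt0 s1))).
Qed.

Lemma is_d_inv_pow n s : 0 < s ->
  is_derive s 1 (fun s => (s ^+ n)^-1) (- n%:R * (s ^+ n.+1)^-1).
Proof.
move=> s0.
have sn0 : s ^+ n != 0 by rewrite expf_neq0// gt_eqF.
have dV := @is_deriveV _ (fun t => t ^+ n) s _ _ sn0 (is_dXn n s); apply: (is_derive_eq dV).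
rewrite /GRing.scale /=.
case: n sn0 dV => [|n] sn0 dV; first by rewrite !(mul0r, oppr0, mulr0).
rewrite /= !exprS; field; rewrite ?expf_neq0// gt_eqF//.
Qed.

Lemma ln_le_sub1 x : 0 < x -> ln x <= x - 1.
Proof.
move=> x0; have := @le_ln1Dx _ (x - 1); rewrite [1 + _]addrC subrK; apply; lra.
Qed.

(** The bound [ln x <= x - 1] at [x = 1 / sqrt s]. *)
Lemma mul_lam_le s : 0 < s -> s * lam s <= 2 * Num.sqrt s.
Proof.
move=> s0; set r := Num.sqrt s; have r0 : 0 < r by rewrite sqrtr_gt0.
have sE : s = r ^+ 2 by rewrite sqr_sqrtr// ltW.
have := @ln_le_sub1 r^-1 ltac:(by rewrite invr_gt0); rewrite lnV ?posrE// => H.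
rewrite /lam sE lnXn// mulr_natl mulr2n.
have H2 : r * (1 - (ln r + ln r)) <= r * (1 + 2 * (r^-1 - 1)) by rewrite ler_pM2l//; lra.
have E : r * (1 + 2 * (r^-1 - 1)) = 2 - r by field; rewrite gt_eqF.
rewrite E in H2.
have : r * (r * (1 - (ln r + ln r))) <= r * (2 - r) by rewrite ler_pM2l.
have := sqr_ge0 r; rewrite !expr2; nra.
Qed.

Variable q : R.
Hypothesis q1 : 1 < q.
Variable tau : R.
Hypothesis tau0 : 0 < tau.

Let K s := (s ^+ 2)^-1 * lam s `^ (1 - q).
Let K1 s := - 2 * ((s ^+ 3)^-1 * lam s `^ (1 - q)) + (q - 1) * ((s ^+ 3)^-1 * lam s `^ (- q)).
Let K2 s := 6 * ((s ^+ 4)^-1 * lam s `^ (1 - q)) - 5 * (q - 1) * ((s ^+ 4)^-1 * lam s `^ (- q)) +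
   q * (q - 1) * ((s ^+ 4)^-1 * lam s `^ (- q - 1)).

Lemma is_d_K s : 0 < s -> s <= 1 -> is_derive s 1 K (K1 s).
Proof.
move=> s0 s1; have d := is_dM (is_d_inv_pow 2 s0) (is_d_lam_pow (1 - q) s0 s1).
apply: (is_derive_eq d); rewrite /K1 (_ : 1 - q - 1 = - q); last by ring.
by field; rewrite gt_eqF.
Qed.

Lemma is_d_K1 s : 0 < s -> s <= 1 -> is_derive s 1 K1 (K2 s).
Proof.
move=> s0 s1.
have d := is_dD (is_dM (is_dC (- 2) s) (is_dM (is_d_inv_pow 3 s0) (is_d_lam_pow (1 - q) s0 s1)))
  (is_dM (is_dC (q - 1) s) (is_dM (is_d_inv_pow 3 s0) (is_d_lam_pow (- q) s0 s1))).
apply: (is_derive_eq d); rewrite /K2 (_ : 1 - q - 1 = - q); last by ring.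
by field; rewrite gt_eqF.
Qed.

(** A regularisation of [s * lam s `^ (1 - q)] that vanishes for [s <= tau] together with its first
    two derivatives [wG1] and [wG2]. *)
Definition wG s := pos (s - tau) ^+ 3 * K s.
Definition wG1 s := 3 * pos (s - tau) ^+ 2 * K s + pos (s - tau) ^+ 3 * K1 s.
Definition wG2 s := 6 * pos (s - tau) * K s + 6 * pos (s - tau) ^+ 2 * K1 s +
  pos (s - tau) ^+ 3 * K2 s.

Lemma wG_0 s : s <= tau -> [/\ wG s = 0, wG1 s = 0 & wG2 s = 0].
Proof.
move=> st; rewrite /wG /wG1 /wG2 pos_eq0 ?subr_le0// !expr0n /=.
by rewrite !(mulr0, mul0r, addr0).
Qed.

Lemma near_below s : s < tau -> forall t, `|t - s| < tau - s -> t <= tau.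
Proof. by move=> st t; rewrite ltr_norml => /andP[_]; lra. Qed.

Lemma is_d_pos_tau n s : is_derive s 1 (fun s => pos (s - tau) ^+ n.+2)
  (n.+2%:R * pos (s - tau) ^+ n.+1).
Proof.
have d := is_dcomp (is_dB (is_dI s) (is_dC tau s)) (is_d_pos n (s - tau)).
by apply: (is_derive_eq d); rewrite subr0 mulr1.
Qed.

Lemma is_d_wG s : s <= 1 -> is_derive s 1 wG (wG1 s).
Proof.
move=> s1; have [st|st] := ltP s tau.
  have [_ -> _] := wG_0 (ltW st); apply: (@is_d_near _ (fun=> 0) _ s 0 (tau - s) _ _ (is_dC 0 s)).
  - by rewrite subr_gt0.
  - by move=> t /(near_below st) /wG_0[-> _ _].
have d := is_dM (is_d_pos_tau 1 s) (is_d_K (lt_le_trans tau0 st) s1).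
apply: (is_derive_eq d); rewrite /wG1; ring.
Qed.

Lemma is_d_wG1 s : s <= 1 -> is_derive s 1 wG1 (wG2 s).
Proof.
move=> s1; have [st|st] := ltP s tau.
  have [_ _ ->] := wG_0 (ltW st); apply: (@is_d_near _ (fun=> 0) _ s 0 (tau - s) _ _ (is_dC 0 s)).
  - by rewrite subr_gt0.
  - by move=> t /(near_below st) /wG_0[_ -> _].
have s0 := lt_le_trans tau0 st.
have d := is_dD (is_dM (is_dM (is_dC 3 s) (is_d_pos_tau 0 s)) (is_d_K s0 s1))
  (is_dM (is_d_pos_tau 1 s) (is_d_K1 s0 s1)).
apply: (is_derive_eq d); rewrite /wG2 expr1; ring.
Qed.

Lemma wG2_continuous s : s <= 1 -> {for s, continuous wG2}.
Proof.
move=> s1; have [st|st] := ltP s tau.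
  apply: (@pc_near _ _ _ (fun=> 0)); last exact: pcK.
  apply/nbhs_ballP; exists (tau - s) => /=; first by rewrite subr_gt0.
  move=> t; rewrite /ball /= distrC => /(near_below st) /wG_0[_ _ ->] //.
have s0 := lt_le_trans tau0 st.
have cp : {for s, continuous (fun s => pos (s - tau))}.
  apply: (@pcc _ _ _ (fun s => s - tau) pos); last exact: pos_continuous.
  exact: (is_d_continuous (is_dB (is_dI s) (is_dC tau s))).
have cK := is_d_continuous (is_d_K s0 s1).
have cK1 := is_d_continuous (is_d_K1 s0 s1).
have cl r := is_d_continuous (is_d_lam_pow r s0 s1).
have ci := is_d_continuous (is_d_inv_pow 4 s0).
have ck k := @pcK R _ s k.
have cK2 : {for s, continuous K2} :=
  pcD (pcB (pcM (ck 6) (pcM ci (cl (1 - q)))) (pcM (ck (5 * (q - 1))) (pcM ci (cl (- q)))))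
   (pcM (ck (q * (q - 1))) (pcM ci (cl (- q - 1)))).
exact: (pcD (pcD (pcM (pcM (ck 6) cp) cK) (pcM (pcM (ck 6) (pcX (n:=2) cp)) cK1))
  (pcM (pcX (n:=3) cp) cK2)).
Qed.

(** The regularised lower bound of the Laplacian; it increases to [s^-1 * lam s `^ (- q)] as [tau]
    tends to zero. *)
Definition wphi s := pos (s - tau) * (s ^+ 2)^-1 * lam s `^ (- q).

Lemma wphi_ge0 s : 0 <= wphi s.
Proof. by rewrite !mulr_ge0 ?pos_ge0 ?powR_ge0// invr_ge0 sqr_ge0. Qed.

Lemma pos_tau_le s : 0 < s -> pos (s - tau) <= s.
Proof. by move=> s0; have t0 := tau0; rewrite /pos ge_max; apply/andP; split; lra. Qed.

Lemma wphi_le s : 0 < s -> wphi s <= s^-1 * lam s `^ (- q).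
Proof.
move=> s0; rewrite ler_wpM2r ?powR_ge0//.
have -> : s^-1 = s * (s ^+ 2)^-1 by field; rewrite gt_eqF.
by rewrite ler_wpM2r ?invr_ge0 ?sqr_ge0// pos_tau_le.
Qed.

Lemma wphi_ge s : 2 * tau <= s -> s^-1 * lam s `^ (- q) <= 2 * wphi s.
Proof.
move=> st; have t0 := tau0; have s0 : 0 < s by lra.
rewrite /wphi !mulrA ler_wpM2r ?powR_ge0//.
rewrite pos_id; last by lra.
have -> : s^-1 = s * (s ^+ 2)^-1 by field; rewrite gt_eqF.
by rewrite ler_wpM2r ?invr_ge0 ?sqr_ge0//; lra.
Qed.

Lemma lam_powE s : s <= 1 -> lam s `^ (- q) = lam s * lam s `^ (- q - 1) /\
  lam s `^ (1 - q) = lam s ^+ 2 * lam s `^ (- q - 1).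
Proof.
move=> s1; have l0 := lam_gt0 s1.
split.
  rewrite -{2}(powRr1 (ltW l0)) -powRD; last by rewrite (gt_eqF l0) implybT.
  by congr powR; ring.
rewrite -powR_mulrn ?ltW// -powRD; last by rewrite (gt_eqF l0) implybT.
by congr powR; ring.
Qed.

Lemma wG_ge0 s : 0 <= wG s.
Proof.
by rewrite mulr_ge0 ?exprn_ge0 ?pos_ge0// mulr_ge0 ?powR_ge0// invr_ge0 sqr_ge0.
Qed.

Lemma wG_le s : 0 < s -> s <= 1 -> wG s <= s ^+ 2 * lam s * wphi s.
Proof.
move=> s0 s1; rewrite /wG /wphi /K.
have [-> ->] := lam_powE s1.
have l0 := lam_gt0 s1; have m0 := powR_ge0 (lam s) (- q - 1).
set y := pos _; have y0 : 0 <= y := pos_ge0 _.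
have ys : y <= s by exact: pos_tau_le.
have -> : y ^+ 3 * ((s ^+ 2)^-1 * (lam s ^+ 2 * lam s `^ (- q - 1))) =
   y ^+ 2 * (lam s * (y * (s ^+ 2)^-1 * (lam s * lam s `^ (- q - 1)))) by ring.
rewrite -[leRHS]mulrA; apply: ler_wpM2r; last by rewrite lerXn2r ?nnegrE ?(ltW s0).
by rewrite !mulr_ge0 ?(ltW l0)// invr_ge0 sqr_ge0.
Qed.

(** Since [Lap (G (1 - |z|^2)) = 4 ((1 - s) G'' (s) - G' (s))], this bounds the Laplacian of the weight
    below.  With [y = s - tau], [wG2] is [y s^-4 lam^(-q-1)] times a form in [s - y] and [y] whose
    coefficients are positive because [q > 1]; hence [wG2 >= c wphi].  The term [wG1] and the
    factor [1 - s] cost at most [wphi] times a multiple of [sqrt s], as [s lam s <= 2 sqrt s]: this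
    is absorbed when [sqrt s <= r0], and it is always at most a multiple of [s^-1]. *)
Lemma wG_laplacian (c r0 M : R) s : tau <= s -> s <= 1 ->
  0 < c -> c <= 3 -> 2 * c <= q - 1 -> M = 2 * (q + 2) ->
  0 < r0 -> (c + M) * r0 <= c / 2 ->
  (s <= r0 ^+ 2 -> c / 2 * wphi s <= (1 - s) * wG2 s - wG1 s) /\
  c / 2 * wphi s - (c / 2 + M) * s^-1 <= (1 - s) * wG2 s - wG1 s.
Proof.
move=> st s1 c0 c3 cq ME r00 r0c; have t0 := tau0.
have s0 : 0 < s := lt_le_trans tau0 st.
have l1 := lam_ge1 s1; have l0 := lam_gt0 s1.
have m0 := powR_ge0 (lam s) (- q - 1).
pose y := s - tau; have y0 : 0 <= y by rewrite subr_ge0.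
have yE : pos (s - tau) = y by rewrite pos_id.
have ys : y <= s by rewrite /y; lra.
have [e1 e2] := lam_powE s1.
pose L := lam s; pose m := lam s `^ (- q - 1).
pose k := q - 1; have k0 : 0 < k by rewrite subr_gt0.
have phiE : wphi s = y * (s ^+ 2)^-1 * (L * m) by rewrite /wphi yE e1.
have phi0 := wphi_ge0 s.
have G1le : wG1 s <= (q + 2) * (s * L) * wphi s.
  have -> : wG1 s = y ^+ 2 * (s ^+ 3)^-1 * m * L * (3 * s * L + y * (k - 2 * L)).
    by rewrite /wG1 /K /K1 yE e1 e2 -/L -/m /k; field; rewrite gt_eqF.
  have -> : (q + 2) * (s * L) * wphi s = y * s * (s ^+ 3)^-1 * m * L * ((3 + k) * s * L).
    by rewrite phiE /k; field; rewrite gt_eqF.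
  have A0 : 0 <= (s ^+ 3)^-1 * m * L.
    by rewrite !mulr_ge0 ?(ltW l0)// invr_ge0 exprn_ge0// ltW.
  have h1 : y * (y * (3 * s * L + y * (k - 2 * L))) <= y * (s * ((3 + k) * s * L)).
    apply: ler_wpM2l => //; apply: (@le_trans _ _ (y * ((3 + k) * s * L))).
      apply: ler_wpM2l => //.
      have h2 : y * k <= s * (k * L).
        by apply: ler_pM => //; rewrite ?(ltW k0)// ler_peMr// ltW.
      have h3 : 0 <= y * L by rewrite mulr_ge0// ltW.
      by lra.
    by apply: ler_wpM2r => //; rewrite !mulr_ge0 ?(ltW s0) ?(ltW l0)// addr_ge0// ltW.
  have := ler_wpM2l A0 h1; set B := (s ^+ 3)^-1; lra.
have G2ge : c * wphi s <= wG2 s.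
  (* The completed form: [k = q - 1 > 0], and [6 s - 5 y >= s] as [y <= s]. *)
  have -> : wG2 s = y * (s ^+ 4)^-1 * m *
     (6 * L ^+ 2 * (s - y) ^+ 2 + k * L * y * (6 * s - 5 * y) + q * k * y ^+ 2).
    by rewrite /wG2 /K /K1 /K2 yE e1 e2 -/L -/m /k; field; rewrite gt_eqF.
  have -> : c * wphi s = y * (s ^+ 4)^-1 * m * (c * L * s ^+ 2).
    by rewrite phiE; field; rewrite gt_eqF.
  apply: ler_wpM2l; first by rewrite !mulr_ge0// invr_ge0 exprn_ge0// ltW.
  pose d := s - y; have d0 : 0 <= d by rewrite subr_ge0.
  have sE : s = d + y by rewrite /d subrK.
  (* With [d = s - y], [s ^ 2 = 2 d ^ 2 + 2 y s - (d ^ 2 + y ^ 2)], see [i5]; each positive part is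
   dominated by one term of the form. *)
  have i1 : c * L * (2 * d ^+ 2) <= 6 * L ^+ 2 * d ^+ 2.
    have : c * L <= 3 * (L * L) by rewrite ler_pM ?(ltW c0) ?(ltW l0)// ler_peMr// ltW.
    by move=> /(ler_wpM2r (sqr_ge0 d)); rewrite expr2; lra.
  have i2 : c * L * (2 * (y * s)) <= k * L * y * (6 * s - 5 * y).
    have Ly0 : 0 <= L * y by rewrite mulr_ge0// ltW.
    have : c * 2 * s <= k * (6 * s - 5 * y).
      by apply: ler_pM; rewrite ?mulr_ge0 ?(ltW c0) ?(ltW s0)//; rewrite /k; lra.
    by move=> /(ler_wpM2l Ly0); lra.
  have i3 : 0 <= q * k * y ^+ 2 by rewrite !mulr_ge0 ?sqr_ge0 ?(ltW k0)//; lra.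
  have i4 : 0 <= c * L * (d ^+ 2 + y ^+ 2).
    by rewrite !mulr_ge0 ?(ltW c0) ?(ltW l0)// addr_ge0 ?sqr_ge0.
  have i5 : c * L * s ^+ 2 = c * L * (2 * d ^+ 2) + c * L * (2 * (y * s)) - c * L * (d ^+ 2 + y ^+ 2).
    by rewrite sE; ring.
  by rewrite -/d i5; lra.
have main : (c * (1 - s) - (q + 2) * (s * L)) * wphi s <= (1 - s) * wG2 s - wG1 s.
  have h : (1 - s) * (c * wphi s) <= (1 - s) * wG2 s by rewrite ler_wpM2l// subr_ge0.
  by lra.
have sL := mul_lam_le s0; rewrite -/(lam s) -/L in sL.
pose r := Num.sqrt s; have rr : 0 < r by rewrite sqrtr_gt0.
have sr : s = r ^+ 2 by rewrite sqr_sqrtr// ltW.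
have r1 : r <= 1 by rewrite -(@ler_sqr _ r 1) ?nnegrE ?(ltW rr)// -sr expr1n.
have q20 : 0 <= q + 2 by have := q1; lra.
have sL' : (q + 2) * (s * L) <= M * r.
  by rewrite ME; apply: le_trans (ler_wpM2l q20 sL) _; rewrite -/r; lra.
split.
  move=> sr0; apply: le_trans main; apply: ler_wpM2r => //.
  have rr0 : r <= r0 by rewrite -(@ler_sqr _ r r0) ?nnegrE ?(ltW rr) ?(ltW r00)// -sr.
  have h : (c + M) * r <= (c + M) * r0 by rewrite ler_wpM2l//; lra.
  have h' : c * s <= c * r by rewrite ler_pM2l// sr expr2 ler_piMr// ltW.
  by lra.
apply: le_trans main.
have phis : wphi s <= s^-1.
  apply: le_trans (wphi_le s0) _; rewrite ler_piMr ?invr_ge0 ?(ltW s0)//.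
  by rewrite -[leRHS](powRr0 (lam s)) ler_powR//; have := q1; lra.
have M0 : 0 <= M by lra.
have h1 : (c / 2 + M) * wphi s <= (c / 2 + M) * s^-1 by rewrite ler_wpM2l//; lra.
have h2 : (- M) * wphi s <= (c * (1 - s) - (q + 2) * (s * L)) * wphi s.
  apply: ler_wpM2r => //.
  have : M * r <= M by rewrite ler_piMr.
  have : 0 <= c * (1 - s) by rewrite mulr_ge0 ?(ltW c0)// subr_ge0.
  by lra.
by lra.
Qed.

End weight.

(** * The weighted inequality *)

Section weighted_estimate.
Variable R : realType.
Local Notation Re := (@complex.Re R).
Local Notation Im := (@complex.Im R).
Local Notation mu := (@lebesgue_measure R).
Local Notation mT := (measurableTypeR R).
Local Notation mu2 := (mu \x mu)%E.

(** Young's inequality with exponents [q / (q - 1)] and [q], by comparing [A] with [c v]: according to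
    the larger one, the left side is below the first or the second term. *)
Lemma young_powR (q A v c : R) : 1 < q -> 0 <= A -> 0 < v -> 0 < c ->
  A * v `^ (q - 1) <= c * v `^ q + c `^ (1 - q) * A `^ q.
Proof.
move=> q1 A0 v0 c0.
have vq : v `^ q = v * v `^ (q - 1).
  by rewrite -{2}(powRr1 (ltW v0)) -powRD ?(gt_eqF v0) ?implybT//; congr powR; ring.
have [Acv|Acv] := leP A (c * v).
  rewrite vq mulrA; apply: (@le_trans _ _ (c * v * v `^ (q - 1))).
    by rewrite ler_wpM2r ?powR_ge0.
  by rewrite lerDl mulr_ge0 ?powR_ge0.
have Ap : 0 < A by rewrite (le_lt_trans _ Acv)// mulr_ge0 ?ltW.
have Aq : A `^ q = A * A `^ (q - 1).
  by rewrite -{2}(powRr1 (ltW Ap)) -powRD ?(gt_eqF Ap) ?implybT//; congr powR; ring.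
have vA : v `^ (q - 1) <= (c^-1 * A) `^ (q - 1).
  apply: ge0_ler_powR; rewrite ?nnegrE ?(ltW v0)//; first by lra.
  - by rewrite mulr_ge0 ?invr_ge0 ?ltW.
  - by rewrite ler_pdivlMl ?ltW.
have E : (c^-1 * A) `^ (q - 1) = c `^ (1 - q) * A `^ (q - 1).
  rewrite powRM ?invr_ge0 ?(ltW c0)//; congr (_ * _).
  by rewrite -powR_inv1 ?(ltW c0)// -powRrM; congr powR; ring.
rewrite Aq mulrCA -E.
apply: (@le_trans _ _ (A * (c^-1 * A) `^ (q - 1))); first by rewrite ler_wpM2l.
by rewrite lerDr mulr_ge0 ?powR_ge0// ltW.
Qed.

Definition disc2 : set (R * R) := [set z | 0 < defect z].

Lemma disc2_open : open disc2.
Proof.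
rewrite /disc2 openE => z /= zs; apply: (@defect_continuous R z [set t | 0 < t]).
by apply: open_nbhs_nbhs; split; [exact: open_gt|].
Qed.

Lemma disc2_measurable : measurable (disc2 : set (mT * mT)).
Proof. exact: open_measurable_plane disc2_open. Qed.

Lemma disc2_square : disc2 `<=` @square R.
Proof.
move=> z; rewrite /disc2 /= => zs; apply: contrapT.
have z2 : 0 < defect z / 2 by rewrite divr_gt0.
by move=> /(defect_square z2); lra.
Qed.

Lemma measurable_density (q : R) (f : R[i] -> R[i]) :
  (forall w, normc w < 1 -> {for w, continuous (f : R[i]^o -> R[i]^o)}) ->
  measurable_fun (disc2 : set (mT * mT)) (fun z => (defect z)^-1 * lam (defect z) `^ (- q) *
    (1 + (Re (f (pt z)) ^+ 2 + Im (f (pt z)) ^+ 2)) `^ q).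
Proof.
move=> cf; apply: measurable_fun_open_continuous; first exact: disc2_open.
move=> z; rewrite /disc2 /= => zs; have s1 := @defect_le1 R z.
have [ca cb] := pc_complex (cf (pt z) ltac:(by rewrite -defect_gt0)).
have cv := pcD (@pcK R _ z 1) (pcD (pcX (n:=2) ca) (pcX (n:=2) cb)).
have v0 : 0 < 1 + (Re (f (pt z)) ^+ 2 + Im (f (pt z)) ^+ 2) by rewrite ltr_pwDl// addr_ge0// sqr_ge0.
have cl : {for defect z, continuous (fun s : R => s^-1 * lam s `^ (- q))}.
  have := is_dM (is_d_inv_pow 1 zs) (is_d_lam_pow (- q) zs s1).
  by under eq_fun do rewrite expr1; exact: is_d_continuous.
exact: (pcM (pcc (@defect_continuous R z) cl) (pcc cv (@powR_continuous _ q _ v0))).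
Qed.

Variables (f F1 F2 : R[i] -> R[i]) (q : R).
Hypothesis df : forall w, normc w < 1 -> has_cderive f w (F1 w).
Hypothesis df1 : forall w, normc w < 1 -> has_cderive F1 w (F2 w).
Hypothesis cf2 : forall w, normc w < 1 -> {for w, continuous (F2 : R[i]^o -> R[i]^o)}.
Hypothesis q1 : 1 < q.

Let v z := 1 + (Re (f (pt z)) ^+ 2 + Im (f (pt z)) ^+ 2).

Let v0 z : 0 < v z.
Proof. exact: v_gt0. Qed.

Let cv z : disc2 z -> {for z, continuous v}.
Proof.
rewrite /disc2 /= defect_gt0 => zs.
have [ca cb] := pc_complex (has_cderive_continuous (df zs)).
exact: (pcD (@pcK R _ z 1) (pcD (pcX (n:=2) ca) (pcX (n:=2) cb))).
Qed.

Let cvq r z : disc2 z -> {for z, continuous (fun z => v z `^ r)}.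
Proof. by move=> /cv cz; exact: (pcc cz (@powR_continuous _ r _ (v0 z))). Qed.

(** Away from the circle [|f|] is bounded, by compactness. *)
Lemma defect_bounded (s0 : R) : 0 < s0 ->
  exists2 U : R, 0 < U & forall z, s0 <= defect z -> v z `^ q <= U.
Proof.
move=> s00; pose K := [set z | s0 <= @defect R z].
have KD : K `<=` disc2 by move=> z /= zs; exact: lt_le_trans s00 zs.
have cK : compact K.
  apply: (@subclosed_compact _ K (@square R)).
  - rewrite (_ : K = @defect R @^-1` [set t | s0 <= t])//.
    by apply: closed_comp; [move=> z _; exact: defect_continuous|exact: closed_ge].
  - by apply: compact_setX; exact: segment_compact.
  - by move=> z /KD /disc2_square.
have : compact ((fun z => v z `^ q) @` K).
  apply: continuous_compact cK; apply: continuous_in_subspaceT => z.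
  by rewrite inE => Kz; exact: cvq (KD _ Kz).
move=> /compact_bounded[U [_ HU]].
exists (`|U| + 1); first by rewrite ltr_wpDl.
move=> z Kz; apply: le_trans (ler_norm _) _.
apply: (HU (`|U| + 1)); last by exists z.
by rewrite (le_lt_trans (ler_norm _))// ltrDl.
Qed.

Let n1 z := normc (F1 (pt z)).

Let W tau z := wG q tau (defect z) * (4 * q * (q - 1) * v z `^ (q - 2) *
      ((Re (f (pt z)) ^+ 2 + Im (f (pt z)) ^+ 2) * (Re (F1 (pt z)) ^+ 2 + Im (F1 (pt z)) ^+ 2)) +
      4 * q * v z `^ (q - 1) * (Re (F1 (pt z)) ^+ 2 + Im (F1 (pt z)) ^+ 2)) -
    v z `^ q * (4 * ((1 - defect z) * wG2 q tau (defect z) - wG1 q tau (defect z))).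

Let energy z := defect z `^ (2 * q - 1) * n1 z `^ (2 * q).

(** The integrand [W tau] of Green's formula is [Phi Lap u - u Lap Phi].  The second term gives a
    multiple of [wphi * u] by [wG_laplacian]; in the first one
    [Lap u <= 4 q^2 v^(q-1) |f'|^2] and [Phi <= s^2 lam s * wphi], and Young's inequality trades it for
    a smaller multiple of [wphi * u] plus the energy density. *)
Lemma pointwise_estimate : exists c E C1 : R, [/\ 0 < c, 0 < E, 0 < C1 & forall tau z, 0 < tau -> disc2 z ->
  W tau z + c * (wphi q tau (defect z) * v z `^ q) <= E + C1 * energy z].
Proof.
(* The bounds [c <= 3] and [2 c <= q - 1] are those of [wG_laplacian]; that lemma yields
   [c / 2] before the factor four of the Laplacian, hence [2 c], of which Young's inequality uses [c]. *)
pose c := Num.min 3 ((q - 1) / 2).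
have c0 : 0 < c by rewrite lt_min /=; apply/andP; split => //; rewrite divr_gt0// subr_gt0.
have c3 : c <= 3 by rewrite ge_min lexx.
have cq : 2 * c <= q - 1.
  have : c <= (q - 1) / 2 by rewrite ge_min lexx orbT.
  lra.
pose M := 2 * (q + 2).
have M0 : 0 < M by rewrite mulr_gt0//; have := q1; lra.
pose r0 := (c / 2) / (c + M).
have r00 : 0 < r0 by rewrite !divr_gt0// addr_gt0.
have r0c : (c + M) * r0 <= c / 2 by rewrite /r0 mulrCA divff ?mulr1// gt_eqF// addr_gt0.
have [U U0 HU] := @defect_bounded (r0 ^+ 2) (exprn_gt0 _ r00).
pose E0 := (c / 2 + M) * (r0 ^+ 2)^-1 * U.
have E00 : 0 < E0.
  by rewrite !mulr_gt0// ?invr_gt0 ?exprn_gt0// addr_gt0// divr_gt0.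
pose C1 := c `^ (1 - q) * (4 * q ^+ 2) `^ q.
have q0 : 0 < q by exact: lt_trans ltr01 q1.
have C10 : 0 < C1 by rewrite mulr_gt0 ?powR_gt0// mulr_gt0// exprn_gt0.
exists c, (4 * E0), C1; split => //; first by rewrite mulr_gt0.
move=> tau z tau0 zD.
have s1 := @defect_le1 R z.
have en0 : 0 <= energy z by rewrite mulr_ge0 ?powR_ge0.
set s := defect z in zD s1 *.
rewrite /disc2 /= in zD; have s0 : 0 < s := zD.
have rhs0 : 0 <= 4 * E0 + C1 * energy z.
  by rewrite addr_ge0// mulr_ge0 ?(ltW E00) ?(ltW C10).
have [st|st] := ltP s tau.
  have [h0 h1 h2] := wG_0 q (ltW st).
  rewrite /W -/s h0 h1 h2 !(mul0r, mulr0, subr0, add0r) /wphi pos_eq0; last by lra.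
  by rewrite !(mul0r, mulr0, oppr0, addr0).
have [lapA lapB] := wG_laplacian q1 tau0 st s1 c0 c3 cq (erefl M) r00 r0c.
set A := (1 - s) * _ - _ in lapA lapB.
set phi := wphi q tau s in lapA lapB *.
have phi0 : 0 <= phi by exact: wphi_ge0.
set u := v z `^ q.
have u0 : 0 <= u by exact: powR_ge0.
have uA : c / 2 * phi * u - E0 <= A * u.
  have [sr|sr] := leP s (r0 ^+ 2).
    have : c / 2 * phi * u <= A * u by rewrite ler_wpM2r// lapA.
    by move: (ltW E00); lra.
  have uU : u <= U by apply: HU; exact: ltW.
  have h : (c / 2 * phi - (c / 2 + M) * s^-1) * u <= A * u by rewrite ler_wpM2r.
  have h' : (c / 2 + M) * s^-1 * u <= E0.
    rewrite /E0; apply: ler_pM => //.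
    - by rewrite mulr_ge0 ?invr_ge0 ?(ltW s0)// addr_ge0 ?(ltW M0)// divr_ge0 ?(ltW c0).
    - rewrite ler_pM2l ?addr_gt0 ?divr_gt0//.
      by rewrite lef_pV2 ?posrE ?exprn_gt0// ltW.
  by lra.
pose b := n1 z ^+ 2; have b0 : 0 <= b by exact: sqr_ge0.
have bE : Re (F1 (pt z)) ^+ 2 + Im (F1 (pt z)) ^+ 2 = b by rewrite /b /n1 sqr_normcE.
set g := Re (f (pt z)) ^+ 2 + Im (f (pt z)) ^+ 2.
have g0 : 0 <= g by rewrite addr_ge0// sqr_ge0.
have gv : g <= v z by rewrite /v -/g lerDr.
have vq1 : v z `^ (q - 1) = v z `^ (q - 2) * v z.
  rewrite -[X in _ * X](powRr1 (ltW (v0 z))) -powRD ?(gt_eqF (v0 z)) ?implybT//.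
  by congr powR; ring.
have G0 := wG_ge0 q tau s.
have l0 := lam_gt0 s1.
have lapu : wG q tau s * (4 * q * (q - 1) * v z `^ (q - 2) * (g * b) + 4 * q * v z `^ (q - 1) * b)
    <= phi * ((4 * q ^+ 2 * (s ^+ 2 * lam s * b)) * v z `^ (q - 1)).
  apply: (@le_trans _ _ (wG q tau s * (4 * q ^+ 2 * b * v z `^ (q - 1)))).
    apply: ler_wpM2l => //.
    have h : 4 * q * (q - 1) * b * v z `^ (q - 2) * g <= 4 * q * (q - 1) * b * v z `^ (q - 2) * v z.
      by rewrite ler_wpM2l// !mulr_ge0 ?powR_ge0 ?(ltW q0) ?normcr_ge0// subr_ge0 ltW.
    by rewrite vq1; lra.
  have h := wG_le q tau0 s0 s1.
  have X0 : 0 <= 4 * q ^+ 2 * b * v z `^ (q - 1) by rewrite !mulr_ge0 ?sqr_ge0 ?powR_ge0 ?normcr_ge0 ?(ltW q0).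
  have := ler_wpM2r X0 h; rewrite -/phi; lra.
have A'0 : 0 <= 4 * q ^+ 2 * (s ^+ 2 * lam s * b).
  by rewrite !mulr_ge0 ?sqr_ge0 ?(ltW l0) ?normcr_ge0 ?(ltW s0) ?(ltW q0).
have yg := young_powR q1 A'0 (v0 z) c0.
have pA : phi * (s ^+ 2 * lam s * b) `^ q <= energy z.
  apply: (@le_trans _ _ (s^-1 * lam s `^ (- q) * (s ^+ 2 * lam s * b) `^ q)).
    by rewrite ler_wpM2r ?powR_ge0//; exact: wphi_le.
  have -> : (s ^+ 2 * lam s * b) `^ q = s `^ (2 * q) * lam s `^ q * n1 z `^ (2 * q).
    rewrite (@powRM _ (s ^+ 2 * lam s) b)// ?mulr_ge0 ?(ltW l0) ?(ltW s0)//.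
    rewrite (@powRM _ (s ^+ 2) (lam s)) ?sqr_ge0 ?(ltW l0)//; congr (_ * _ * _).
      by rewrite -powR_mulrn ?(ltW s0)// -powRrM.
    by rewrite /b -powR_mulrn ?normcr_ge0// -powRrM.
  have ll : lam s `^ (- q) * lam s `^ q = 1.
    by rewrite -powRD ?(gt_eqF l0) ?implybT// addNr powRr0.
  have ss : s^-1 * s `^ (2 * q) = s `^ (2 * q - 1).
    rewrite -(powR_inv1 (ltW s0)) -powRD ?(gt_eqF s0) ?implybT//.
    by congr powR; ring.
  rewrite le_eqVlt; apply/orP; left; apply/eqP.
  rewrite /energy -/s -ss.
  by rewrite -[RHS]mulr1 -ll; ring.
have lapu2 : wG q tau s * (4 * q * (q - 1) * v z `^ (q - 2) * (g * b) + 4 * q * v z `^ (q - 1) * b)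
    <= c * phi * u + C1 * energy z.
  apply: le_trans lapu _; apply: le_trans (ler_wpM2l phi0 yg) _.
  rewrite -/u mulrDr; apply: lerD; first by rewrite le_eqVlt; apply/orP; left; apply/eqP; ring.
  rewrite (@powRM _ (4 * q ^+ 2) (s ^+ 2 * lam s * b)); last 2 first.
  - by rewrite mulr_ge0// sqr_ge0.
  - by rewrite !mulr_ge0 ?(ltW l0) ?(ltW s0) ?normcr_ge0.
  have := ler_wpM2l (ltW C10) pA; rewrite /C1; lra.
rewrite /W -/s bE -/g -/u -/A; lra.
Qed.

Let density z := (defect z)^-1 * lam (defect z) `^ (- q) * v z `^ q.

Let menergy : measurable_fun (disc2 : set (mT * mT)) energy.
Proof.
apply: measurable_funM.
  apply: (measurableT_comp (measurable_powR (2 * q - 1))).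
  by apply: measurable_fun_open_continuous; [exact: disc2_open|move=> z _; exact: defect_continuous].
apply: (measurableT_comp (measurable_powR (2 * q))).
apply: measurable_fun_open_continuous; first exact: disc2_open.
move=> z; rewrite /disc2 /= defect_gt0 => zs.
exact: (normc_pt_continuous (has_cderive_continuous (df1 zs))).
Qed.

Let energy_ge0 z : 0 <= energy z.
Proof. by rewrite mulr_ge0 ?powR_ge0. Qed.

Let phiu tau z := wphi q tau (defect z) * v z `^ q.

Let phiu_cont tau z : 0 < tau -> {for z, continuous (phiu tau)}.
Proof.
move=> tau0; have [zs|zs] := ltP (defect z) tau.
  apply: (@pc_near _ _ _ (fun=> 0)); last exact: pcK.
  have := defect_lt_near zs; apply: filterS => w ws.
  by rewrite /phiu /wphi pos_eq0 ?mul0r// subr_le0 ltW.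
have s0 : 0 < defect z by exact: lt_le_trans zs.
have s1 := @defect_le1 R z.
have cl : {for defect z, continuous (fun s : R => pos (s - tau) * (s ^+ 2)^-1 * lam s `^ (- q))}.
  have cp := pcc (is_d_continuous (is_dB (is_dI (defect z)) (is_dC tau (defect z)))) (@pos_continuous R _).
  exact: (pcM (pcM cp (is_d_continuous (is_d_inv_pow 2 s0))) (is_d_continuous (is_d_lam_pow (- q) s0 s1))).
exact: (pcM (pcc (@defect_continuous R z) cl) (cvq s0)).
Qed.

Let phiu_0 tau z : 0 < tau -> ~ disc2 z -> phiu tau z = 0.
Proof.
move=> tau0 /negP; rewrite -leNgt => zs.
by rewrite /phiu /wphi pos_eq0 ?mul0r//; lra.
Qed.

(** Integrating [pointwise_estimate], Green's formula removes [W tau], so the integrals of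
    [wphi q tau (defect z) * v z `^ q] are bounded uniformly in [tau].  On the set
    [2 tau < defect z] the integrand is at least half of the density, and these sets exhaust the
    disc. *)
Lemma weighted_finite :
  (\int[mu2]_(z in disc2) (energy z)%:E < +oo)%E ->
  (\int[mu2]_(z in disc2) (density z)%:E < +oo)%E.
Proof.
move=> fin.
have [c [E [C1 [c0 E0 C10 est]]]] := pointwise_estimate.
have mD := disc2_measurable.
have ien : mu2.-integrable disc2 (EFin \o energy).
  apply/integrableP; split; first exact/measurable_EFinP.
  rewrite (_ : (fun x => `|_|%E) = EFin \o energy)//.
  by apply/funext => z /=; rewrite ger0_norm.
have icst : mu2.-integrable disc2 (fun=> E%:E).
  apply: (@integrableS _ _ _ mu2 (@square R : set (mT * mT)) disc2) => //.
  - exact: square_measurable.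
  - exact: disc2_square.
  - apply/integrableP; split; first exact: measurable_cst.
    rewrite integral_cst; last exact: square_measurable.
    rewrite lte_mul_pinfty ?abse_ge0//; exact: square_finite.
pose I := (\int[mu2]_(z in disc2) (E%:E + C1%:E * (energy z)%:E))%E.
have iR : mu2.-integrable disc2 (fun z => (E%:E + C1%:E * (energy z)%:E)%E).
  by apply: integrableD => //; exact: integrableZl.
have Ifin : (I < +oo)%E by have /integrable_fin_num := iR; rewrite fin_numE => /(_ mD) /andP[_]; rewrite lt_neqAle leey andbT.
have key tau : 0 < tau -> (\int[mu2]_(z in disc2) (phiu tau z)%:E <= c^-1%:E * I)%E.
  move=> tau0.
  have [cW W0 intW] := green_identity df df1 cf2 tau0 (@is_d_wG R q tau tau0) (@is_d_wG1 R q tau tau0)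
    (@wG2_continuous R q tau tau0) (@wG_0 R q tau) (fun z => erefl (W tau z)).
  have iW := integrable_continuous_square cW W0.
  have iu : mu2.-integrable [set: mT * mT] (EFin \o phiu tau).
    apply: integrable_continuous_square; first by move=> z; exact: phiu_cont.
    by move=> z sz; apply: phiu_0 => // /disc2_square.
  have WD0 z : ~ disc2 z -> W tau z = 0.
    move=> /negP; rewrite -leNgt => zs.
    have [h0 h1 h2] := @wG_0 R q tau (defect z) (le_trans zs (ltW tau0)).
    by rewrite /W h0 h1 h2 !(mul0r, mulr0, subrr).
  have red h : (forall z, ~ disc2 z -> h z = 0%R) ->
      (\int[mu2]_z (h z)%:E = \int[mu2]_(z in disc2) (h z)%:E)%E.
    move=> h0; rewrite [RHS]integral_mkcond; apply: eq_integral => z _.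
    by rewrite patchE; case: ifPn => // /negP zs; rewrite h0// => ?; apply: zs; rewrite inE.
  rewrite lee_pdivlMl// -integralZl//; last first.
    by apply: (integrableS _ _ _ iu).
  have iWD : mu2.-integrable disc2 (EFin \o W tau) by apply: (integrableS _ _ _ iW).
  have iuD : mu2.-integrable disc2 (EFin \o phiu tau) by apply: (integrableS _ _ _ iu).
  have W0D : (\int[mu2]_(z in disc2) (W tau z)%:E = 0)%E by rewrite -(red _ WD0).
  apply: (@le_trans _ _ (\int[mu2]_(z in disc2) (W tau z)%:E +
      \int[mu2]_(z in disc2) (c%:E * (phiu tau z)%:E))%E); first by rewrite W0D add0e.
  rewrite -(integralD mD iWD (integrableZl mD c iuD)).
  apply: le_integral => //.
    by apply: integrableD => //; exact: integrableZl.
  move=> z /[!inE] zD.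
  rewrite /= -!EFinM -!EFinD lee_fin.
  exact: est.
pose Fn n : set (R * R) := [set z | n.+1%:R^-1 < defect z].
have FnD n : Fn n `<=` disc2 by move=> z; apply: lt_trans; rewrite invr_gt0.
have mF n : measurable (Fn n : set (mT * mT)).
  apply: open_measurable_plane; rewrite openE => z /= zs.
  apply: (@defect_continuous R z [set t | n.+1%:R^-1 < t]).
  by apply: open_nbhs_nbhs; split; [exact: open_gt|].
have mdens : measurable_fun (disc2 : set (mT * mT)) (EFin \o density).
  apply/measurable_EFinP.
  by apply: measurable_density => w w1; exact: (has_cderive_continuous (df w1)).
have dens0 z : disc2 z -> (0 <= (density z)%:E)%E.
  by move=> zs; rewrite lee_fin !mulr_ge0 ?powR_ge0// invr_ge0 ltW.
have cup : disc2 = \bigcup_n Fn n.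
  apply/seteqP; split => [z zs|z [n _]]; last exact: FnD.
  have [n nz] : exists n, n.+1%:R^-1 < defect z.
    by have [n _ /(_ n (leqnn _)) H] := near_infty_natSinv_lt (PosNum zs); exists n.
  by exists n.
have cv' := @ge0_nondecreasing_set_cvg_integral _ (mT * mT)%type R Fn (EFin \o density) mu2.
have {}cv' : (\int[mu2]_(z in Fn n) (density z)%:E)%E @[n --> \oo] -->
    (\int[mu2]_(z in \bigcup_n Fn n) (density z)%:E)%E.
  apply: cv' => //.
  - move=> n m nm; apply/subsetPset => z; apply: le_lt_trans.
    by rewrite lef_pV2 ?posrE// ler_nat.
  - by move=> n; exact: (measurable_funS mD (@FnD n)).
  - by move=> n z /FnD /dens0.
rewrite cup -(cvg_lim _ cv')//; apply: (@le_lt_trans _ _ (2%:E * (c^-1%:E * I))%E); last first.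
  by rewrite lte_mul_pinfty ?lee_fin// lte_mul_pinfty ?lee_fin ?invr_ge0 ?ltW.
apply: lime_le; first by apply/cvg_ex; exists (\int[mu2]_(z in \bigcup_n Fn n) (density z)%:E)%E.
near=> n.
pose tau : R := n.+1%:R^-1 / 2.
have tau0 : 0 < tau by rewrite divr_gt0// invr_gt0.
apply: (@le_trans _ _ (2%:E * \int[mu2]_(z in disc2) (phiu tau z)%:E)%E); last first.
  by rewrite lee_pmul2l//; exact: key.
have mphi : measurable_fun (disc2 : set (mT * mT)) (EFin \o phiu tau).
  apply/measurable_EFinP.
  by apply: measurable_fun_open_continuous; [exact: disc2_open|move=> z _; exact: phiu_cont].
have phi0 z : (0 <= (phiu tau z)%:E)%E by rewrite lee_fin mulr_ge0 ?powR_ge0// wphi_ge0.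
rewrite -ge0_integralZl//.
apply: (@le_trans _ _ (\int[mu2]_(z in Fn n) (2%:E * (phiu tau z)%:E))%E).
  apply: ge0_le_integral => //.
  - by move=> z /FnD /dens0.
  - exact: (measurable_funS mD (@FnD n)).
  - by apply: measurable_funeM; exact: (measurable_funS mD (@FnD n)).
  - move=> z zF; rewrite -EFinM lee_fin /density /phiu mulrA ler_wpM2r ?powR_ge0//.
    apply: wphi_ge => //; rewrite /tau mulrC divfK//; exact: ltW.
apply: ge0_subset_integral => //.
- by apply: measurable_funeM.
- by move=> z _; rewrite mule_ge0.
Unshelve. all: end_near. Qed.

End weighted_estimate.

(** * Functions with controlled second differences *)

Section zygmund.
Variable R : realType.
Implicit Types (x t a b : R).

(** The power [3/2]: it lies between [1], the growth of the modulus of smoothness, and [2], the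
    largest power that the kernel [(delta + t)^-3] can integrate. *)
Definition pow32 x : R := x * Num.sqrt x.

Lemma pow32_ge0 x : 0 <= x -> 0 <= pow32 x.
Proof. by move=> x0; rewrite mulr_ge0 ?sqrtr_ge0. Qed.

Lemma pow32_ge1 x : 1 <= x -> 1 <= pow32 x.
Proof. by move=> x1; rewrite mulr_ege1// -[1]sqrtr1 ler_sqrt//; exact: le_trans x1. Qed.

(** [14/5 < 2^(3/2)]; a constant above [2] is what makes the doubling in [zygmund_right] converge. *)
Lemma pow32_half x : 0 <= x -> 14 / 5 * pow32 (x / 2) <= pow32 x.
Proof.
move=> x0; rewrite /pow32 sqrtrM//.
have s2 : Num.sqrt 2^-1 <= 5 / 7 :> R.
  rewrite -[leRHS]ger0_norm ?divr_ge0// -sqrtr_sqr ler_sqrt ?sqr_ge0//.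
  by rewrite expr2; lra.
have : x * Num.sqrt x * Num.sqrt 2^-1 <= x * Num.sqrt x * (5 / 7).
  by rewrite ler_wpM2l// mulr_ge0 ?sqrtr_ge0.
lra.
Qed.

Variables (D w : R -> R) (P delta w0 : R).
Hypothesis delta0 : 0 < delta.
Hypothesis deltaP : delta <= P.
Hypothesis D0 : D 0 = 0.
Hypothesis Dd : D delta = 0.
Hypothesis Dbd : exists B, forall x, 0 <= x <= delta -> `|D x| <= B.
Hypothesis D2 : forall a b, - P <= a -> a < b -> b <= P ->
  `|D a + D b - 2 * D ((a + b) / 2)| <= w ((b - a) / 2).
Hypothesis w_small : forall t, 0 < t -> t <= delta -> w t <= w0.
Hypothesis w_large : forall t, delta <= t -> t <= P -> w t <= w0 * pow32 (t / delta).

Let w00 : 0 <= w0.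
Proof.
have P0 : 0 < P by exact: lt_le_trans deltaP.
have NP : - P < P by lra.
have h := D2 (lexx (- P)) NP (lexx P).
have {h} := le_trans (normr_ge0 _) h.
rewrite opprK (_ : (P + P) / 2 = P); last by field.
move=> /le_trans/(_ (w_large deltaP (lexx P))).
by rewrite pmulr_lge0// (lt_le_trans ltr01)// pow32_ge1// ler_pdivlMr// mul1r.
Qed.

(** Let [Sigma] be the supremum of [|D|] on [[0, delta]].  For [y <= delta / 2] the second difference at
    [0, y, 2 y] gives [2 |D y| <= |D (2 y)| + w0 <= Sigma + w0], and symmetrically from [delta] for
    [y >= delta / 2]; hence [Sigma <= (Sigma + w0) / 2]. *)
Lemma zygmund_near x : 0 <= x <= delta -> `|D x| <= w0.
Proof.
move=> xd; have [B HB] := Dbd.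
pose S := [set `|D x| | x in [set x | 0 <= x <= delta]].
have S0 : S !=set0 by exists (`|D 0|), 0 => //=; rewrite lexx ltW.
have Sb : has_sup S by split => //; exists B => _ [y yd <-]; exact: HB.
have inS y : 0 <= y <= delta -> `|D y| <= sup S.
  by move=> yd; apply: ub_le_sup; [exact: Sb.2|exists y].
have M0 : 0 <= sup S by apply: le_trans (inS 0 _) => //; rewrite lexx ltW.
have half : sup S <= (sup S + w0) / 2.
  apply: ge_sup => // _ [y /andP[y0 yd] <-].
  have [->|yn0] := eqVneq y 0; first by rewrite D0 normr0; have := w00; lra.
  have [->|ynd] := eqVneq y delta; first by rewrite Dd normr0; have := w00; lra.
  have yp : 0 < y by rewrite lt_def yn0.
  have ylt : y < delta by rewrite lt_def eq_sym ynd.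
  have dP := deltaP; have d0 := delta0.
  have [y2|y2] := leP y (delta / 2).
    have := @D2 0 (2 * y) ltac:(lra) ltac:(lra) ltac:(lra).
    rewrite D0 !add0r subr0 mulrC mulfK// mulrC => h.
    have := le_trans h (w_small yp yd).
    have := inS (2 * y) ltac:(apply/andP; split; lra).
    have := ler_distD (D (2 * y)) 0 (2 * D y); rewrite !sub0r !normrN normrM ger0_norm//; lra.
  have := @D2 (2 * y - delta) delta ltac:(lra) ltac:(lra) ltac:(lra).
  rewrite Dd addr0 subrK [2 * y / 2]mulrC mulKf// => h.
  have ww := @w_small ((delta - (2 * y - delta)) / 2) ltac:(lra) ltac:(lra).
  have := le_trans h ww.
  have := inS (2 * y - delta) ltac:(apply/andP; split; lra).
  have := ler_distD (D (2 * y - delta)) 0 (2 * D y); rewrite !sub0r !normrN normrM ger0_norm//; lra.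
have := inS x xd; lra.
Qed.

Let wle t : 0 < t -> t <= P -> w t <= w0 * (1 + pow32 (t / delta)).
Proof.
move=> t0 tP; have h0 : 0 <= pow32 (t / delta) by apply: pow32_ge0; rewrite divr_ge0 ?ltW.
have [td|td] := leP t delta.
  by apply: le_trans (w_small t0 td) _; rewrite ler_peMr// lerDl.
by apply: le_trans (w_large (ltW td) tP) _; rewrite ler_wpM2l// lerDr.
Qed.

(** By doubling: the second difference at [0, x / 2, x] bounds [|D x|] by [2 |D (x / 2)| + w (x / 2)]. *)
Lemma zygmund_right x : 0 <= x -> x <= P -> `|D x| <= w0 * (1 + 9 * pow32 (x / delta)).
Proof.
move=> x0 xP.
have [n xn] : exists n, x <= 2 ^+ n * delta.
  have [n xn] : exists n : nat, x / delta <= n%:R.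
    exists (Num.truncn (x / delta)).+1; apply/ltW/truncnS_gt.
  exists n; rewrite -ler_pdivrMr// (le_trans xn)// -natrX ler_nat.
  exact/ltnW/ltn_expl.
elim: n x x0 xP xn => [|n ih] x x0 xP xn.
  rewrite expr0 mul1r in xn.
  apply: le_trans (zygmund_near _) _; first by rewrite x0.
  by rewrite ler_peMr// lerDl mulr_ge0// pow32_ge0// divr_ge0// ltW.
have [xd|xd] := leP x delta.
  apply: le_trans (zygmund_near _) _; first by rewrite x0.
  by rewrite ler_peMr// lerDl mulr_ge0// pow32_ge0// divr_ge0// ltW.
have xp : 0 < x by exact: lt_trans xd.
have P0 : 0 < P := lt_le_trans xp xP.
have := @D2 0 x ltac:(lra) xp xP; rewrite D0 !add0r subr0 => h.
have h2 := ih (x / 2) ltac:(lra) ltac:(lra) ltac:(by rewrite ler_pdivrMr// mulrAC -exprSr).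
have h3 := @wle (x / 2) ltac:(lra) ltac:(lra).
have hx : pow32 (x / 2 / delta) * (14 / 5) <= pow32 (x / delta).
  rewrite (_ : x / 2 / delta = x / delta / 2); last by rewrite mulrAC.
  by rewrite [leLHS]mulrC pow32_half// divr_ge0// ltW.
have h1 : 1 <= pow32 (x / delta) by rewrite pow32_ge1// ler_pdivlMr// mul1r ltW.
have := ler_distD (2 * D (x / 2)) (D x) 0; rewrite !subr0 normrM ger0_norm// => h4.
have h5 : `|D x| <= 2 * (w0 * (1 + 9 * pow32 (x / 2 / delta))) + w0 * (1 + pow32 (x / 2 / delta)).
  by apply: le_trans h4 _; lra.
apply: le_trans h5 _; set p := pow32 (x / 2 / delta) in hx *; set r := pow32 _ in hx h1 *.
have -> : 2 * (w0 * (1 + 9 * p)) + w0 * (1 + p) = w0 * (3 + 19 * p) by ring.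
(* With [14 p / 5 <= r] and [1 <= r], [3 + 19 p <= 1 + 2 r + 7 r], which is why [9] is a
   possible constant. *)
by rewrite ler_wpM2l//; lra.
Qed.

(** The negative side follows from the second difference at [x, 0, - x]. *)
Lemma zygmund_bound x : `|x| <= P -> `|D x| <= w0 * (2 + 10 * pow32 (`|x| / delta)).
Proof.
move=> xP; have h0 : 0 <= pow32 (`|x| / delta) by apply: pow32_ge0; rewrite divr_ge0// ltW.
have [x0|x0] := leP 0 x.
  rewrite (ger0_norm x0) in xP h0 *.
  by apply: le_trans (zygmund_right x0 xP) _; rewrite ler_wpM2l//; lra.
rewrite (ltr0_norm x0) in xP h0 *.
have nx0 : 0 < - x by rewrite oppr_gt0.
have h := zygmund_right (ltW nx0) xP.
have := @D2 x (- x) ltac:(lra) ltac:(lra) xP.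
rewrite subrr mul0r D0 mulr0 subr0 (_ : (- x - x) / 2 = - x); last by field.
move=> /le_trans/(_ (wle nx0 xP)) h2.
have := ler_normD (D x + D (- x)) (- D (- x)); rewrite addrK normrN => h3.
apply: le_trans h3 _.
have -> : w0 * (2 + 10 * pow32 (- x / delta)) = w0 * (1 + pow32 (- x / delta)) + w0 * (1 + 9 * pow32 (- x / delta)) by ring.
exact: lerD.
Qed.

End zygmund.

Section majorant.
Variable R : realType.
Implicit Types (t s : R).

Lemma lam_decr s t : 0 < s -> s <= t -> lam t <= lam s.
Proof.
by move=> s0 st; rewrite lerD2l lerN2 ler_ln ?posrE//; exact: lt_le_trans st.
Qed.

Lemma mul_lam_le1 s : 0 < s -> s * lam s <= 1.
Proof.
move=> s0; have := @ln_le_sub1 R s^-1 ltac:(by rewrite invr_gt0); rewrite lnV ?posrE// => H.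
have : s * lam s <= s * s^-1 by rewrite ler_pM2l// /lam; lra.
by rewrite divff// gt_eqF.
Qed.

(** [lam d = lam t + ln (t / d) <= lam t * (t / d)], so dividing by [sqrt (lam t)] instead of
    [sqrt (lam d)] costs at most [sqrt (t / d)]. *)
Lemma modulus_growth d t : 0 < d -> d <= t -> t <= 1 ->
  t / Num.sqrt (lam t) <= d / Num.sqrt (lam d) * pow32 (t / d).
Proof.
move=> d0 dt t1; have t0 := lt_le_trans d0 dt.
have lt0 := lam_gt0 t1; have ld0 := lam_gt0 (le_trans dt t1).
have lt1 := lam_ge1 t1.
have x0 : 0 < t / d by rewrite divr_gt0.
have lE : lam d = lam t + ln (t / d).
  by rewrite /lam ln_div ?posrE//; ring.
have le1 : lam d <= lam t * (t / d).
  have := @ln_le_sub1 R (t / d) x0 => h.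
  have h1 : 0 <= t / d - 1 by rewrite subr_ge0 ler_pdivlMr// mul1r.
  have : t / d - 1 <= lam t * (t / d - 1) by rewrite ler_peMl.
  rewrite lE; lra.
have h : Num.sqrt (lam d) <= Num.sqrt (lam t) * Num.sqrt (t / d).
  by rewrite -sqrtrM ?(ltW lt0)// ler_sqrt// mulr_ge0 ?ltW.
have sd : 0 < Num.sqrt (lam d) by rewrite sqrtr_gt0.
have sT : 0 < Num.sqrt (lam t) by rewrite sqrtr_gt0.
rewrite ler_pdivrMr// /pow32.
have -> : d / Num.sqrt (lam d) * (t / d * Num.sqrt (t / d)) * Num.sqrt (lam t) =
  t * (Num.sqrt (lam t) * Num.sqrt (t / d)) / Num.sqrt (lam d).
  by field; rewrite !gt_eqF.
by rewrite ler_pdivlMr// ler_pM2l.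
Qed.

Lemma modulus_growth1 d t : 0 < d -> d <= 1 -> 1 <= t ->
  1 <= d / Num.sqrt (lam d) * pow32 (t / d).
Proof.
move=> d0 d1 t1; have t0 := lt_le_trans ltr01 t1.
have ld0 := lam_gt0 d1.
have sd : 0 < Num.sqrt (lam d) by rewrite sqrtr_gt0.
have x0 : 0 < t / d by rewrite divr_gt0.
have -> : d / Num.sqrt (lam d) * pow32 (t / d) = t * Num.sqrt (t / d) / Num.sqrt (lam d).
  by rewrite /pow32; field; rewrite !gt_eqF.
rewrite ler_pdivlMr// mul1r -[leLHS]mul1r ler_pM ?sqrtr_ge0//.
rewrite ler_sqrt ?(ltW x0)//.
apply: (@le_trans _ _ d^-1); last by rewrite ler_pMl ?invr_gt0.
by rewrite -[leRHS]mul1r ler_pdivlMr// mulrC mul_lam_le1.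
Qed.

End majorant.

(** * Arcs of the circle *)

Section circle_arcs.
Variable R : realType.
Local Notation Re := (@complex.Re R).
Local Notation Im := (@complex.Im R).
Local Notation T := (circle R).
Implicit Types (a b m s t x : R).

Lemma circle_eq (u v : T) : circle_val u = circle_val v -> u = v.
Proof.
case: u => z hz; case: v => w hw /= zw; subst w.
by congr exist; exact: bool_irrelevance.
Qed.

Lemma cis_val t : circle_val (cis t) = cos t +i* sin t.
Proof. by []. Qed.

Lemma cis_eq s t : cos s = cos t -> sin s = sin t -> cis s = cis t :> T.
Proof. by move=> c d; apply: circle_eq; rewrite !cis_val c d. Qed.

Lemma cisD2pin t n : cis (t + n%:R * (2 * pi)) = cis t :> T.
Proof.
elim: n => [|n ih]; first by rewrite mul0r addr0.
rewrite -ih -natr1 mulrDl mul1r addrA [X in cis (_ + X) = _]mulr_natl.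
by apply: cis_eq; rewrite ?cosD2pi ?sinD2pi.
Qed.

Lemma cisD2piz t (k : int) : cis (t + k%:~R * (2 * pi)) = cis t :> T.
Proof.
case: k => n; first exact: cisD2pin.
rewrite NegzE mulrNz mulNr -[in RHS](subrK (n.+1%:R * (2 * pi)) t).
by rewrite cisD2pin.
Qed.

Lemma cos_lt1 x : 0 < x -> x < 2 * pi -> cos x < 1.
Proof.
move=> x0 x2; have -> : x = x / 2 + x / 2 by field.
rewrite cosD -!expr2.
have s0 : 0 < sin (x / 2) by apply: sin_gt0_pi; apply/andP; split; lra.
have := cos2Dsin2 (x / 2); have : 0 < sin (x / 2) ^+ 2 by rewrite exprn_gt0.
lra.
Qed.

Lemma cis_inj s t : `|s - t| < 2 * pi -> cis s = cis t :> T -> s = t.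
Proof.
move=> st /(congr1 (@circle_val R)); rewrite !cis_val => -[c d].
apply/eqP; rewrite -subr_eq0 -normr_eq0; apply/negPn/negP => nz.
have p : 0 < `|s - t| by rewrite lt_def nz normr_ge0.
have := cos_lt1 p st; apply/negP; rewrite -leNgt.
have -> : cos `|s - t| = cos (s - t).
  by case: (leP 0 (s - t)) => h; [rewrite ger0_norm|rewrite ltr0_norm// cosN].
by rewrite cosB c d -!expr2 cos2Dsin2.
Qed.

Lemma cis_surj a (u : T) : exists t, [/\ a <= t, t < a + 2 * pi & cis t = u].
Proof.
have [t tu] : exists t, cis t = u.
  have : normc (circle_val u) == 1 by case: (u).
  case E : (circle_val u) => [c d] => /eqP n1.
  have := sqr_normcE (c +i* d); rewrite n1 expr1n /= => cd.
  have c1 : -1 <= c <= 1 by apply/andP; split; have := sqr_ge0 d; nra.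
  have [/andP[t0 tp] ct] := acos_def c1.
  have s0 : 0 <= sin (acos c) by apply: sin_ge0_pi; rewrite t0.
  have s2 : sin (acos c) ^+ 2 = d ^+ 2 by have := cos2Dsin2 (acos c); rewrite ct; lra.
  have sd : sin (acos c) = `|d|.
    by apply/eqP; rewrite -(@eqrXn2 _ 2)// real_normK ?num_real// s2.
  have [d0|d0] := leP 0 d.
    by exists (acos c); apply: circle_eq; rewrite cis_val ct sd ger0_norm// E.
  exists (- acos c); apply: circle_eq.
  by rewrite cis_val cosN sinN ct sd ltr0_norm// opprK E.
have pi20 : 0 < 2 * pi :> R by rewrite mulr_gt0 ?pi_gt0.
pose k := Num.floor ((t - a) / (2 * pi)).
exists (t + (- k)%:~R * (2 * pi)); split; last by rewrite cisD2piz.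
- rewrite mulrNz mulNr lerBrDr -lerBrDl -ler_pdivlMr//.
  exact: floor_le_tmp.
- rewrite mulrNz mulNr ltrBlDr -ltrBlDl.
  have := floorD1_gt ((t - a) / (2 * pi)).
  rewrite ltr_pdivrMr// intrD mulrDl mul1r -/k; lra.
Qed.

(** Half-open arcs are additive without boundary terms. *)
Definition harc a b : set T := @cis R @` `[a, b[.

Lemma measurable_circle_open (U : set R[i]^o) : open U -> measurable ((@circle_val R) @^-1` U : set T).
Proof. by move=> oU; apply: sub_sigma_algebra; exists U. Qed.

(** The real and imaginary parts of [g] are continuous on [U], so their preimages of open sets are
    traces on the circle of open subsets of [U]. *)
Lemma measurable_circle_continuous (U : set R[i]^o) (g : R[i] -> R[i]) : open U ->
  (forall u : T, U (circle_val u)) -> (forall w, U w -> {for w, continuous (g : R[i]^o -> R[i]^o)}) ->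
  measurable_fun setT (fun u : T => Re (g (circle_val u))) /\
  measurable_fun setT (fun u : T => Im (g (circle_val u))).
Proof.
move=> oU TU cg.
have H (p : R[i] -> R) : (forall w h, `|p (w + h) - p w| <= normc h) ->
    measurable_fun setT (fun u : T => p (g (circle_val u))).
  move=> pl mT; apply: (measurability _ (RGenOInfty.measurableE R)) => //.
  move=> _ [_ [a ->] <-]; rewrite setTI.
  pose V : set R[i]^o := [set w | U w /\ a < p (g w)].
  have -> : (fun u : T => p (g (circle_val u))) @^-1` `]a, +oo[%classic = (@circle_val R) @^-1` V.
    apply/seteqP; split => u /=; first by rewrite in_itv /= andbT.
    by case=> _; rewrite in_itv /= andbT.
  apply: measurable_circle_open; rewrite openE => w [Uw aw].
  have e0 : 0 < (p (g w) - a) / 2 by rewrite divr_gt0// subr_gt0.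
  have /continuousCP/(_ _ e0)[d d0 Hd] := cg _ Uw.
  have nU : nbhs (w : R[i]^o) U by apply: open_nbhs_nbhs.
  apply: filterS2 _ nU (_ : nbhs (w : R[i]^o) [set y | normc (y - w) < d]).
    move=> y Uy /Hd; rewrite (_ : w + (y - w) = y); last by rewrite addrC subrK.
    move=> h; split => //.
    have := pl (g w) (g y - g w); rewrite (_ : g w + (g y - g w) = g y); last by rewrite addrC subrK.
    move=> /le_trans/(_ h); rewrite ler_norml => /andP[h1 h2]; lra.
  apply/nbhs_ballP; exists d%:C => /=; first by rewrite ltcR.
  by move=> y; rewrite /ball /= normc_norm ltcR normcBC.
split; apply: H => w h.
- by rewrite cReD addrAC subrr add0r normRe_le.
- by rewrite cImD addrAC subrr add0r normIm_le.
Qed.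

Lemma measurable_cis1 a : measurable [set cis a : T].
Proof.
rewrite -[X in measurable X]setCK; apply: measurableC.
rewrite (_ : ~` [set cis a] = (@circle_val R) @^-1` (~` [set (cos a +i* sin a : R[i]^o)])).
  apply: measurable_circle_open; apply: closed_openC.
  apply: (@accessible_closed_set1 R[i]^o); apply: hausdorff_accessible.
  exact: (@norm_hausdorff R[i] R[i]^o).
apply/seteqP; split => u /= h; first by move=> e; apply: h; exact: circle_eq.
by move=> e; apply: h; rewrite e.
Qed.

(** With midpoint [m] and half-length [h <= pi], the arc is the set of the points [u] with
    [Re (u * exp (- i m)) > cos h]. *)
Lemma measurable_open_arc a b : a < b -> b - a <= 2 * pi -> measurable (@cis R @` `]a, b[ : set T).
Proof.
move=> ab bap.
pose m := (a + b) / 2; pose h := (b - a) / 2.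
have h0 : 0 < h by rewrite divr_gt0// subr_gt0.
have hp : h <= pi by rewrite ler_pdivrMr// mulrC.
have [mre _] := @measurable_circle_continuous setT (fun w => w * (cos m -i* sin m)) openT
  (fun=> I) (fun w _ => has_cderive_continuous (has_cderiveM (has_cderive_id w) (has_cderive_cst _ w))).
have reE t : Re (circle_val (cis t : T) * (cos m -i* sin m)) = cos (t - m).
  by rewrite cis_val cReM cosB /=; ring.
have -> : @cis R @` `]a, b[ = (fun u : T => Re (circle_val u * (cos m -i* sin m))) @^-1` `]cos h, +oo[%classic.
  apply/seteqP; split => [_ [t /= + <-]|u].
    rewrite in_itv /= => /andP[at_ tb].
    suff H : cos h < cos (t - m) by rewrite -reE in H; rewrite /preimage /mkset in_itv; apply/andP.
    have -> : cos (t - m) = cos `|t - m|.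
      by case: (leP 0 (t - m)) => k; [rewrite ger0_norm|rewrite ltr0_norm// cosN].
    have tm : `|t - m| < h by rewrite ltr_norml /m /h; apply/andP; split; lra.
    by rewrite ltr_cos// in_itv /= ?normr_ge0 ?(ltW h0)//= (le_trans (ltW tm)).
  have [t [t1 t2 <-]] := cis_surj (m - pi) u; rewrite /preimage /mkset.
  rewrite reE in_itv andbT => /= ht; exists t => //=.
  have tp : `|t - m| <= pi by rewrite ler_norml; apply/andP; split; lra.
  move: ht; have -> : cos (t - m) = cos `|t - m|.
    by case: (leP 0 (t - m)) => k; [rewrite ger0_norm|rewrite ltr0_norm// cosN].
  rewrite ltr_cos ?in_itv /= ?normr_ge0 ?(ltW h0)// ltr_norml /m /h => /andP[h1 h2].
  by apply/andP; split; lra.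
rewrite -[X in measurable X]setTI; apply: mre => //.
Qed.

Lemma harc_setU1 a b : a < b -> harc a b = [set cis a] `|` @cis R @` `]a, b[.
Proof.
move=> ab; apply/seteqP; split => [_ [t /= + <-]|u].
  rewrite in_itv /= => /andP[at_ tb]; move: at_; rewrite le_eqVlt => /predU1P[->|at_]; first by left.
  by right; exists t => //=; rewrite in_itv /= at_.
move=> [->|[t /= + <-]]; first by exists a => //=; rewrite in_itv /= lexx.
by rewrite in_itv /= => /andP[at_ tb]; exists t => //=; rewrite in_itv /= ltW.
Qed.

Lemma harc_empty a b : b <= a -> harc a b = set0.
Proof.
move=> ba; rewrite -subset0 => _ [t /= + _]; rewrite in_itv /= => /andP[h1 h2].
by have := lt_le_trans (le_lt_trans h1 h2) ba; rewrite ltxx.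
Qed.

Lemma measurable_harc a b : b - a <= 2 * pi -> measurable (harc a b).
Proof.
move=> bap; have [ab|ba] := ltP a b; last by rewrite harc_empty.
by rewrite harc_setU1//; apply: measurableU; [exact: measurable_cis1|exact: measurable_open_arc].
Qed.

Lemma harc_split a m b : a <= m -> m <= b -> harc a b = harc a m `|` harc m b.
Proof.
move=> am mb; apply/seteqP; split => [_ [t /= + <-]|_ [|] [t /= + <-]].
- rewrite in_itv /= => /andP[h1 h2]; have [tm|tm] := ltP t m; [left|right];
    by exists t => //=; rewrite in_itv /= ?h1 ?tm.
- rewrite in_itv /= => /andP[h1 h2]; exists t => //=; rewrite in_itv /= h1/=; exact: lt_le_trans mb.
- rewrite in_itv /= => /andP[h1 h2]; exists t => //=; rewrite in_itv /= h2 andbT; exact: le_trans h1.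
Qed.

Lemma harc_disjoint a m b : b - a <= 2 * pi -> harc a m `&` harc m b = set0.
Proof.
move=> bap; rewrite -subset0 => _ [[t /= + <-] [s /= + st]].
rewrite !in_itv /= => /andP[h1 h2] /andP[h3 h4].
have := @cis_inj s t _ st; rewrite ltr_norml => /(_ _) E.
have st' : s = t by apply: E; apply/andP; split; lra.
by move: h2 h3; rewrite st' => h2 h3; have := lt_le_trans h2 h3; rewrite ltxx.
Qed.

Lemma harcD2piz a b (k : int) : harc (a + k%:~R * (2 * pi)) (b + k%:~R * (2 * pi)) = harc a b.
Proof.
apply/seteqP; split => [_ [t /= + <-]|_ [t /= + <-]]; rewrite in_itv /= => /andP[h1 h2].
  exists (t - k%:~R * (2 * pi)); first by rewrite /= in_itv /=; apply/andP; split; lra.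
  by rewrite -{2}(subrK (k%:~R * (2 * pi)) t) cisD2piz.
exists (t + k%:~R * (2 * pi)); last by rewrite cisD2piz.
by rewrite /= in_itv /=; apply/andP; split; lra.
Qed.

(** After a translation by a multiple of [2 pi] the arc starts in [[0, 2 pi[]; it is then an interval
    of that fundamental domain, or two of them if it passes through the angle [2 pi]. *)
Lemma harc_lengthE a b : a <= b -> b - a <= 2 * pi -> arc_length (harc a b) = (b - a)%:E.
Proof.
have pi20 : 0 < 2 * pi :> R by rewrite mulr_gt0 ?pi_gt0.
wlog a0 : a b / 0 <= a /\ a < 2 * pi.
  move=> H ab bap.
  have [t [t0 t2 /esym ta]] := cis_surj 0 (cis a).
  pose k := Num.floor (a / (2 * pi)).
  have k1 : k%:~R * (2 * pi) <= a by rewrite -ler_pdivlMr//; exact: floor_le_tmp.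
  have k2 : a < k%:~R * (2 * pi) + 2 * pi.
    by have := floorD1_gt (a / (2 * pi)); rewrite ltr_pdivrMr// intrD mulrDl mul1r.
  rewrite -(harcD2piz a b (- k)) H; first by congr EFin; ring.
  - by rewrite mulrNz mulNr; split; lra.
  - by rewrite lerD2r.
  - by rewrite opprD addrACA subrr addr0.
case: a0 => a0 a2 ab bap.
rewrite /arc_length.
have [b2|b2] := leP b (2 * pi).
  have -> : `[0, 2 * pi[ `&` @cis R @^-1` harc a b = `[a, b[%classic.
    apply/seteqP; split => t /=; rewrite !in_itv /=.
      move=> [/andP[t0 t2] [s /= + st]]; rewrite in_itv /= => /andP[s1 s2].
      by rewrite -(@cis_inj s t _ st) ?s1// ltr_norml; apply/andP; split; lra.
    move=> /andP[t1 t2]; split; first by apply/andP; split; lra.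
    by exists t => //=; rewrite in_itv /= t1.
  rewrite lebesgue_measure_itv /= lte_fin; case: ltP => // ba.
  by rewrite (_ : b = a) ?subrr//; apply/eqP; rewrite eq_le ba.
have -> : `[0, 2 * pi[ `&` @cis R @^-1` harc a b = `[a, 2 * pi[%classic `|` `[0, b - 2 * pi[%classic.
  apply/seteqP; split => t /=; rewrite !in_itv /=.
    move=> [/andP[t0 t2] [s /= + st]]; rewrite in_itv /= => /andP[s1 s2].
    have [s3|s3] := ltP s (2 * pi).
      by left; rewrite -(@cis_inj s t _ st) ?s1// ltr_norml; apply/andP; split; lra.
    have st' : cis (s - 2 * pi) = cis t :> T.
      by rewrite -st -{2}(subrK (2 * pi) s) -(cisD2piz _ 1) mul1r.
    right; rewrite -(@cis_inj _ t _ st'); first by apply/andP; split; lra.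
    by rewrite ltr_norml; apply/andP; split; lra.
  move=> [|] /andP[t1 t2]; split; try (by apply/andP; split; lra).
    by exists t => //=; rewrite in_itv /=; apply/andP; split; lra.
  exists (t + 2 * pi); last by rewrite -[RHS](cisD2piz _ 1) mul1r.
  by rewrite /= in_itv /=; apply/andP; split; lra.
have E1 : lebesgue_measure [set` `[a, 2 * pi[%R] = (2 * pi - a)%:E.
  by rewrite lebesgue_measure_itv /= lte_fin a2 EFinB.
have E2 : lebesgue_measure [set` `[0, b - 2 * pi[%R] = (b - 2 * pi)%:E.
  by rewrite lebesgue_measure_itv /= lte_fin subr_gt0 b2 -EFinB subr0.
transitivity (lebesgue_measure [set` `[a, 2 * pi[%R] + lebesgue_measure [set` `[0%R, (b - 2 * pi)%R[%R])%E.
  apply: measureU; [exact: measurable_itv|exact: measurable_itv|].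
  rewrite -subset0 => t /= []; rewrite !in_itv /= => /andP[h1 h2] /andP[h3 h4]; lra.
by rewrite E1 E2 -EFinD; congr EFin; ring.
Qed.

End circle_arcs.

(** * Distribution function of the measure *)

Section modulus_arcs.
Variable R : realType.
Local Notation T := (circle R).
Variables (mu : {measure set T -> \bar R}) (C : R).
Hypothesis hmod : forall t : R, 0 < t -> t < 1 ->
  (modulus_of_smoothness mu t <= (C * (t / Num.sqrt (ln (expR 1 / t))))%:E)%E.

Lemma modulus_arc (a m b t : R) : a < m -> m < b -> b - a <= 2 * pi -> m - a = b - m ->
  b - m <= t -> 0 < t -> t < 1 ->
  (`|mu (harc a m) - mu (harc m b)| <= (C * (t / Num.sqrt (lam t)))%:E)%E.
Proof.
move=> am mb bap eqm mt t0 t1.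
have -> : lam t = ln (expR 1 / t) by rewrite ln_div ?posrE ?expR_gt0// expRK.
apply: le_trans (hmod t0 t1); apply: ereal_sup_ubound.
have ma2 : m - a <= 2 * pi by lra.
have bm2 : b - m <= 2 * pi by lra.
exists (harc a m), (harc m b); split => //.
- by exists a, m, b, true, true, true; split.
- by rewrite !harc_lengthE ?(ltW am) ?(ltW mb)// eqm.
- by rewrite harc_lengthE ?(ltW mb)// lee_fin.
Qed.

(** By hypothesis the difference of the measures of two adjacent arcs is finite, and in [\bar R] a
    difference is infinite as soon as one of its terms is. *)
Lemma half_arc_finite (a : R) : (mu (harc a (a + 1 / 2)) < +oo)%E.
Proof.
have pi2 := pi_ge2 R.
have := @modulus_arc a (a + 1 / 2) (a + 1) (1 / 2) ltac:(lra) ltac:(lra) ltac:(lra) ltac:(lra)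
  ltac:(lra) ltac:(lra) ltac:(lra).
have := measure_ge0 mu (harc a (a + 1 / 2)).
have := measure_ge0 mu (harc (a + 1 / 2) (a + 1)).
case: (mu (harc a (a + 1 / 2))) => [x| |] //; first by rewrite ltry.
by case: (mu _).
Qed.

(** Sixteen arcs of length [1 / 2] cover the circle, as [2 pi <= 8]. *)
Lemma circle_measure_finite : (mu setT < +oo)%E.
Proof.
pose A (i : nat) : set T := harc (i%:R / 2) (i%:R / 2 + 1 / 2).
have mA i : measurable (A i) by apply: measurable_harc; have := pi_ge2 R; lra.
have mU n : measurable (\big[setU/set0]_(i < n) A i) by apply: bigsetU_measurable.
have fU n : (mu (\big[setU/set0]_(i < n) A i) < +oo)%E.
  elim: n => [|n ih]; first by rewrite big_ord0 measure0.
  rewrite big_ord_recr /=; apply: le_lt_trans (measureU2 _ (mU n) (mA n)) _.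
  by rewrite lte_add_pinfty//; exact: half_arc_finite.
apply: le_lt_trans (fU 16%N); apply: le_measure; rewrite ?inE//.
move=> u _; have [t [t0 t2 <-]] := cis_surj 0 u.
rewrite -bigcup_mkord.
have pi4 : pi / 2 < 2 :> R := pihalf_lt2 R.
have h0 : 0 <= t * 2 by lra.
have := truncn_itv h0; set n := Num.truncn _ => /andP[n1 n2].
exists n.
  rewrite /= -(@ltr_nat R); apply: le_lt_trans n1 _; lra.
rewrite -natr1 in n2.
by exists t => //=; rewrite in_itv /=; apply/andP; split; lra.
Qed.

End modulus_arcs.

Section angle.
Variable R : realType.
Local Notation T := (circle R).
Local Notation leb := (@lebesgue_measure R).
Variable theta0 : R.

Let ang_ex (u : T) : exists t, [/\ - pi <= t, t < pi & cis (theta0 + t) = u].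
Proof.
have [t [t0 t2 tu]] := cis_surj (theta0 - pi) u.
by exists (t - theta0); split; [lra|lra|rewrite addrC subrK].
Qed.

(** The angle is taken in [[- pi, pi[], so that the point at angle [theta0], where the kernel is large,
    is in the middle of the interval. *)
Definition ang (u : T) : R := sval (cid (ang_ex u)).

Lemma angP u : [/\ - pi <= ang u, ang u < pi & cis (theta0 + ang u) = u].
Proof. exact: svalP (cid (ang_ex u)). Qed.

Lemma ang_lt t : - pi <= t -> t <= pi ->
  [set u | ang u < t] = harc (theta0 - pi) (theta0 + t).
Proof.
move=> t1 t2; apply/seteqP; split => [u /= ut|_ [s /= + <-]].
  have [a1 a2 a3] := angP u; exists (theta0 + ang u) => //=.
  by rewrite in_itv /=; apply/andP; split; lra.
rewrite in_itv /= => /andP[s1 s2].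
have [a1 a2 a3] := angP (cis s).
suff : theta0 + ang (cis s) = s by lra.
by apply: cis_inj a3; rewrite ltr_norml; apply/andP; split; lra.
Qed.

Lemma measurable_ang : measurable_fun setT ang.
Proof.
move=> mT; apply: (measurability _ (RGenInftyO.measurableE R)) => //.
move=> _ [_ [x ->] <-]; rewrite setTI.
have -> : ang @^-1` `]-oo, x[%classic = [set u | ang u < x].
  by apply/seteqP; split => u /=; rewrite in_itv.
have [xp|xp] := ltP pi x.
  rewrite (_ : [set u | _] = setT)//; apply/seteqP; split => // u _ /=.
  by have [_ a2 _] := angP u; exact: lt_trans xp.
have [px|px] := leP (- pi) x; last first.
  rewrite (_ : [set u | _] = set0)// -subset0 => u /= ux.
  by have [a1 _ _] := angP u; lra.
by rewrite ang_lt//; apply: measurable_harc; lra.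
Qed.

Variable mu : {finite_measure set T -> \bar R}.

Definition distrib (t : R) : R := fine (mu (harc (theta0 - pi) (theta0 + t))).

Lemma distrib_fin t : t <= pi -> mu (harc (theta0 - pi) (theta0 + t)) = (distrib t)%:E.
Proof.
move=> t1; rewrite fineK// fin_num_measure//.
by apply: measurable_harc; lra.
Qed.

Lemma distrib_diff a b : - pi <= a -> a <= b -> b <= pi ->
  mu (harc (theta0 + a) (theta0 + b)) = (distrib b - distrib a)%:E.
Proof.
move=> a1 ab b1; have ap : a <= pi by exact: le_trans b1.
have h := @harc_split R (theta0 - pi) (theta0 + a) (theta0 + b) ltac:(lra) ltac:(lra).
have m1 : measurable (harc (theta0 - pi) (theta0 + a)) by apply: measurable_harc; lra.
have m2 : measurable (harc (theta0 + a) (theta0 + b)) by apply: measurable_harc; lra.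
have dis : harc (theta0 - pi) (theta0 + a) `&` harc (theta0 + a) (theta0 + b) = set0.
  by apply: harc_disjoint; lra.
have E : (mu (harc (theta0 - pi) (theta0 + b)) =
    mu (harc (theta0 - pi) (theta0 + a)) + mu (harc (theta0 + a) (theta0 + b)))%E.
  by rewrite h; exact: measureU.
have f2 : mu (harc (theta0 + a) (theta0 + b)) \is a fin_num by rewrite fin_num_measure.
move: E; rewrite !distrib_fin// -(fineK f2) -EFinD => -[->]; congr EFin; ring.
Qed.

Lemma distrib_le a b : - pi <= a -> a <= b -> b <= pi -> distrib a <= distrib b.
Proof.
move=> a1 ab b1; rewrite -subr_ge0 -lee_fin -distrib_diff//.
Qed.

Definition mass : R := fine (mu setT).

Lemma mass_fin : mu setT = mass%:E.
Proof. by rewrite fineK// fin_num_measure. Qed.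

Lemma mass_ge0 : 0 <= mass.
Proof. by rewrite -lee_fin -mass_fin measure_ge0. Qed.

Lemma distrib_pi : distrib pi = mass.
Proof.
rewrite /distrib /mass; congr (fine (mu _)); apply/seteqP; split => // u _.
have [t [t1 t2 tu]] := cis_surj (theta0 - pi) u.
by exists t => //=; rewrite in_itv /=; apply/andP; split; lra.
Qed.

Lemma distrib_Npi : distrib (- pi) = 0.
Proof. by rewrite /distrib harc_empty ?measure0//; lra. Qed.

Lemma distrib_itv t : - pi <= t -> t <= pi -> 0 <= distrib t <= mass.
Proof.
move=> t1 t2; rewrite -distrib_pi -distrib_Npi.
by rewrite !distrib_le// ?lexx//; have := pi_ge0 R; lra.
Qed.

Lemma measurable_distrib : measurable_fun `[- pi, pi] distrib.
Proof.
move=> mD; apply: (measurability _ (RGenOInfty.measurableE R)) => //.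
move=> _ [_ [y ->] <-]; apply: is_interval_measurable => s t /=.
rewrite !in_itv /= !andbT => -[/andP[s1 s2] ys] [/andP[t1 t2] yt] r /andP[sr rt].
rewrite /= !in_itv /= andbT; split; first by apply/andP; split; lra.
by apply: lt_le_trans ys _; apply: distrib_le => //; lra.
Qed.

(** Integration by parts, by Fubini's theorem for [kappa' t] on the set of the pairs with
    [ang u < t <= pi]: integrating first in [t] gives the left side, first in [u] the right side. *)
Lemma stieltjes (kappa kappa' : R -> R) : (forall t : R, is_derive t 1 kappa (kappa' t)) ->
  (forall t, {for t, continuous kappa'}) ->
  (\int[mu]_u (kappa pi - kappa (ang u)) = sint (- pi) pi (fun t => kappa' t * distrib t))%R.
Proof.
move=> dk ck.
have pi0 : - pi <= pi :> R by have := pi_ge0 R; lra.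
pose I : set R := `[- pi, pi]%classic.
pose g (p : T * R) : R := kappa' p.2 * \1_[set p : T * R | ang p.1 < p.2] p.
have mI : measurable (I : set (measurableTypeR R)) by exact: measurable_itv.
have mS : measurable ([set p | ang p.1 < p.2] : set (T * measurableTypeR R)).
  have mf : measurable_fun setT (fun p : T * measurableTypeR R => p.2 - ang p.1).
    apply: measurable_funB; first exact: measurable_snd.
    exact: (measurableT_comp measurable_ang measurable_fst).
  rewrite (_ : [set p | _] = (fun p : T * measurableTypeR R => p.2 - ang p.1) @^-1` `]0, +oo[%classic).
    by rewrite -[X in measurable X]setTI; apply: mf => //; exact: measurable_itv.
  by apply/seteqP; split => p /=; rewrite in_itv /= andbT subr_gt0.
have mg : measurable_fun setT (g : T * measurableTypeR R -> R).
  apply: measurable_funM; last exact: measurable_indic.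
  apply: (measurableT_comp _ measurable_snd).
  by apply: continuous_measurable_fun => t; exact: ck.
pose A : set (T * measurableTypeR R) := setT `*` I.
have mA : measurable A by apply: measurableX.
have [K HK] : exists K : R, forall t, I t -> `|kappa' t| <= K.
  have : compact (kappa' @` I).
    apply: continuous_compact; last exact: segment_compact.
    by apply: continuous_in_subspaceT => t _; exact: ck.
  move=> /compact_bounded[M [_ HM]]; exists (`|M| + 1) => t It.
  apply: (HM (`|M| + 1)); last by exists t.
  by rewrite (le_lt_trans (ler_norm _))// ltrDl.
have ig : (mu \x leb)%E.-integrable setT (EFin \o (g \_ A)).
  rewrite -restrict_EFin; apply/(integrable_mkcond _ mA).
  apply: (@measurable_bounded_integrable _ _ _ (mu \x leb)%E g) => //.
  - apply: (@le_lt_trans _ _ (mu setT * leb I)%E).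
      by rewrite le_eqVlt; apply/orP; left; apply/eqP; exact: product_measure1E.
    rewrite mass_fin lebesgue_measure_itv /= lte_fin.
    by case: ifP => _; rewrite -?EFinB -?EFinM ?mule0 ltry.
  - exact: measurable_funTS.
  - exists K; split; first exact: num_real.
    move=> x Kx p [_ /= Ip]; rewrite /g normrM; apply: le_trans (ltW Kx).
    rewrite -[leRHS]mulr1; apply: ler_pM => //; first exact: HK.
    by rewrite ger0_norm// indicE lern1 leq_b1.
have := Fubini ig => FB.
have gA u t : (g \_ A) (u, t) = (g (u, t)) * \1_I t.
  rewrite patchE; case: ifPn => [|/negP At].
    by rewrite inE => -[_ /= It]; rewrite indicE mem_set// mulr1.
  rewrite indicE memNset ?mulr0// => It; apply: At; rewrite inE; split => //.
have L u : (\int[leb]_y (EFin \o (g \_ A)) (u, y) = (kappa pi - kappa (ang u))%:E)%E.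
  have [a1 a2 _] := angP u.
  have cc : cont_on (ang u) pi kappa' by move=> t _; exact: ck.
  rewrite -(sint_FTC (ltW a2) cc (fun t _ => dk t)).
  have /integrable_fin_num := cont_on_integrable cc.
  move=> /(_ (measurable_itv _)) fin.
  rewrite /sint /Rintegral fineK// -integral_itv_obnd_cbnd; last first.
    by apply/measurable_EFinP; apply: measurable_funTS; apply: continuous_measurable_fun.
  rewrite [RHS]integral_mkcond; apply: eq_integral => t _.
  rewrite patchE /= gA /g /= !indicE; case: ifPn => [|/negP nt].
    rewrite inE /= in_itv /= => /andP[t1 t2].
    have It : I t by rewrite /I /= in_itv /= t2 andbT (le_trans a1)// ltW.
    by rewrite !mem_set ?mulr1.
  have [It|It] := pselect (I t); last by rewrite (memNset It) mulr0.
  have nS : ~ [set p : T * R | ang p.1 < p.2] (u, t).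
    move=> /= ut; apply: nt; rewrite inE /= in_itv /= ut.
    by move: It; rewrite /I /= in_itv /= => /andP[].
  by rewrite (memNset nS) mulr0 mul0r.
have Lt t : (\int[mu]_x (EFin \o (g \_ A)) (x, t) = ((kappa' t * distrib t) * \1_I t)%:E)%E.
  have [It|It] := pselect (I t); last first.
    rewrite [in RHS]indicE memNset// mulr0; apply: integral0_eq => u _.
    by rewrite /= gA indicE memNset// mulr0.
  have /andP[t1 t2] : - pi <= t <= pi by move: It; rewrite /I /= in_itv.
  have mSt : measurable [set u | ang u < t] by rewrite ang_lt//; apply: measurable_harc; lra.
  rewrite [in RHS]indicE mem_set// mulr1 EFinM.
  have -> : ((distrib t)%:E = \int[mu]_u (\1_[set u | ang u < t] u)%:E)%E.
    rewrite integral_indic// setIT ang_lt//; apply/esym; exact: distrib_fin.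
  rewrite -integralZl//.
    apply: eq_integral => u _; rewrite /= gA /g /= !indicE (mem_set It) mulr1 -EFinM.
    by congr (EFin (_ * _)); congr (nat_of_bool _)%:R; apply/idP/idP; rewrite !inE.
  apply: (@measurable_bounded_integrable _ _ _ mu) => //.
  - by rewrite -ge0_fin_numE//; exact: fin_num_measure.
  - exists 1; split; first exact: num_real.
    by move=> x x1 u _ /=; rewrite ger0_norm// (le_trans _ (ltW x1)).
have FB' : (\int[mu]_u (kappa pi - kappa (ang u))%:E =
    \int[leb]_t ((kappa' t * distrib t) * \1_I t)%:E)%E.
  transitivity (\int[mu]_u \int[leb]_y (EFin \o (g \_ A)) (u, y))%E.
    by apply: eq_integral => u _; rewrite L.
  by rewrite FB; apply: eq_integral => t _; rewrite Lt.
rewrite /sint /Rintegral FB' [in RHS]integral_mkcond; congr fine.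
apply: eq_integral => t _; rewrite patchE indicE.
by have [It|It] := pselect (I t); rewrite ?(mem_set It) ?(memNset It) ?mulr1 ?mulr0.
Qed.

End angle.

(** * Integration of a kernel against the measure *)

Section kernel_bound.
Variable R : realType.
Local Notation Re := (@complex.Re R).
Local Notation Im := (@complex.Im R).
Local Notation T := (circle R).
Local Notation leb := (@lebesgue_measure R).
Variables (mu : {finite_measure set T -> \bar R}) (C : R).
Hypothesis C0 : 0 < C.
Hypothesis hmod : forall t : R, 0 < t -> t < 1 ->
  (modulus_of_smoothness mu t <= (C * (t / Num.sqrt (ln (expR 1 / t))))%:E)%E.
Variable theta0 : R.
Local Notation F := (distrib theta0 mu).
Local Notation M := (mass mu).

(** The second difference at [a, m, b] is the difference of the measures of the adjacent arcs from [m]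
    to [b] and from [a] to [m]. *)
Lemma distrib_second_diff (a b t : R) : - pi <= a -> a < b -> b <= pi ->
  (b - a) / 2 <= t -> 0 < t -> t < 1 ->
  `|F a + F b - 2 * F ((a + b) / 2)| <= C * (t / Num.sqrt (lam t)).
Proof.
move=> a1 ab b1 abt t0 t1.
have [m mE] : exists m, m = (a + b) / 2 by exists ((a + b) / 2).
have am : a < m by lra.
have mb : m < b by lra.
have pm : - pi <= m by lra.
have mp : m <= pi by lra.
have H := @modulus_arc R mu C hmod (theta0 + a) (theta0 + m) (theta0 + b) t ltac:(lra)
  ltac:(lra) ltac:(lra) ltac:(lra) ltac:(lra) t0 t1.
have G x y : mu (harc (theta0 + a) (theta0 + m)) = x ->
    mu (harc (theta0 + m) (theta0 + b)) = y -> (`|x - y| <= (C * (t / Num.sqrt (lam t)))%:E)%E.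
  by move=> <- <-; exact: H.
have := G _ _ (distrib_diff theta0 mu a1 (ltW am) mp) (distrib_diff theta0 mu pm (ltW mb) b1).
rewrite -EFinB lee_fin -mE; apply: le_trans.
by rewrite (_ : F a + F b - 2 * F m = - (F m - F a - (F b - F m))) ?normrN//; ring.
Qed.

Definition dens_near (d : R) : R := (F d - F 0) / d.

(** [F] minus the affine function that agrees with it at [0] and at [d]. *)
Definition osc (d x : R) : R := F x - F 0 - dens_near d * x.

(** [zygmund_bound] with a modulus that is the one of the hypothesis below length [1], and the total
    mass beyond; [modulus_growth] and [modulus_growth1] compare both to the value at [d]. *)
Lemma osc_bound (d x : R) : 0 < d -> d < 1 -> `|x| <= pi ->
  `|osc d x| <= (C + M) * (d / Num.sqrt (lam d)) * (2 + 10 * pow32 (`|x| / d)).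
Proof.
move=> d0 d1 xpi; have pi2 := pi_ge2 R; have M0 := mass_ge0 mu.
have ld0 := lam_gt0 (ltW d1).
have sd : 0 < Num.sqrt (lam d) by rewrite sqrtr_gt0.
have dd0 : 0 < d / Num.sqrt (lam d) by rewrite divr_gt0.
pose w (t : R) := if t <= d then C * (d / Num.sqrt (lam d)) else
  if t < 1 then C * (t / Num.sqrt (lam t)) else M.
apply: (@zygmund_bound R (osc d) w pi d) => //.
- by lra.
- by rewrite /osc subrr mulr0 subr0.
- by rewrite /osc /dens_near divfK ?subrr// gt_eqF.
- exists (`|F 0| + M + `|dens_near d|) => y /andP[y0 yd].
  rewrite /osc; apply: le_trans (ler_normB _ _) _.
  have h1 : `|dens_near d * y| <= `|dens_near d|.
    by rewrite normrM ler_piMr// ger0_norm//; lra.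
  have h2 : `|F y - F 0| <= `|F y| + `|F 0| := ler_normB _ _.
  have /andP[Fy0 Fy1] : 0 <= F y <= M by apply: distrib_itv; lra.
  rewrite (ger0_norm Fy0) in h2; lra.
- move=> a b a1 ab b1; have -> : osc d a + osc d b - 2 * osc d ((a + b) / 2) = F a + F b - 2 * F ((a + b) / 2).
    by rewrite /osc; field.
  rewrite /w; case: ifPn => [t1|]; first by apply: distrib_second_diff.
  rewrite -ltNge => dt; case: ifPn => [t1|_].
    by apply: distrib_second_diff => //; lra.
  set m := (a + b) / 2.
  have am : a <= m by rewrite /m; lra.
  have mb : m <= b by rewrite /m; lra.
  have e1 : F a <= F m by apply: distrib_le => //; lra.
  have e2 : F m <= F b by apply: distrib_le => //; lra.
  have /andP[fa0 fa1] : 0 <= F a <= M by apply: distrib_itv; lra.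
  have /andP[fb0 fb1] : 0 <= F b <= M by apply: distrib_itv; lra.
  by rewrite ler_norml; apply/andP; split; lra.
- move=> t t0 td; rewrite /w td ler_pM2r//; lra.
- move=> t dt tp; have t0 : 0 < t by lra.
  have p1 : 1 <= pow32 (t / d) by rewrite pow32_ge1// ler_pdivlMr// mul1r.
  rewrite /w; case: ifPn => [_|_].
    rewrite -mulrA; apply: ler_pM; rewrite ?(ltW C0) ?(ltW dd0)//; first lra.
    by rewrite ler_peMr// ltW.
  rewrite -mulrA; case: ifPn => [t1|]; last first.
    rewrite -leNgt => t1; have := modulus_growth1 d0 (ltW d1) t1 => h.
    by rewrite -[leLHS]mulr1; apply: ler_pM; [exact: M0|exact: ler01|rewrite lerDr; exact: ltW C0|exact: h].
  apply: ler_pM => //; first exact: ltW.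
  - by rewrite divr_ge0 ?sqrtr_ge0// ltW.
  - by rewrite lerDl.
  - by apply: modulus_growth => //; exact: ltW.
Qed.

Lemma pow32_mono (x y : R) : 0 <= x -> x <= y -> pow32 x <= pow32 y.
Proof.
by move=> x0 xy; rewrite /pow32 ler_pM ?sqrtr_ge0// ler_sqrt// (le_trans x0).
Qed.

Lemma is_d_invsqrt (y : R) : 0 < y ->
  is_derive y 1 (fun y => - 2 * (Num.sqrt y)^-1) ((pow32 y)^-1).
Proof.
move=> y0; have s0 : 0 < Num.sqrt y by rewrite sqrtr_gt0.
have s1 : Num.sqrt y != 0 by rewrite gt_eqF.
have d := is_dM (is_dC (- 2) y) (@is_deriveV _ Num.sqrt y _ _ s1 (is_derive1_sqrt y0)).
apply: (is_derive_eq d); rewrite /GRing.scale /= /pow32.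
rewrite -[in RHS](sqr_sqrtr (ltW y0)) sqrtr_sqr gtr0_norm//; by field.
Qed.

(** The kernel decays like [(d + |t|)^-3] and [osc] grows like [|t|^(3/2)], so their product decays
    like this function, up to a power of [d]. *)
Definition decay (d t : R) : R := (pow32 (d + `|t|))^-1.

Lemma decay_integral (d : R) : 0 < d ->
  cont_on (- pi) pi (decay d) /\ sint (- pi) pi (decay d) <= 4 / Num.sqrt d.
Proof.
move=> d0; have pi2 := pi_ge2 R.
have pos_ (t : R) : 0 < d + `|t| by rewrite ltr_pwDl.
have c : cont_on (- pi) pi (decay d).
  move=> t _; rewrite /decay.
  have cn : {for t, continuous (fun t : R => d + `|t|)}.
    by apply: pcD; [exact: pcK|exact: norm_continuous].
  have cV : {for d + `|t|, continuous (fun y : R => (pow32 y)^-1)}.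
    have p0 : pow32 (d + `|t|) != 0 by rewrite mulf_neq0 ?sqrtr_eq0 -?ltNge ?gt_eqF.
    have cp : {for d + `|t|, continuous (fun y : R => pow32 y)}.
      by apply: pcM; [exact: (is_d_continuous (is_dI _))|exact: sqrt_continuous].
    exact: (pcc cp (inv_continuous p0)).
  exact: (pcc cn cV).
split => //.
have p0 : - pi <= 0 :> R by lra.
have c1 := cont_onS (lexx (- pi)) (pi_ge0 R) c.
have c2 := cont_onS p0 (lexx pi) c.
rewrite (@sint_split _ _ 0 _ _ _ _ c)//; last exact: pi_ge0.
have i2 : sint 0 pi (decay d) <= 2 / Num.sqrt d.
  have dd t : 0 <= t <= pi -> is_derive t 1 (fun t => - 2 * (Num.sqrt (d + t))^-1) (decay d t).
    move=> /andP[t0 _]; rewrite /decay ger0_norm//.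
    have dt0 : 0 < d + t by lra.
    have e := is_dcomp (is_dD (is_dC d t) (is_dI t)) (is_d_invsqrt dt0).
    by apply: (is_derive_eq e); rewrite add0r mulr1.
  rewrite (sint_FTC (pi_ge0 R) c2 dd) addr0.
  have : 0 <= (Num.sqrt (d + pi))^-1 :> R by rewrite invr_ge0 sqrtr_ge0.
  lra.
have i1 : sint (- pi) 0 (decay d) <= 2 / Num.sqrt d.
  have dd t : - pi <= t <= 0 -> is_derive t 1 (fun t => 2 * (Num.sqrt (d - t))^-1) (decay d t).
    move=> /andP[_ t0]; rewrite /decay ler0_norm//.
    have dt0 : 0 < d - t by lra.
    have e := is_dM (is_dC (- 1) t) (is_dcomp (is_dB (is_dC d t) (is_dI t)) (is_d_invsqrt dt0)).
    have -> : (fun t => 2 * (Num.sqrt (d - t))^-1) = (fun t => - 1 * (- 2 * (Num.sqrt (d - t))^-1)).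
      by apply/funext => x; ring.
    by apply: (is_derive_eq e); rewrite sub0r; ring.
  rewrite (sint_FTC p0 c1 dd) subr0 opprK.
  have : 0 <= (Num.sqrt (d + pi))^-1 :> R by rewrite invr_ge0 sqrtr_ge0.
  lra.
lra.
Qed.

Lemma affine_continuous (a c t : R) : {for t, continuous (fun t : R => a + c * t)}.
Proof. by apply: pcD; [exact: pcK|apply: pcM; [exact: pcK|exact: (is_d_continuous (is_dI _))]]. Qed.

(** As [kappa] has a periodic primitive, its integral over a period vanishes; after integration by
    parts the affine part of [F] therefore only contributes to the boundary term, and [F] can be
    replaced by [D = osc d] throughout.  The remaining integral is bounded with [osc_bound] and
    [decay_integral]. *)
Lemma stieltjes_bound (kappa kappa' prim : R -> R) (d c1 : R) : 0 < d -> d < 1 -> 0 <= c1 ->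
  (forall t : R, is_derive t 1 kappa (kappa' t)) -> (forall t, {for t, continuous kappa'}) ->
  (forall t : R, is_derive t 1 prim (kappa t)) -> prim pi = prim (- pi) ->
  kappa pi = kappa (- pi) -> `|kappa pi| <= c1 ->
  (forall t, `|t| <= pi -> `|kappa' t| <= c1 / (d + `|t|) ^+ 3) ->
  `|(\int[mu]_u kappa (ang theta0 u))%R| <=
     400 * c1 * ((C + M) * (d / Num.sqrt (lam d))) / d ^+ 2.
Proof.
move=> d0 d1 c10 dk ck dp pp kk kpi kb.
have pi2 := pi_ge2 R; have M0 := mass_ge0 mu.
have pi4 : pi <= 4 :> R by have := pihalf_lt2 R; lra.
have Npi : - pi <= pi :> R by lra.
set w0 := (C + M) * _.
have w00 : 0 <= w0.
  by rewrite mulr_ge0 ?divr_ge0 ?sqrtr_ge0 ?(ltW d0)// addr_ge0// ltW.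
pose D := osc d; pose c := dens_near d.
have FE t : F t = F 0 + c * t + D t by rewrite /D /osc -/c; ring.
have DB t : `|t| <= pi -> `|D t| <= w0 * (2 + 10 * pow32 (`|t| / d)) by exact: osc_bound.
have ckap t : {for t, continuous kappa} := is_d_continuous (dk t).
have mD : measurable_fun `[- pi, pi] D.
  rewrite (_ : D = (fun t => F t - (F 0 + c * t))); last first.
    by apply/funext => t; rewrite /D /osc -/c; ring.
  apply: measurable_funB; first exact: measurable_distrib.
  apply: measurable_funTS; apply: continuous_measurable_fun => t.
  by exact: affine_continuous.
have bound t : - pi <= t <= pi -> `|kappa' t * D t| <= (12 * c1 * w0 / (d * Num.sqrt d)) * decay d t.
  move=> tpi; have tn : `|t| <= pi by rewrite ler_norml.
  rewrite normrM /decay; set y := d + `|t|.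
  have y0 : 0 < y by rewrite /y ltr_pwDl.
  have sy : 0 < Num.sqrt y by rewrite sqrtr_gt0.
  have sd : 0 < Num.sqrt d by rewrite sqrtr_gt0.
  have x0 : 0 <= `|t| / d by rewrite divr_ge0// ltW.
  have yd : y / d = 1 + `|t| / d by rewrite /y mulrDl divff// gt_eqF.
  have h1 : pow32 (`|t| / d) <= pow32 (y / d) by rewrite pow32_mono// yd; lra.
  have h2 : 1 <= pow32 (y / d) by rewrite pow32_ge1// yd; lra.
  apply: (@le_trans _ _ (c1 / y ^+ 3 * (w0 * (12 * pow32 (y / d))))).
    apply: ler_pM => //; first exact: kb.
    by apply: le_trans (DB t tn) _; rewrite ler_wpM2l//; lra.
  rewrite le_eqVlt; apply/orP; left; apply/eqP.
  rewrite /pow32 sqrtrM ?(ltW y0)// sqrtrV ?(ltW d0)//.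
  have yy : y = Num.sqrt y ^+ 2 by rewrite sqr_sqrtr// ltW.
  rewrite {1 2 4}yy; field; rewrite !gt_eqF//.
have [cdec idec] := decay_integral d0.
have cdec' : cont_on (- pi) pi (fun t => (12 * c1 * w0 / (d * Num.sqrt d)) * decay d t).
  by move=> t tp; apply: pcM; [exact: pcK|exact: cdec].
have mI : measurable (`[- pi, pi]%classic : set (measurableTypeR R)) by exact: measurable_itv.
have ikD : leb.-integrable `[- pi, pi] (EFin \o (fun t => kappa' t * D t)).
  apply: (@le_integrable _ _ _ leb _ mI _ _ _ _ (cont_on_integrable cdec')).
    apply/measurable_EFinP; apply: measurable_funM => //.
    by apply: measurable_funTS; apply: continuous_measurable_fun.
  move=> t /=; rewrite in_itv /= => tpi; rewrite lee_fin.
  by apply: le_trans (bound t tpi) _; exact: ler_norm.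
have clin : cont_on (- pi) pi (fun t => kappa' t * (F 0 + c * t)).
  move=> t _; apply: pcM; first exact: ck.
  by exact: affine_continuous.
have S := stieltjes theta0 mu dk ck.
have split_ : sint (- pi) pi (fun t => kappa' t * F t) =
    sint (- pi) pi (fun t => kappa' t * (F 0 + c * t)) + sint (- pi) pi (fun t => kappa' t * D t).
  rewrite -RintegralD//; last exact: cont_on_integrable.
  by apply: eq_sint => t _; rewrite FE; ring.
have lin : sint (- pi) pi (fun t => kappa' t * (F 0 + c * t)) = 2 * pi * c * kappa pi.
  have dd t : - pi <= t <= pi -> is_derive t 1 (fun t => (F 0 + c * t) * kappa t - c * prim t)
      (kappa' t * (F 0 + c * t)).
    move=> _; have e := is_dB (is_dM (is_dD (is_dC (F 0) t) (is_dM (is_dC c t) (is_dI t))) (dk t))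
      (is_dM (is_dC c t) (dp t)).
    by apply: (is_derive_eq e); ring.
  by rewrite (sint_FTC Npi clin dd) pp -kk; ring.
have ikap : mu.-integrable setT (EFin \o (fun u => kappa (ang theta0 u))).
  have [K HK] : exists K : R, forall t, `[- pi, pi]%classic t -> `|kappa t| <= K.
    have : compact (kappa @` `[- pi, pi]%classic).
      apply: continuous_compact; last exact: segment_compact.
      by apply: continuous_in_subspaceT => t _; exact: ckap.
    move=> /compact_bounded[B [_ HB]]; exists (`|B| + 1) => t It.
    apply: (HB (`|B| + 1)); last by exists t.
    by rewrite (le_lt_trans (ler_norm _))// ltrDl.
  apply: (@measurable_bounded_integrable _ _ _ mu) => //.
  - by rewrite -ge0_fin_numE//; exact: fin_num_measure.
  - apply: measurableT_comp; last exact: measurable_ang.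
    exact: continuous_measurable_fun.
  - exists K; split; first exact: num_real.
    move=> x Kx u _ /=; apply: le_trans (ltW Kx); apply: HK.
    by have [a1 a2 _] := angP theta0 u; rewrite /= in_itv /= a1 ltW.
have icst : mu.-integrable setT (EFin \o (fun=> kappa pi)).
  apply: (@measurable_bounded_integrable _ _ _ mu) => //.
  - by rewrite -ge0_fin_numE//; exact: fin_num_measure.
  - exists `|kappa pi|; split; first exact: num_real.
    by move=> x Kx u _ /=; exact: ltW.
(* The linear part [c t] contributes [2 pi c * kappa pi] to [lin], which is what is missing in
   [D pi - D (- pi)]. *)
have E : (\int[mu]_u kappa (ang theta0 u))%R = kappa pi * (D pi - D (- pi)) -
    sint (- pi) pi (fun t => kappa' t * D t).
  move: S; rewrite split_ lin RintegralB// Rintegral_cst// -/M => S.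
  have D1 : D pi - D (- pi) = M - 2 * pi * c.
    by rewrite /D /osc -/c distrib_pi distrib_Npi; ring.
  by rewrite D1; lra.
rewrite E; apply: le_trans (ler_normB _ _) _.
(* At the endpoints [osc_bound] is only used crudely, with [pow32 x <= x ^ 2]. *)
have pd : pow32 (pi / d) <= 16 / d ^+ 2.
  have h : pi / d <= 4 / d by rewrite ler_pM2r ?invr_gt0.
  have h0 : 0 <= pi / d by rewrite divr_ge0 ?pi_ge0// ltW.
  have h1 : 1 <= pi / d by rewrite ler_pdivlMr//; lra.
  have -> : 16 / d ^+ 2 = (4 / d) * (4 / d) by field; rewrite gt_eqF.
  rewrite /pow32; apply: ler_pM; rewrite ?sqrtr_ge0//; apply: le_trans h.
  rewrite -[leRHS]ger0_norm// -sqrtr_sqr ler_sqrt ?sqr_ge0//.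
  by rewrite expr2 ler_peMl.
have dd1 : 1 <= 1 / d ^+ 2.
  by rewrite ler_pdivlMr ?exprn_gt0// mul1r exprn_ile1// ltW.
have p1 : `|kappa pi * (D pi - D (- pi))| <= c1 * (2 * (w0 * (162 * (1 / d ^+ 2)))).
  rewrite normrM; apply: ler_pM => //; apply: le_trans (ler_normB _ _) _.
  have := DB pi; have := DB (- pi); rewrite normrN (ger0_norm (pi_ge0 R)) => /(_ (lexx _)) e1 /(_ (lexx _)) e2.
  have : w0 * (2 + 10 * pow32 (pi / d)) <= w0 * (162 * (1 / d ^+ 2)).
    by rewrite ler_wpM2l//; lra.
  lra.
have p2 : `|sint (- pi) pi (fun t => kappa' t * D t)| <= 12 * c1 * w0 / (d * Num.sqrt d) * (4 / Num.sqrt d).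
  rewrite /sint; apply: le_trans (le_normr_Rintegral _ _) _ => //.
  apply: (@le_trans _ _ (sint (- pi) pi (fun t => (12 * c1 * w0 / (d * Num.sqrt d)) * decay d t))).
    apply: le_Rintegral; first exact: mI.
    - by have := integrable_norm ikD.
    - exact: (cont_on_integrable cdec').
    - by move=> t /=; rewrite in_itv /=; exact: bound.
  have K0 : 0 <= 12 * c1 * w0 / (d * Num.sqrt d).
    apply: divr_ge0; first by apply: mulr_ge0 w00; apply: mulr_ge0.
    by apply: mulr_ge0; [exact: ltW|exact: sqrtr_ge0].
  by rewrite sintZ//; apply: ler_wpM2l.
have sd : 0 < Num.sqrt d by rewrite sqrtr_gt0.
have e2 : 12 * c1 * w0 / (d * Num.sqrt d) * (4 / Num.sqrt d) = 48 * (c1 * w0 * (1 / d ^+ 2)).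
  move: sd (sqr_sqrtr (ltW d0)); move: (Num.sqrt d) (w0) => s v s0 <-.
  by field; rewrite gt_eqF.
rewrite e2 in p2.
have q0 : 0 <= c1 * w0 * (1 / d ^+ 2) by apply: mulr_ge0; [exact: mulr_ge0|rewrite divr_ge0// sqr_ge0].
have -> : 400 * c1 * w0 / d ^+ 2 = 400 * (c1 * w0 * (1 / d ^+ 2)) by ring.
by lra.
Qed.

End kernel_bound.

(** * The kernel of the derivative of the Herglotz integral *)

Section kernel.
Variable R : realType.
Local Notation Re := (@complex.Re R).
Local Notation Im := (@complex.Im R).
Local Notation T := (circle R).
Local Notation leb := (@lebesgue_measure R).

(** The remainder [(a + h)^-1 - a^-1 + a^-2 h] equals [h^2 / (a^2 (a + h))]. *)
Lemma inv_has_cderive (a : R[i]) : a != 0 ->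
  has_cderive (fun w => w^-1) a (- (a^-1 * a^-1)).
Proof.
move=> a0 e e0.
have n0 : 0 < normc a by rewrite normc_gt0.
have m0 : 0 < e * normc a ^+ 3 / 2 by rewrite divr_gt0// mulr_gt0// exprn_gt0.
exists (Num.min (normc a / 2) (e * normc a ^+ 3 / 2)).
  by rewrite lt_min m0 andbT divr_gt0.
move=> h; rewrite lt_min => /andP[h1 h2].
have n1 : normc a / 2 <= normc (a + h) by have := lerB_normcD a h; lra.
have ah : a + h != 0 by rewrite -normc_gt0; lra.
have -> : (a + h)^-1 - a^-1 - - (a^-1 * a^-1) * h = h * (h * (a^-1 * (a^-1 * (a + h)^-1))).
  by field; rewrite ah a0.
rewrite !normcM !normcV mulrC ler_wpM2r ?normcr_ge0//.
have i1 : (normc (a + h))^-1 <= 2 / normc a.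
  rewrite -[leRHS]invrK lef_pV2 ?posrE ?invr_gt0 ?divr_gt0// ?invf_div//.
  by apply: lt_le_trans n1; rewrite divr_gt0.
apply: (@le_trans _ _ (e * normc a ^+ 3 / 2 * ((normc a)^-1 * ((normc a)^-1 * (2 / normc a))))).
  apply: ler_pM; rewrite ?normcr_ge0 ?mulr_ge0 ?invr_ge0 ?normcr_ge0//; first exact: ltW.
  by rewrite !ler_wpM2l ?invr_ge0 ?normcr_ge0.
move: (normc a) n0 => x x0; rewrite le_eqVlt; apply/orP; left; apply/eqP; field.
by rewrite gt_eqF.
Qed.

Lemma has_cderiveV (f : R[i] -> R[i]) z L : has_cderive f z L -> f z != 0 ->
  has_cderive (fun w => (f w)^-1) z (- ((f z)^-1 * (f z)^-1) * L).
Proof. by move=> fL fz; exact: (has_cderive_comp fL (inv_has_cderive fz)). Qed.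

(** On [[0, pi / 4]] the cosine is at least [1 / 2], as [2 cos(y)^2 - 1 = cos (2 y) >= 0], so that
    [sin y >= y / 2]; then [sin x = 2 sin (x / 2) cos (x / 2)]. *)
Lemma sin_ge_quarter (x : R) : 0 <= x -> x <= pi / 2 -> x / 4 <= sin x.
Proof.
move=> x0 xp.
have half (y : R) : 0 <= y -> y <= pi / 4 -> 1 / 2 <= cos y.
  move=> y0 yp; have c1 : 0 <= cos y by apply: cos_ge0_pihalf; apply/andP; split; lra.
  have : 0 <= cos (y *+ 2) by apply: cos_ge0_pihalf; rewrite (mulr2n y); apply/andP; split; lra.
  rewrite cos_mulr2n; nra.
have s (y : R) : 0 <= y -> y <= pi / 4 -> y / 2 <= sin y.
  move=> y0 yp.
  have cc : cont_on 0 y (@cos R) by move=> t _; exact: continuous_cos.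
  have ck : cont_on 0 y (fun=> 1 / 2 : R) by move=> t _; exact: pcK.
  have := sint_FTC y0 cc (fun t _ => is_derive_sin t); rewrite sin0 subr0 => <-.
  apply: (@le_trans _ _ (sint 0 y (fun=> 1 / 2))); first by rewrite sint_cst// subr0; lra.
  by apply: le_sint => // t /andP[t0 ty]; apply: half => //; lra.
have -> : x = x / 2 + x / 2 by field.
rewrite sinD; set y := x / 2.
have y0 : 0 <= y by rewrite /y; lra.
have yp : y <= pi / 4 by rewrite /y; lra.
by have := half y y0 yp; have := s y y0 yp; nra.
Qed.

(** [1 - cos t = 2 sin (t / 2) ^ 2]. *)
Lemma cos_le_quadratic (t : R) : `|t| <= pi -> t ^+ 2 / 32 <= 1 - cos t.
Proof.
move=> tp; wlog t0 : t tp / 0 <= t.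
  move=> H; have [t0|t0] := leP 0 t; first exact: H.
  by rewrite -sqrrN -cosN; apply: H; rewrite ?normrN// oppr_ge0 ltW.
rewrite ger0_norm// in tp.
have s := @sin_ge_quarter (t / 2) ltac:(lra) ltac:(lra).
move: s; have -> : t ^+ 2 / 32 = (t / 2) ^+ 2 / 8 by field.
rewrite (_ : cos t = cos (t / 2 + t / 2)); last by congr cos; field.
have x0 : 0 <= t / 2 by lra.
rewrite cosD; have := cos2Dsin2 (t / 2); move: (t / 2) x0 (cos _) (sin _) => x x0 c s cs xs.
have : (x / 4) ^+ 2 <= s ^+ 2 by rewrite ler_sqr ?nnegrE//; lra.
by rewrite -!expr2; lra.
Qed.

(** [|e^(it) - r|^2 = (1 - r)^2 + 2 r (1 - cos t) >= (1 - r)^2 + t^2 / 32]. *)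
Lemma dist_circle_radius (r t : R) : 1 / 2 <= r -> r < 1 -> `|t| <= pi ->
  (1 - r + `|t|) / 16 <= normc (cos t +i* sin t - r%:C).
Proof.
move=> r1 r2 tp; have q := cos_le_quadratic tp.
have a0 : 0 <= 1 - r + `|t| by rewrite addr_ge0// subr_ge0 ltW.
rewrite -ler_sqr ?nnegrE ?normcr_ge0 ?divr_ge0// sqr_normcE /= subr0.
have t2 : `|t| ^+ 2 = t ^+ 2 by rewrite real_normK ?num_real.
have := cos2Dsin2 t; have c1 := cos_le1 t.
have : (1 - r + `|t|) ^+ 2 <= 2 * (1 - r) ^+ 2 + 2 * `|t| ^+ 2.
  by have := sqr_ge0 (1 - r - `|t|); nra.
have p : 1 - cos t <= 2 * r * (1 - cos t) by rewrite -[leLHS]mul1r ler_wpM2r//; lra.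
rewrite t2; move: (cos t) (sin t) p q c1 => c s p q c1; nra.
Qed.

(** The derivative in [z] of the Herglotz kernel [(u + z) / (u - z)]. *)
Definition poisson_deriv (z u : R[i]) : R[i] := 2 * u * ((u - z)^-1 * (u - z)^-1).

Section pointwise.
Variables (theta0 r : R).
Hypotheses (r1 : 1 / 2 <= r) (r2 : r < 1).
Let E0 : R[i] := cos theta0 +i* sin theta0.
Let z := r%:C * E0.
Let E (w : R[i]) := E0 * cexp w.
Let V (w : R[i]) := (E w - z)^-1.
Let line (t : R) : R[i] := 0 + t%:C * 'i%C.

Let lineE t : line t = 0 +i* t.
Proof. by rewrite /line; apply/eqP; rewrite eq_complex /=; apply/andP; split; apply/eqP; ring. Qed.

Lemma circle_pointE (t : R) : E (line t) = circle_val (cis (theta0 + t)).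
Proof.
rewrite /E lineE cexp_Im cis_val cosD sinD.
by apply/eqP; rewrite eq_complex /=; apply/andP; split; apply/eqP; ring.
Qed.

Lemma normc_E t : normc (E (line t)) = 1.
Proof. by rewrite circle_pointE cis_val; apply/eqP; exact: normc_cis. Qed.

Lemma normc_z : normc z = r.
Proof.
rewrite /z normcM normc_real (eqP (normc_cis theta0)) mulr1 ger0_norm//; have := r1; lra.
Qed.

Lemma dist_point_ge (t : R) : `|t| <= pi -> (1 - r + `|t|) / 16 <= normc (E (line t) - z).
Proof.
move=> tp; apply: le_trans (dist_circle_radius r1 r2 tp) _.
rewrite /E /z lineE cexp_Im [r%:C * _]mulrC -mulrBr normcM.
by rewrite (eqP (normc_cis theta0)) mul1r.
Qed.

Lemma point_neq t : E (line t) - z != 0.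
Proof.
rewrite -normc_gt0; have := lerB_normcB (E (line t)) z; rewrite normc_E normc_z; have := r2; lra.
Qed.

Let dE w : has_cderive E w (E w).
Proof.
have := has_cderiveM (has_cderive_cst E0 w) (cexp_derive w).
by rewrite mulr0 addr0.
Qed.

Let dV t : has_cderive V (line t) (- (V (line t) * V (line t)) * E (line t)).
Proof.
have := has_cderiveV (has_cderiveB (dE (line t)) (has_cderive_cst z (line t))) (point_neq t).
by rewrite subr0.
Qed.

(* In terms of the angle [t], [E (line t)] runs over the circle and [V] is the resolvent: [K] is the
   kernel, [K1] its derivative, and [P], which satisfies [P' * i = K], a primitive of the kernel
   in [t].  Being functions of [E], they are periodic. *)
Let K w := 2 * E w * (V w * V w).
Let K1 w := - (2 * E w) * ((E w + z) * (V w * (V w * V w))).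
Let P w := 'i%C * z^-1 * ((E w + z) * V w).

Let z_neq0 : z != 0.
Proof. by rewrite -normc_gt0 normc_z; have := r1; lra. Qed.

Let dK t : has_cderive K (line t) (K1 (line t)).
Proof.
have d := has_cderiveM (has_cderiveM (has_cderive_cst 2 (line t)) (dE (line t)))
  (has_cderiveM (dV t) (dV t)).
move: d; congr has_cderive; rewrite /K1 /V.
have := point_neq t; move: (E (line t)) => e ez.
by field.
Qed.

Let dK1 t : exists L, has_cderive K1 (line t) L.
Proof.
eexists; apply: has_cderiveM.
  by apply: has_cderiveN; apply: has_cderiveM (dE _); exact: has_cderive_cst.
apply: has_cderiveM; first by apply: has_cderiveD (dE _) _; exact: has_cderive_cst.
by apply: has_cderiveM (dV _) _; apply: has_cderiveM (dV _) (dV _).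
Qed.

Let dP t : has_cderive P (line t) (- 'i%C * K (line t)).
Proof.
have d := has_cderiveM (has_cderive_cst ('i%C * z^-1) (line t))
  (has_cderiveM (has_cderiveD (dE (line t)) (has_cderive_cst z (line t))) (dV t)).
move: d; congr has_cderive; rewrite /K /V.
have := point_neq t; move: (E (line t)) => e ez; move: z_neq0 => z0.
by field; rewrite z0 ez.
Qed.

Let E_pi : E (line pi) = E (line (- pi)).
Proof. by rewrite /E !lineE !cexp_Im cospi sinpi cosN sinN cospi sinpi oppr0. Qed.

Let K_le t : `|t| <= pi -> normc (K (line t)) <= 512 / (1 - r + `|t|) ^+ 2 /\
  normc (K1 (line t) * 'i%C) <= 16384 / (1 - r + `|t|) ^+ 3.
Proof.
move=> tp; have dz := dist_point_ge tp.
have a0 : 0 < 1 - r + `|t| by rewrite ltr_pwDl// subr_gt0.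
have vE : normc (V (line t)) <= 16 / (1 - r + `|t|).
  rewrite /V normcV -[leRHS]invrK invf_div lef_pV2 ?posrE ?divr_gt0//.
  by apply: lt_le_trans dz; rewrite divr_gt0.
have n2 : normc (2 : R[i]) = 2.
  by rewrite (_ : 2 = (2 : R)%:C) ?normc_real ?ger0_norm//; apply/eqP; rewrite eq_complex /= addr0 !eqxx.
have ni : normc ('i%C : R[i]) = 1 by rewrite /normc /= expr0n expr1n add0r sqrtr1.
have ez : normc (E (line t) + z) <= 2.
  by apply: le_trans (le_normcD _ _) _; rewrite normc_E normc_z; have := r2; lra.
rewrite /K /K1; move: (normc_E t) ez vE.
move: (V (line t)) (E (line t)) => v1 e1; move: (e1 + z) => ez1 En ez vE.
rewrite !normcM normcN !normcM n2 ni En !mulr1.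
have v0 := normcr_ge0 v1.
have e0 := normcr_ge0 ez1.
move: (normc v1) (normc ez1) vE ez v0 e0 => v e vE ez v0 e0.
move: (1 - r + `|t|) a0 vE => a a0 vE; split.
  rewrite (_ : 512 / _ = 2 * (16 / a * (16 / a))); last by field; rewrite gt_eqF.
  by rewrite ler_wpM2l//; apply: ler_pM.
rewrite (_ : 16384 / _ = 2 * (2 * (16 / a * (16 / a * (16 / a))))); last by field; rewrite gt_eqF.
have h2 : v * v <= 16 / a * (16 / a) by apply: ler_pM.
have h3 : v * (v * v) <= 16 / a * (16 / a * (16 / a)) by apply: ler_pM; rewrite ?mulr_ge0.
have h4 : e * (v * (v * v)) <= 2 * (16 / a * (16 / a * (16 / a))).
  by apply: (ler_pM e0 _ ez h3); rewrite !mulr_ge0.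
by rewrite ler_wpM2l.
Qed.

Section measure_bound.
Variables (mu : {finite_measure set T -> \bar R}) (C : R).
Hypothesis C0 : 0 < C.
Hypothesis hmod : forall t : R, 0 < t -> t < 1 ->
  (modulus_of_smoothness mu t <= (C * (t / Num.sqrt (ln (expR 1 / t))))%:E)%E.

(** [stieltjes_bound] for the real and the imaginary part; [16384 = 4 * 16^3] bounds the derivative of
    the kernel by the distance estimate of [dist_point_ge]. *)
Lemma poisson_deriv_bound_polar : normc (circle_integral mu (fun u => poisson_deriv z (circle_val u))) <=
  800 * 16384 * ((C + mass mu) * ((1 - r) / Num.sqrt (lam (1 - r)))) / (1 - r) ^+ 2.
Proof.
have d0 : 0 < 1 - r by have := r2; lra.
have d1 : 1 - r < 1 by have := r1; lra.
have KE u : poisson_deriv z (circle_val u) = K (line (ang theta0 u)).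
  by have [_ _ a3] := angP theta0 u; rewrite /poisson_deriv /K /V circle_pointE a3.
have pp0 : `|pi| <= pi :> R by rewrite ger0_norm ?pi_ge0.
have pi2 := pi_ge2 R.
have cs : normc (K (line pi)) <= 16384.
  have [+ _] := K_le pp0; move=> h; apply: le_trans h _.
  rewrite ger0_norm ?pi_ge0//.
  have p1 : 0 < 1 - r + pi by lra.
  by rewrite ler_pdivrMr ?exprn_gt0//; nra.
have P_pi : P (line pi) = P (line (- pi)) by rewrite /P /V E_pi.
have K_pi : K (line pi) = K (line (- pi)) by rewrite /K /V E_pi.
have Ki t : - 'i%C * K (line t) * 'i%C = K (line t).
  move: (K _) => [x y].
  by apply/eqP; rewrite eq_complex /=; apply/andP; split; apply/eqP; ring.
have bRe := @stieltjes_bound R mu C C0 hmod theta0 (fun t => Re (K (line t)))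
  (fun t => Re (K1 (line t) * 'i%C)) (fun t => Re (P (line t))) (1 - r) 16384 d0 d1 ltac:(lra)
  (fun t => (is_derive_line (dK t)).1).
have bIm := @stieltjes_bound R mu C C0 hmod theta0 (fun t => Im (K (line t)))
  (fun t => Im (K1 (line t) * 'i%C)) (fun t => Im (P (line t))) (1 - r) 16384 d0 d1 ltac:(lra)
  (fun t => (is_derive_line (dK t)).2).
have cK1 t : {for line t, continuous ((fun w => K1 w * 'i%C) : R[i]^o -> R[i]^o)}.
  have [L hL] := dK1 t.
  exact: (has_cderive_continuous (has_cderiveM hL (has_cderive_cst 'i%C (line t)))).
have dPr t := is_derive_line (dP t).
rewrite /circle_integral; apply: le_trans (normc_leReIm _) _ => /=.
rewrite (_ : 800 * 16384 * _ / _ = 400 * 16384 * ((C + mass mu) * ((1 - r) / Num.sqrt (lam (1 - r)))) / (1 - r) ^+ 2 +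
  400 * 16384 * ((C + mass mu) * ((1 - r) / Num.sqrt (lam (1 - r)))) / (1 - r) ^+ 2); last by ring.
apply: lerD.
  rewrite (_ : (fun u => _) = (fun u => Re (K (line (ang theta0 u))))); last first.
    by apply/funext => u; rewrite KE.
  apply: bRe.
  - by move=> t; exact: (continuousC_line (cK1 t)).1.
  - by move=> t; have := (dPr t).1; rewrite Ki.
  - by rewrite P_pi.
  - by rewrite K_pi.
  - exact: le_trans (normRe_le _) cs.
  - by move=> t tp; apply: le_trans (normRe_le _) _; exact: (K_le tp).2.
rewrite (_ : (fun u => _) = (fun u => Im (K (line (ang theta0 u))))); last first.
  by apply/funext => u; rewrite KE.
apply: bIm.
- by move=> t; exact: (continuousC_line (cK1 t)).2.
- by move=> t; have := (dPr t).2; rewrite Ki.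
- by rewrite P_pi.
- by rewrite K_pi.
- exact: le_trans (normIm_le _) cs.
- by move=> t tp; apply: le_trans (normIm_le _) _; exact: (K_le tp).2.
Qed.

End measure_bound.
End pointwise.

Lemma polar_form (z : R[i]) : exists theta, z = (normc z)%:C * (cos theta +i* sin theta).
Proof.
have [->|z0] := eqVneq z 0; first by exists 0; rewrite normc0 mul0r.
have n0 : (normc z)%:C != 0 :> R[i] by rewrite -normc_eq0 normc_real normr_eq0 normc_eq0.
have h : normc (z / (normc z)%:C) == 1.
  rewrite normcM normcV normc_real ger0_norm ?normcr_ge0// divff// normc_eq0//.
have [t [_ _ tu]] := cis_surj 0 (exist (fun z : R[i] => normc z == 1) _ h : T).
exists t; rewrite -cis_val tu /=.
by rewrite /circle_val /= mulrC divfK.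
Qed.

End kernel.

(** * The Herglotz integral and the singular inner function *)

Section herglotz.
Variable R : realType.
Local Notation Re := (@complex.Re R).
Local Notation Im := (@complex.Im R).
Local Notation T := (circle R).
Variable mu : {finite_measure set T -> \bar R}.

Definition bounded_density (F : T -> R[i]) :=
  [/\ measurable_fun setT (fun u => Re (F u)), measurable_fun setT (fun u => Im (F u)) &
      exists B : R, forall u, normc (F u) <= B].

Lemma bounded_integrable (g : T -> R) (B : R) : measurable_fun setT g ->
  (forall u, `|g u| <= B) -> mu.-integrable setT (EFin \o g).
Proof.
move=> mg gB; apply: (@measurable_bounded_integrable _ _ _ mu) => //.
- by rewrite -ge0_fin_numE//; exact: fin_num_measure.
- exists B; split; first exact: num_real.
  by move=> x Bx u _ /=; apply: le_trans (gB u) (ltW Bx).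
Qed.

Lemma bounded_densityP F : bounded_density F ->
  mu.-integrable setT (EFin \o (fun u => Re (F u))) /\
  mu.-integrable setT (EFin \o (fun u => Im (F u))).
Proof.
move=> [mR mI [B FB]]; split; apply: (@bounded_integrable _ B) => // u.
- exact: le_trans (normRe_le _) (FB u).
- exact: le_trans (normIm_le _) (FB u).
Qed.

Lemma bounded_densityB F G : bounded_density F -> bounded_density G ->
  bounded_density (fun u => F u - G u).
Proof.
move=> [f1 f2 [B fB]] [g1 g2 [B' gB]]; split.
- rewrite (_ : (fun u => _) = (fun u => Re (F u) - Re (G u))); first exact: measurable_funB.
  by apply/funext => u; rewrite cReD cReN.
- rewrite (_ : (fun u => _) = (fun u => Im (F u) - Im (G u))); first exact: measurable_funB.
  by apply/funext => u; rewrite cImD cImN.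
- by exists (B + B') => u; apply: le_trans (le_normcB _ _) _; exact: lerD.
Qed.

Lemma bounded_densityM F c : bounded_density F -> bounded_density (fun u => F u * c).
Proof.
move=> [f1 f2 [B fB]]; split.
- rewrite (_ : (fun u => _) = (fun u => Re (F u) * Re c - Im (F u) * Im c)).
    by apply: measurable_funB; apply: measurable_funM.
  by apply/funext => u; rewrite cReM.
- rewrite (_ : (fun u => _) = (fun u => Re (F u) * Im c + Im (F u) * Re c)).
    by apply: measurable_funD; apply: measurable_funM.
  by apply/funext => u; rewrite cImM.
- by exists (B * normc c) => u; rewrite normcM ler_wpM2r ?normcr_ge0.
Qed.

Lemma circle_integralB F G : bounded_density F -> bounded_density G ->
  circle_integral mu (fun u => F u - G u) = circle_integral mu F - circle_integral mu G.
Proof.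
move=> /bounded_densityP[f1 f2] /bounded_densityP[g1 g2].
apply/eqP; rewrite eq_complex /=; apply/andP; split; apply/eqP.
- by rewrite -RintegralB//; congr Rintegral; apply/funext => u; rewrite cReD cReN.
- by rewrite -RintegralB//; congr Rintegral; apply/funext => u; rewrite cImD cImN.
Qed.

Lemma circle_integralM F c : bounded_density F ->
  circle_integral mu (fun u => F u * c) = circle_integral mu F * c.
Proof.
move=> bF; have [f1 f2] := bounded_densityP bF; have [m1 m2 [B FB]] := bF.
have i1 k : mu.-integrable setT (EFin \o (fun u => Re (F u) * k)).
  apply: (@bounded_integrable _ (B * `|k|)); first exact: measurable_funM.
  by move=> u; rewrite normrM ler_wpM2r//; exact: le_trans (normRe_le _) (FB u).
have i2 k : mu.-integrable setT (EFin \o (fun u => Im (F u) * k)).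
  apply: (@bounded_integrable _ (B * `|k|)); first exact: measurable_funM.
  by move=> u; rewrite normrM ler_wpM2r//; exact: le_trans (normIm_le _) (FB u).
apply/eqP; rewrite eq_complex cReM cImM /=; apply/andP; split; apply/eqP.
- rewrite -!RintegralZr// -RintegralB//; congr Rintegral; apply/funext => u; exact: cReM.
- rewrite -!RintegralZr// -RintegralD//; congr Rintegral; apply/funext => u; exact: cImM.
Qed.

Lemma circle_integral_le F (B : R) : bounded_density F -> (forall u, normc (F u) <= B) ->
  normc (circle_integral mu F) <= 2 * B * mass mu.
Proof.
move=> bF FB; have [f1 f2] := bounded_densityP bF.
have h (g : T -> R) : mu.-integrable setT (EFin \o g) -> (forall u, `|g u| <= B) ->
    `|\int[mu]_u g u| <= B * mass mu.
  move=> ig gB; apply: le_trans (le_normr_Rintegral _ ig) _ => //.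
  rewrite -(@Rintegral_cst _ _ _ mu)//; apply: le_Rintegral => //.
  - by have := integrable_norm ig.
  - by apply: (@bounded_integrable _ `|B|).
apply: le_trans (normc_leReIm _) _ => /=.
have := h _ f1 (fun u => le_trans (normRe_le _) (FB u)).
have := h _ f2 (fun u => le_trans (normIm_le _) (FB u)).
lra.
Qed.

(** Differentiation under the integral sign, from a quadratic bound uniform on the circle. *)
Lemma circle_integral_has_cderive (k : R[i] -> T -> R[i]) (k' : T -> R[i]) z (d B : R) :
  0 < d -> bounded_density k' -> (forall h, normc h < d -> bounded_density (k (z + h))) ->
  (forall h u, normc h < d -> normc (k (z + h) u - k z u - k' u * h) <= B * normc h ^+ 2) ->
  has_cderive (fun w => circle_integral mu (k w)) z (circle_integral mu k').
Proof.
move=> d0 bk' bk q e e0.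
have bz : bounded_density (k z) by rewrite -(addr0 z); apply: bk; rewrite normc0.
have M0 := mass_ge0 mu.
have B0 : 0 < 2 * `|B| * mass mu + 1 by rewrite ltr_wpDl// !mulr_ge0.
exists (Num.min d (e / (2 * `|B| * mass mu + 1))); first by rewrite lt_min d0 divr_gt0.
move=> h; rewrite lt_min ltr_pdivlMr// => /andP[hd he].
have b1 : bounded_density (k (z + h)) by exact: bk.
have b2 := bounded_densityB b1 bz; have b3 := bounded_densityM h bk'.
rewrite -(circle_integralM h bk') -(circle_integralB b1 bz) -(circle_integralB b2 b3).
apply: (@le_trans _ _ (2 * (`|B| * normc h ^+ 2) * mass mu)).
  apply: circle_integral_le.
    exact: bounded_densityB b2 b3.
  by move=> u; apply: le_trans (q h u hd) _; rewrite ler_wpM2r ?sqr_ge0// ler_norm.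
have h0 := normcr_ge0 h.
rewrite (_ : 2 * _ * _ = normc h * (2 * `|B| * mass mu) * normc h); last by ring.
rewrite ler_wpM2r//; apply: le_trans (ltW he); rewrite ler_wpM2l//; lra.
Qed.

Lemma normc_circle (u : T) : normc (circle_val u) = 1.
Proof. by case: u => w /= /eqP. Qed.

Section disc_point.
Variable z : R[i].
Hypothesis z1 : normc z < 1.

Lemma circle_dist u : 1 - normc z <= normc (circle_val u - z).
Proof. by rewrite -(normc_circle u); exact: lerB_normcB. Qed.

Lemma circle_neq u : circle_val u - z != 0.
Proof. by rewrite -normc_gt0; apply: lt_le_trans (circle_dist u); rewrite subr_gt0. Qed.

Lemma normc_invB u : normc (circle_val u - z)^-1 <= (1 - normc z)^-1.
Proof.
have d0 : 0 < 1 - normc z by rewrite subr_gt0.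
rewrite normcV lef_pV2 ?posrE//; first exact: circle_dist.
exact: lt_le_trans d0 (circle_dist u).
Qed.

Lemma measurable_kernel (g : R[i] -> R[i]) : (forall w, w - z != 0 -> exists L, has_cderive g w L) ->
  measurable_fun setT (fun u : T => Re (g (circle_val u))) /\
  measurable_fun setT (fun u : T => Im (g (circle_val u))).
Proof.
move=> dg; apply: (@measurable_circle_continuous R (~` [set z])).
- apply: closed_openC; apply: (@accessible_closed_set1 R[i]^o); apply: hausdorff_accessible.
  exact: (@norm_hausdorff R[i] R[i]^o).
- by move=> u /= uz; have := circle_neq u; rewrite uz subrr eqxx.
- move=> w /= wz; have [|L dL] := dg w; first by rewrite subr_eq0; exact/eqP.
  exact: has_cderive_continuous dL.
Qed.

Lemma inv_shift_has_cderive w : w - z != 0 -> exists L, has_cderive (fun w => (w - z)^-1) w L.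
Proof.
move=> wz; have d := has_cderiveB (has_cderive_id w) (has_cderive_cst z w).
by eexists; exact: (has_cderiveV d wz).
Qed.

Definition herglotz_kernel (u : T) : R[i] := (circle_val u + z) / (circle_val u - z).

Lemma normc2 : normc (2 : R[i]) = 2.
Proof. by rewrite (_ : 2 = (2 : R)%:C) ?normc_real ?ger0_norm//; apply/eqP; rewrite eq_complex /= addr0 !eqxx. Qed.

Lemma herglotz_kernel_bounded : bounded_density herglotz_kernel.
Proof.
have [|m1 m2] := @measurable_kernel (fun w => (w + z) / (w - z)).
  move=> w wz; have [L dL] := inv_shift_has_cderive wz; eexists; apply: has_cderiveM dL.
  by apply: has_cderiveD; [exact: has_cderive_id|exact: has_cderive_cst].
split => //; exists (2 * (1 - normc z)^-1) => u; rewrite normcM.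
apply: ler_pM; rewrite ?normcr_ge0//; last exact: normc_invB.
by apply: le_trans (le_normcD _ _) _; rewrite normc_circle; have := z1; lra.
Qed.

Lemma poisson_deriv_le u : normc (poisson_deriv z (circle_val u)) <= 2 / (1 - normc z) ^+ 2.
Proof.
rewrite !normcM normc2 normc_circle mulr1 ler_wpM2l// expr2 invfM.
by apply: ler_pM; rewrite ?normcr_ge0//; exact: normc_invB.
Qed.

Lemma poisson_deriv_bounded : bounded_density (fun u => poisson_deriv z (circle_val u)).
Proof.
have [|m1 m2] := @measurable_kernel (poisson_deriv z).
  move=> w wz; have [L dL] := inv_shift_has_cderive wz; eexists.
  apply: has_cderiveM; last exact: (has_cderiveM dL dL).
  by apply: has_cderiveM; [exact: has_cderive_cst|exact: has_cderive_id].
split => //; exists (2 / (1 - normc z) ^+ 2) => u; exact: poisson_deriv_le.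
Qed.

(** With [p = (u + z) / (u - z)], [p + 1 = 2 u / (u - z)] and [p - 1 = 2 z / (u - z)], so that
    [4 Re p = |p + 1|^2 - |p - 1|^2 >= 0]. *)
Lemma Re_herglotz_kernel_ge0 u : 0 <= Re (herglotz_kernel u).
Proof.
have uz := circle_neq u; set p := herglotz_kernel u.
have p1 : p + 1 = 2 * circle_val u * (circle_val u - z)^-1 by rewrite /p /herglotz_kernel; field.
have p2 : p - 1 = 2 * z * (circle_val u - z)^-1 by rewrite /p /herglotz_kernel; field.
have h : normc (p - 1) <= normc (p + 1).
  by rewrite p1 p2 !normcM normc2 normc_circle !ler_wpM2r ?normcr_ge0// ler_wpM2l// ltW.
have : normc (p - 1) ^+ 2 <= normc (p + 1) ^+ 2 by rewrite ler_sqr ?nnegrE ?normcr_ge0.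
rewrite !sqr_normcE; case: (p) => x y /=; nra.
Qed.

End disc_point.

Definition herglotz z : R[i] := circle_integral mu (fun u => (circle_val u + z) / (circle_val u - z)).
Definition herglotz_deriv z : R[i] := circle_integral mu (fun u => poisson_deriv z (circle_val u)).

(** [(u + w) / (u - w) = 2 u / (u - w) - 1], and the second difference quotient of the resolvent
    [(u - w)^-1] is bounded away from the circle. *)
Lemma herglotz_has_cderive z : normc z < 1 -> has_cderive herglotz z (herglotz_deriv z).
Proof.
move=> z1; have d0 : 0 < (1 - normc z) / 2 by rewrite divr_gt0// subr_gt0.
have zh h : normc h < (1 - normc z) / 2 -> normc (z + h) < 1.
  by move=> hd; apply: le_lt_trans (le_normcD _ _) _; lra.
apply: (@circle_integral_has_cderive herglotz_kernel _ z _ (4 / (1 - normc z) ^+ 3) d0).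
- exact: poisson_deriv_bounded.
- by move=> h hd; apply: herglotz_kernel_bounded; exact: zh.
move=> h u hd.
have uz := circle_neq z1 u; have uzh := circle_neq (zh h hd) u.
have -> : herglotz_kernel (z + h) u - herglotz_kernel z u - poisson_deriv z (circle_val u) * h =
    2 * circle_val u * ((circle_val u - z)^-1 * ((circle_val u - z)^-1 * (circle_val u - (z + h))^-1)) * (h * h).
  rewrite /herglotz_kernel /poisson_deriv; move: (circle_val u) uz uzh => w w1 w2.
  by field; rewrite w1 w2.
have n1 := normc_invB z1 u.
have n2 : normc (circle_val u - (z + h))^-1 <= 2 / (1 - normc z).
  apply: le_trans (normc_invB (zh h hd) u) _; rewrite -[leRHS]invrK invf_div.
  rewrite lef_pV2 ?posrE// ?subr_gt0 ?zh//; have := le_normcD z h; lra.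
rewrite !normcM normc2 normc_circle mulr1 -expr2 ler_wpM2r ?sqr_ge0//.
have v1 := normcr_ge0 (circle_val u - z)^-1; have v2 := normcr_ge0 (circle_val u - (z + h))^-1.
have h1 := ler_pM v1 v2 n1 n2.
have h2 := ler_pM v1 (mulr_ge0 v1 v2) n1 h1.
rewrite (_ : 4 / _ = 2 * ((1 - normc z)^-1 * ((1 - normc z)^-1 * (2 / (1 - normc z))))).
  by rewrite ler_wpM2l.
have : 1 - normc z != 0 by rewrite gt_eqF// subr_gt0.
by move: (1 - normc z) => x x0; field.
Qed.

Lemma Re_herglotz_ge0 z : normc z < 1 -> 0 <= Re (herglotz z).
Proof. by move=> z1; apply: Rintegral_ge0 => u _; exact: Re_herglotz_kernel_ge0. Qed.

Variable C : R.
Hypothesis C0 : 0 < C.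
Hypothesis hmod : forall t : R, 0 < t -> t < 1 ->
  (modulus_of_smoothness mu t <= (C * (t / Num.sqrt (ln (expR 1 / t))))%:E)%E.

(** For [|z| >= 1 / 2] this is [poisson_deriv_bound_polar], as [delta = 1 - |z|] and [s = 1 - |z|^2]
    satisfy [delta <= s <= 2 delta].  For [|z| < 1 / 2] the kernel is at most [8], whereas
    [s sqrt (lam s) <= s lam s <= 1]. *)
Lemma herglotz_deriv_bound : exists2 C2 : R, 0 <= C2 & forall z, normc z < 1 ->
  normc (herglotz_deriv z) <= C2 / ((1 - normc z ^+ 2) * Num.sqrt (lam (1 - normc z ^+ 2))).
Proof.
have M0 := mass_ge0 mu.
have [A [A0 AE]] : exists A : R, 0 <= A /\ A = 800 * 16384.
  by eexists; split; last reflexivity; exact: mulr_ge0 (ler0n _ _) (ler0n _ _).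
have CM : 0 <= A * (C + mass mu) by rewrite mulr_ge0// addr_ge0// ltW.
exists (2 * (A * (C + mass mu)) + 16 * mass mu); first by lra.
move=> z z1; have n0 := normcr_ge0 z.
have [s sE] : exists s, s = 1 - normc z ^+ 2 by exists (1 - normc z ^+ 2).
have s0 : 0 < s by rewrite sE subr_gt0 expr_lt1.
have s1 : s <= 1 by rewrite sE gerBl sqr_ge0.
rewrite -sE; have ls1 := lam_ge1 s1.
have q0 : 0 < Num.sqrt (lam s) by rewrite sqrtr_gt0 (lt_le_trans ltr01).
have w0 : 0 < s * Num.sqrt (lam s) by rewrite mulr_gt0.
rewrite ler_pdivlMr//.
have [zh|zh] := ltP (normc z) (1 / 2).
  have h1 : normc (herglotz_deriv z) <= 2 * 8 * mass mu.
    apply: (circle_integral_le (poisson_deriv_bounded z1)) => u.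
    apply: le_trans (poisson_deriv_le z1 u) _.
    have d0 : 0 < (1 - normc z) ^+ 2 by rewrite exprn_gt0// subr_gt0.
    by rewrite ler_pdivrMr//; nra.
  have h2 : s * Num.sqrt (lam s) <= 1.
    apply: le_trans (mul_lam_le1 s0); rewrite ler_wpM2l ?(ltW s0)//.
    rewrite -[leRHS]sqr_sqrtr ?(le_trans ler01)// expr2 ler_peMl ?(ltW q0)//.
    by rewrite -sqrtr1 ler_sqrt ?(le_trans ler01).
  have := ler_pM (normcr_ge0 _) (ltW w0) h1 h2; lra.
have d0 : 0 < 1 - normc z by rewrite subr_gt0.
have [d [dE d0']] : exists d, d = 1 - normc z /\ 0 < d by exists (1 - normc z).
have ds : d <= s by rewrite dE sE; nra.
have sd : s <= 2 * d by rewrite dE sE; nra.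
have ld := lam_decr d0' ds.
have p0 : 0 < Num.sqrt (lam d) by rewrite sqrtr_gt0 (lt_le_trans ltr01)// (le_trans ls1).
have qp : Num.sqrt (lam s) <= Num.sqrt (lam d) by rewrite ler_sqrt// (le_trans ler01)// (le_trans ls1).
have [theta zE] := polar_form z.
have h1 : normc (herglotz_deriv z) <= A * (C + mass mu) * (d * Num.sqrt (lam d))^-1.
  have h0 := @poisson_deriv_bound_polar R theta (normc z) zh z1 mu C C0 hmod.
  rewrite -zE -AE -dE in h0; apply: le_trans h0 _.
  rewrite le_eqVlt; apply/orP; left; apply/eqP.
  by field; rewrite !gt_eqF.
have h2 : s * Num.sqrt (lam s) <= 2 * (d * Num.sqrt (lam d)).
  by rewrite mulrA; apply: ler_pM => //; exact: ltW.
have := ler_pM (normcr_ge0 _) (ltW w0) h1 h2.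
rewrite (_ : _ * (2 * _) = 2 * (A * (C + mass mu))); first by lra.
by field; rewrite !gt_eqF.
Qed.

Lemma singular_inner_has_cderive z : normc z < 1 ->
  has_cderive (singular_inner mu) z (cexp (- herglotz z) * - herglotz_deriv z).
Proof.
move=> z1; exact: (has_cderive_comp (has_cderiveN (herglotz_has_cderive z1)) (cexp_derive _)).
Qed.

Lemma normc_singular_inner z : normc z < 1 -> normc (cexp (- herglotz z)) <= 1.
Proof. by move=> z1; rewrite normc_cexp cReN -expR0 ler_expR oppr_le0 Re_herglotz_ge0. Qed.

End herglotz.

(** * Multipliers *)

Section multiplier.
Variable R : realType.
Local Notation Re := (@complex.Re R).
Local Notation Im := (@complex.Im R).
Local Notation T := (circle R).
Local Notation leb := (@lebesgue_measure R).
Local Notation mT := (measurableTypeR R).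
Local Notation mu2 := (leb \x leb)%E.

Lemma disc_set : [set w : R * R | unit_disc (w.1 +i* w.2)] = disc2 (R:=R).
Proof. by apply/seteqP; split => z; rewrite /disc2 /= defect_gt0. Qed.

(** [has_cderive_cderive] in the discs contained in the unit disc. *)
Lemma analytic_cderive (f : R[i] -> R[i]) :
  (forall w, normc w < 1 -> has_cderive f w (cderive f w)) ->
  forall w, normc w < 1 -> has_cderive (cderive f) w (cderive (cderive f) w).
Proof.
move=> df w w1; have r0 : 0 < 1 - normc w by rewrite subr_gt0.
have dfb : cdiff_on (cball w (1 - normc w)) f.
  move=> v; rewrite /cball /= => vw; exists (cderive f v); apply: df.
  by rewrite -(subrK w v); apply: le_lt_trans (le_normcD _ _) _; lra.
have [L dL] := has_cderive_cderive r0 dfb.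
by have [_ ->] := has_cderive_derivable dL.
Qed.

Lemma normc_ptE_continuous z : {for z, continuous (fun z : R * R => normc (pt z))}.
Proof. exact: (normc_pt_continuous (has_cderive_continuous (has_cderive_id (pt z)))). Qed.

Lemma measurable_energy (p : R) (g : R[i] -> R[i]) :
  (forall w, normc w < 1 -> {for w, continuous (g : R[i]^o -> R[i]^o)}) ->
  measurable_fun (@disc2 R : set (mT * mT)) (fun z => (1 - normc (pt z)) `^ (p - 1) * normc (g (pt z)) `^ p).
Proof.
move=> cg; apply: measurable_funM.
  apply: (measurableT_comp (measurable_powR (p - 1))).
  apply: measurable_fun_open_continuous; first exact: disc2_open.
  by move=> z _; apply: pcB; [exact: pcK|exact: normc_ptE_continuous].
apply: (measurableT_comp (measurable_powR p)).
apply: measurable_fun_open_continuous; first exact: disc2_open.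
by move=> z; rewrite /disc2 /= defect_gt0 => zs; apply: normc_pt_continuous; exact: cg.
Qed.

(** The integral in [D_norm], on the set [disc2] used for Green's formula. *)
Definition dirichlet (p : R) (g : R[i] -> R[i]) : \bar R :=
  (\int[mu2]_(z in @disc2 R) ((1 - normc (pt z)) `^ (p - 1) * normc (cderive g (pt z)) `^ p)%:E)%E.

Lemma D_norm_finite (p : R) f : 0 < p -> (D_norm p f < +oo)%E <-> (dirichlet p f < +oo)%E.
Proof.
move=> p0; rewrite /D_norm disc_set /area_measure -/(dirichlet p f); split => [H|H].
  apply: (@lty_poweRy _ _ p^-1); first by rewrite invr_neq0// gt_eqF.
  apply: le_lt_trans H; rewrite leeDr// lee_fin; exact: normcr_ge0.
by rewrite lte_add_pinfty ?ltry//; exact: poweR_lty.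
Qed.

Lemma powR_addr_le (p a b : R) : 0 < p -> 0 <= a -> 0 <= b ->
  (a + b) `^ p <= 2 `^ p * (a `^ p + b `^ p).
Proof.
move=> p0 a0 b0; wlog ab : a b a0 b0 / a <= b.
  move=> H; have [ab|/ltW ba] := leP a b; first exact: H.
  by rewrite (addrC a) (addrC (a `^ p)); exact: H.
apply: (@le_trans _ _ ((2 * b) `^ p)).
  by apply: ge0_ler_powR; rewrite ?nnegrE ?(ltW p0) ?addr_ge0 ?mulr_ge0//; lra.
by rewrite powRM// ler_wpM2l ?powR_ge0// lerDr powR_ge0.
Qed.

Variables (p : R) (mu : {finite_measure set T -> \bar R}) (C : R).
Hypothesis p2 : 2 < p.
Hypothesis C0 : 0 < C.

Hypothesis hmod : forall t : R, 0 < t -> t < 1 ->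
  (modulus_of_smoothness mu t <= (C * (t / Num.sqrt (ln (expR 1 / t))))%:E)%E.

Let p0 : 0 < p.
Proof. by have := p2; lra. Qed.

(** [defect z = (1 - |z|) (1 + |z|) <= 2 (1 - |z|)]. *)
Lemma energy_finite f : (forall w, normc w < 1 -> has_cderive f w (cderive f w)) ->
  (dirichlet p f < +oo)%E ->
  (\int[mu2]_(z in @disc2 R) (defect z `^ (2 * (p / 2) - 1) * normc (cderive f (pt z)) `^ (2 * (p / 2)))%:E < +oo)%E.
Proof.
move=> df fin; have pp := p2.
have -> : 2 * (p / 2) = p by field.
have cF w : normc w < 1 -> {for w, continuous (cderive f : R[i]^o -> R[i]^o)}.
  by move=> /(analytic_cderive df) /has_cderive_continuous.
have mD := @disc2_measurable R.
pose g z := (1 - normc (pt z)) `^ (p - 1) * normc (cderive f (pt z)) `^ p.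
have mg : measurable_fun (@disc2 R : set (mT * mT)) (EFin \o g) by apply/measurable_EFinP; exact: measurable_energy.
have g0 z : 0 <= g z by rewrite mulr_ge0// powR_ge0.
apply: (@le_lt_trans _ _ ((2 `^ (p - 1))%:E * dirichlet p f)%E); last first.
  by apply: lte_mul_pinfty => //; rewrite lee_fin powR_ge0.
have g0' z : disc2 z -> (0 <= (EFin \o g) z)%E by move=> _; rewrite lee_fin; exact: g0.
have k0 : (0 <= (2 `^ (p - 1))%:E :> \bar R)%E by rewrite lee_fin powR_ge0.
rewrite /dirichlet -(ge0_integralZl mu2 mD mg g0' k0).
apply: ge0_le_integral => //.
- by move=> z _; rewrite lee_fin mulr_ge0// powR_ge0.
- apply/measurable_EFinP; apply: measurable_funM.
    apply: (measurableT_comp (measurable_powR (p - 1))).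
    by apply: measurable_fun_open_continuous; [exact: disc2_open|move=> z _; exact: defect_continuous].
  apply: (measurableT_comp (measurable_powR p)).
  apply: measurable_fun_open_continuous; first exact: disc2_open.
  by move=> z; rewrite /disc2 /= defect_gt0 => zs; apply: normc_pt_continuous; exact: cF.
- by apply: measurable_funeM.
move=> z; rewrite /disc2 /= defect_gt0 => zs; rewrite -EFinM lee_fin mulrA ler_wpM2r ?powR_ge0//.
have n0 := normcr_ge0 (pt z).
rewrite -powRM//; last by rewrite subr_ge0 ltW.
have d0 : 0 < defect z by rewrite defect_gt0.
apply: ge0_ler_powR; rewrite ?nnegrE ?(ltW d0)//; first by lra.
- by rewrite mulr_ge0// subr_ge0 ltW.
- by rewrite defect_normc; nra.
Qed.

Let S := singular_inner mu.

(** [(S f)' = S f' + S' f] with [|S| <= 1] and [|S'| <= |H'| <= C2 / (s sqrt (lam s))], while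
    [1 - |z| <= s]: the second term contributes [C2^p s^(p-1) s^-p lam(s)^(-p/2) |f|^p], where
    [|f|^p <= (1 + |f|^2)^(p/2)]. *)
Lemma product_pointwise f : (forall w, normc w < 1 -> has_cderive f w (cderive f w)) ->
  exists2 K : R, 0 <= K & forall z, disc2 z ->
  (1 - normc (pt z)) `^ (p - 1) * normc (cderive (S \* f) (pt z)) `^ p <=
  2 `^ p * ((1 - normc (pt z)) `^ (p - 1) * normc (cderive f (pt z)) `^ p) +
  K * ((defect z)^-1 * lam (defect z) `^ (- (p / 2)) *
    (1 + (Re (f (pt z)) ^+ 2 + Im (f (pt z)) ^+ 2)) `^ (p / 2)).
Proof.
move=> df; have pp := p2.
have [C2 C20 H] := herglotz_deriv_bound C0 hmod.
exists (2 `^ p * C2 `^ p); first by rewrite mulr_ge0 ?powR_ge0.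
move=> z zs; have z1 : normc (pt z) < 1 by rewrite -defect_gt0.
have Sd := singular_inner_has_cderive mu z1.
have [_ ->] := has_cderive_derivable (has_cderiveM Sd (df _ z1)).
have Hz := H _ z1; rewrite -defect_normc in Hz.
have S1 := normc_singular_inner mu z1.
move: zs; rewrite /disc2 /= => s0; have s1 := @defect_le1 R z.
have n0 := normcr_ge0 (pt z).
have l0 := lam_gt0 s1; have rs : 1 - normc (pt z) <= defect z by rewrite defect_normc; nra.
have q0 : 0 < Num.sqrt (lam (defect z)) by rewrite sqrtr_gt0.
have w0 : 0 < defect z * Num.sqrt (lam (defect z)) by rewrite mulr_gt0.
have r0 : 0 <= 1 - normc (pt z) by rewrite subr_ge0 ltW.
rewrite -sqr_normcE; move: (cderive f (pt z)) (f (pt z)) => a b.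
have bound : normc (S (pt z) * a + b * (cexp (- herglotz mu (pt z)) * - herglotz_deriv mu (pt z))) <=
    normc a + C2 / (defect z * Num.sqrt (lam (defect z))) * normc b.
  apply: le_trans (le_normcD _ _) _; apply: lerD.
    by rewrite normcM -[leRHS]mul1r ler_wpM2r ?normcr_ge0.
  rewrite normcM mulrC ler_wpM2r ?normcr_ge0// normcM normcN -[leRHS]mul1r.
  by apply: ler_pM => //; exact: normcr_ge0.
have K0 : 0 <= C2 / (defect z * Num.sqrt (lam (defect z))) by rewrite divr_ge0// ltW.
apply: (@le_trans _ _ ((1 - normc (pt z)) `^ (p - 1) * (2 `^ p * (normc a `^ p +
   (C2 / (defect z * Num.sqrt (lam (defect z))) * normc b) `^ p)))).
  rewrite ler_wpM2l ?powR_ge0//.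
  apply: le_trans (powR_addr_le p0 (normcr_ge0 a) (mulr_ge0 K0 (normcr_ge0 b))).
  apply: ge0_ler_powR bound; rewrite ?nnegrE ?(ltW p0) ?normcr_ge0//.
  by rewrite addr_ge0 ?normcr_ge0// mulr_ge0 ?normcr_ge0.
rewrite mulrDr mulrDr; apply: lerD; first by rewrite mulrCA.
rewrite mulrCA -[leRHS]mulrA ler_wpM2l ?powR_ge0//.
rewrite powRM ?normcr_ge0// powRM ?invr_ge0 ?(ltW w0)//.
apply: (@le_trans _ _ (defect z `^ (p - 1) * (C2 `^ p * (defect z * Num.sqrt (lam (defect z)))^-1 `^ p *
   (1 + normc b ^+ 2) `^ (p / 2)))).
  apply: ler_pM; rewrite ?mulr_ge0 ?powR_ge0//.
    by apply: ge0_ler_powR rs; rewrite ?nnegrE ?(ltW s0)//; lra.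
  rewrite ler_wpM2l ?mulr_ge0 ?powR_ge0//.
  have {1}-> : p = 2 * (p / 2) by field.
  rewrite powRrM powR_mulrn ?normcr_ge0//.
  by apply: ge0_ler_powR; rewrite ?nnegrE ?addr_ge0 ?sqr_ge0// ?lerDr//; lra.
rewrite le_eqVlt; apply/orP; left; apply/eqP.
have -> : (defect z * Num.sqrt (lam (defect z)))^-1 `^ p = defect z `^ (- p) * lam (defect z) `^ (- (p / 2)).
  rewrite -powR_inv1 ?(ltW w0)// -powRrM mulN1r powRM ?(ltW s0) ?(ltW q0)//.
  by rewrite -powR12_sqrt ?(ltW l0)// -powRrM; congr (_ * powR _ _); field.
have -> : (defect z)^-1 = defect z `^ (p - 1) * defect z `^ (- p).
  rewrite -powRD ?(gt_eqF s0) ?implybT// -powR_inv1 ?(ltW s0)//; congr powR; ring.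
by ring.
Qed.

(** Both terms of [product_pointwise] are integrable, the first one by hypothesis and the second one
    by [weighted_finite]. *)
Lemma product_dirichlet f : (forall w, normc w < 1 -> has_cderive f w (cderive f w)) ->
  (dirichlet p f < +oo)%E -> (dirichlet p (S \* f)%R < +oo)%E.
Proof.
move=> df fin.
have df1 := analytic_cderive df.
have q1 : 1 < p / 2 by have := p2; lra.
have W := weighted_finite df df1 (fun w w1 => has_cderive_continuous (analytic_cderive df1 w1)) q1
  (energy_finite df fin).
have [K K0 HK] := product_pointwise df.
have mD := @disc2_measurable R.
have dSf w : normc w < 1 -> has_cderive (S \* f) w (cderive (S \* f) w).
  move=> w1; have d := has_cderiveM (singular_inner_has_cderive mu w1) (df w w1).
  by have [_ ->] := has_cderive_derivable d.
have mE g : (forall w, normc w < 1 -> has_cderive g w (cderive g w)) ->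
    measurable_fun (@disc2 R : set (mT * mT))
      (EFin \o (fun z => (1 - normc (pt z)) `^ (p - 1) * normc (cderive g (pt z)) `^ p)).
  move=> dg; apply/measurable_EFinP; apply: measurable_energy => w w1.
  exact: (has_cderive_continuous (analytic_cderive dg w1)).
have mdens : measurable_fun (@disc2 R : set (mT * mT)) (EFin \o (fun z =>
   (defect z)^-1 * lam (defect z) `^ (- (p / 2)) *
    (1 + (Re (f (pt z)) ^+ 2 + Im (f (pt z)) ^+ 2)) `^ (p / 2))).
  by apply/measurable_EFinP; apply: measurable_density => w w1; exact: (has_cderive_continuous (df w w1)).
pose g1 z := 2 `^ p * ((1 - normc (pt z)) `^ (p - 1) * normc (cderive f (pt z)) `^ p).
pose g2 z := K * ((defect z)^-1 * lam (defect z) `^ (- (p / 2)) *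
    (1 + (Re (f (pt z)) ^+ 2 + Im (f (pt z)) ^+ 2)) `^ (p / 2)).
have mg1 : measurable_fun (@disc2 R : set (mT * mT)) (EFin \o g1).
  by apply/measurable_EFinP; apply: measurable_funM => //; apply/measurable_EFinP; exact: mE.
have mg2 : measurable_fun (@disc2 R : set (mT * mT)) (EFin \o g2).
  by apply/measurable_EFinP; apply: measurable_funM => //; apply/measurable_EFinP.
have g10 z : disc2 z -> 0 <= g1 z by move=> _; rewrite !mulr_ge0 ?powR_ge0.
have g20 z : disc2 z -> 0 <= g2 z.
  by rewrite /disc2 /= => zs; rewrite mulr_ge0// mulr_ge0 ?powR_ge0// mulr_ge0 ?powR_ge0// invr_ge0 ltW.
apply: (@le_lt_trans _ _ (\int[mu2]_(z in @disc2 R) ((g1 z)%:E + (g2 z)%:E))%E).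
  apply: ge0_le_integral; first exact: mD.
  - by move=> z _; rewrite lee_fin mulr_ge0 ?powR_ge0.
  - exact: mE.
  - exact: emeasurable_funD.
  - by move=> z zs; rewrite -EFinD lee_fin; exact: HK.
rewrite ge0_integralD//.
apply: lte_add_pinfty.
  under eq_integral do rewrite /g1 EFinM.
  have e0 z : disc2 z -> (0 <= ((1 - normc (pt z)) `^ (p - 1) * normc (cderive f (pt z)) `^ p)%:E)%E.
    by move=> _; rewrite lee_fin mulr_ge0 ?powR_ge0.
  have k0 : (0 <= (2 `^ p)%:E :> \bar R)%E by rewrite lee_fin powR_ge0.
  by rewrite (ge0_integralZl mu2 mD (mE f df) e0 k0); exact: lte_mul_pinfty.
under eq_integral do rewrite /g2 EFinM.
have e0 z : disc2 z -> (0 <= ((defect z)^-1 * lam (defect z) `^ (- (p / 2)) *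
    (1 + (Re (f (pt z)) ^+ 2 + Im (f (pt z)) ^+ 2)) `^ (p / 2))%:E)%E.
  rewrite /disc2 /= => zs; rewrite lee_fin mulr_ge0 ?powR_ge0// mulr_ge0 ?powR_ge0//.
  by rewrite invr_ge0 ltW.
have k0 : (0 <= K%:E :> \bar R)%E by rewrite lee_fin.
by rewrite (ge0_integralZl mu2 mD mdens e0 k0); exact: lte_mul_pinfty.
Qed.

Lemma singular_inner_multiplier : multiplier (D_space p) S.
Proof.
move=> f [af /(D_norm_finite f p0) fin].
have df w : normc w < 1 -> has_cderive f w (cderive f w).
  by move=> w1; apply: derivable_has_cderive; exact: af.
split; last by apply/(D_norm_finite _ p0); exact: product_dirichlet.
move=> w w1; exact: (has_cderive_derivable (has_cderiveM (singular_inner_has_cderive mu w1) (df w w1))).1.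
Qed.

End multiplier.

Section finite_copy.
Variables (R : realType) (mu : {measure set (circle R) -> \bar R}) (fin : fin_num_fun mu).

(** The finiteness of the measure is a consequence of the hypothesis on its modulus of smoothness; this
    carries the corresponding structure. *)
Definition finite_copy (_ : fin_num_fun mu) : set (circle R) -> \bar R := mu.

HB.instance Definition _ h := Measure.copy (finite_copy h) mu.

HB.instance Definition _ h := Measure_isFinite.Build _ _ _ (finite_copy h) h.

End finite_copy.

Theorem proposition3p3 (R : realType) (p : R)
    (mu : {measure set (circle R) -> \bar R}) (C : R) :
  2 < p ->
  singular_measure mu ->
  0 < C ->
  (forall t : R, 0 < t -> t < 1 ->
     (modulus_of_smoothness mu t <=
        (C * (t / Num.sqrt (ln (expR 1 / t))))%:E)%E) ->
  multiplier (D_space p) (singular_inner mu).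
Proof.
move=> p2 _ C0 hmod.
have mu_fin := circle_measure_finite hmod.
have fin : fin_num_fun mu by exact: lty_fin_num_fun.
exact: (@singular_inner_multiplier R p (finite_copy fin) C p2 C0 hmod).
Qed.
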